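(* For every $0<\kappa\le1$, $$\frac{1}{2(1+32\kappa)}\ \le\ \varepsilon_c(\kappa)\ \le\ \frac12 .$$ Consequently, $\displaystyle\lim_{\kappa\downarrow0}\varepsilon_c(\kappa)=\frac12$.
   Context: Fourier transform on $L^2(\mathbb R)$: $\mathcal F f(\xi)=\int_{\mathbb R}e^{-2\pi i x\xi}f(x)\,dx$, extended to a unitary operator on $L^2(\mathbb R)$. For $\kappa>0$ let $\rho_\kappa(x)=\min\{1,\kappa/|x|\}$ for $x\ne0$, $\rho_\kappa(0)=1$, and $I_x^{(\kappa)}=(x-\rho_\kappa(x),x+\rho_\kappa(x))$. A measurable set $E\subset\mathbb R$ is called $(\varepsilon,\kappa)$-Wolff thin if $|E\cap I_x^{(\kappa)}|\le 2\varepsilon\rho_\kappa(x)$ for all $x\in\mathbb R$ ($|\cdot|$ is Lebesgue measure). For measurable $E,F\subset\mathbb R$, $P_E$ is multiplication by $\mathbf 1_E$ on $L^2(\mathbb R)$ and $Q_F=\mathcal F^{-1}P_F\mathcal F$. For $0<\varepsilon<1$, $$\Theta_\kappa(\varepsilon)=\sup\{\|P_EQ_F\|_{L^2\to L^2}:\ E\text{ and }F\text{ are }(\varepsilon,\kappa)\text{-Wolff thin}\},$$ and $\varepsilon_c(\kappa)=\sup\{\varepsilon\in(0,1):\Theta_\kappa(\varepsilon)<1\}$. *)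

(* Defs.v *)
From HB Require Import structures.
From mathcomp Require Import all_boot all_order all_algebra.
From mathcomp Require Import all_classical all_reals all_analysis.
From mathcomp Require Import complex.

Set Implicit Arguments.
Unset Strict Implicit.
Unset Printing Implicit Defensive.

Import Order.TTheory GRing.Theory Num.Theory.
Import numFieldNormedType.Exports.

Local Open Scope classical_set_scope.
Local Open Scope ring_scope.

(* The real line with the sigma-algebra of Lebesgue (Caratheodory) measurable
   sets; the default structure on [R] only has the Borel sets.  By
   [completed_caratheodory_measurable] these are the unions of a Borel set and
   a negligible set. *)
Definition lebesgueType (R : realType) : Type :=
  caratheodory_type ((@wlength R idfun)^*)%mu.

Section L2.
Variable R : realType.
Local Notation mu := (@completed_lebesgue_measure R).
Implicit Types (f g h : R -> R[i]) (E F : set R).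

Definition cmeasurable f :=
  measurable_fun [set: lebesgueType R] (fun x : lebesgueType R => complex.Re (f x)) /\
  measurable_fun [set: lebesgueType R] (fun x : lebesgueType R => complex.Im (f x)).

Definition cLnorm (p : \bar R) f : \bar R :=
  Lnorm mu p (fun x : lebesgueType R => (Normc.normc (f x))%:E).

(* The elements of [cL p] are functions, not classes modulo equality almost
   everywhere. *)
Definition cL (p : \bar R) : set (R -> R[i]) :=
  [set f | cmeasurable f /\ (cLnorm p f < +oo)%E].

(* Meaningful when the real and imaginary parts are integrable. *)
Definition cintegral f : R[i] :=
  Complex (\int[mu]_x complex.Re (f x)) (\int[mu]_x complex.Im (f x)).

Definition expi (t : R) : R[i] := Complex (cos t) (sin t).

Definition fourier f : R -> R[i] :=
  fun xi => cintegral (fun x => expi (- (2 * pi * x * xi)) * f x).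

(* Graph of the extension by continuity to L^2 of the restriction of [fourier]
   to L^1 \cap L^2. *)
Definition plancherel_graph f g : Prop :=
  cL 2%:E g /\
  exists u : nat -> R -> R[i],
    [/\ forall n, cL 1%:E (u n) /\ cL 2%:E (u n),
        cLnorm 2%:E (u n \- f) @[n --> \oo] --> 0%E &
        cLnorm 2%:E (fourier (u n) \- g) @[n --> \oo] --> 0%E].

(* The values of [plancherel] and [plancherel_inv] are representatives, chosen
   among almost everywhere equal functions. *)
Definition plancherel f : R -> R[i] := xget (cst 0) (plancherel_graph f).

Definition plancherel_inv g : R -> R[i] :=
  xget (cst 0) [set h | cL 2%:E h /\
    {ae mu, forall x : lebesgueType R, plancherel h x = g x}].

Definition Pop E f : R -> R[i] := fun x => (\1_E x)%:C%C * f x.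

Definition Qop F f : R -> R[i] := plancherel_inv (Pop F (plancherel f)).

Definition opnorm2 (T : (R -> R[i]) -> R -> R[i]) : \bar R :=
  ereal_sup [set cLnorm 2%:E (T f) |
             f in [set f | cL 2%:E f /\ (cLnorm 2%:E f <= 1)%E]].

End L2.

Section WolffThin.
Variable R : realType.
Local Notation mu := (@completed_lebesgue_measure R).
Implicit Types (kappa eps x : R).

Definition rho kappa x : R :=
  if x == 0 then 1 else Num.min 1 (kappa / `|x|).

Definition Iwolff kappa x : set R :=
  `]x - rho kappa x, x + rho kappa x[%classic.

Definition wolff_thin eps kappa : set (set R) :=
  [set E | measurable (E : set (lebesgueType R)) /\
    forall x, (mu (E `&` Iwolff kappa x) <= (2 * eps * rho kappa x)%:E)%E].

Definition Theta kappa eps : \bar R :=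
  ereal_sup [set opnorm2 (Pop E \o Qop F) |
             E in wolff_thin eps kappa & F in wolff_thin eps kappa].

Definition eps_c kappa : R :=
  sup [set eps | 0 < eps < 1 /\ (Theta kappa eps < 1)%E].

End WolffThin.

(* Main.v *)
(* Lower bound.  On the dense space of functions p G, with p a polynomial and G the
   standard Gaussian, write p = c + (2 x q - q' / 2 pi) and split p in the halves
   h1 = c/2 + x q and h2 = c/2 + x q - q' / 2 pi.  The Fourier transform exchanges
   the two halves, and |h1 G|^2 decreases away from the origin at rate at most
   |c q| G^2 + 4 pi |x| |h1 h2| G^2.  A thin set E carries at most the fraction eps
   of the mass of a function, up to eps times the integral of its rate of decrease
   against w(x) = sqrt (x^2 + 4 kappa) - x, because the intervals
   (a, sqrt (a^2 + 4 kappa)) are among the intervals I_x.  Since w <= 2 sqrt kappa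
   and x w <= 2 kappa, the part of h1 G on E and the part of the transform of h2 G
   on F have total energy at most eps (1 + 8 pi kappa) ||p G||^2.  If g = Q_F g,
   pairing g with p G -> g bounds the norm of g outside E from below by
   (1 - sqrt (2 eps (1 + 8 pi kappa))) ||g||.

   Upper bound.  A comb of small step has density 1/2 in every interval that is not
   too short, and multiplication by the corresponding sign function +1/-1 sends a
   fixed function to high frequencies.  Doubling a function on a comb thus adds a
   high frequency part to its transform; doubling that part on a comb in a frequency
   annulus adds a part far away in space, and so on.  After n steps one gets a
   function of squared norm of order n carried by a set of density about 1/2, whose
   transform is within a bounded distance of a function carried by such a set. *)
Require Import Defs.
From mathcomp Require Import all_boot all_order all_algebra.
From mathcomp Require Import all_classical all_reals all_analysis.
From mathcomp Require Import measurable_realfun complex ring lra.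
Set Implicit Arguments.
Unset Strict Implicit.
Unset Printing Implicit Defensive.
Import Order.TTheory GRing.Theory Num.Theory.
Import numFieldNormedType.Exports.
Local Open Scope classical_set_scope.
Local Open Scope ring_scope.

(** * Real integrals against the completed Lebesgue measure *)

Section Integral.
Variable R : realType.
Local Notation T := (lebesgueType R).
Local Notation mu := (@completed_lebesgue_measure R).
Local Notation leb := (@lebesgue_measure R).
Implicit Types (f g : R -> R) (c : R).

(** The factor 2 that puts the critical density near 1/2 enters through (u + v)^2 <= 2 (u^2 + v^2),
    where u is the norm of h1 G on E and v that of the transform of h2 G on F. The constant 32 is 8
    pi rounded up by pi <= 4. Nothing is known about the derivative of g, so thinness is tested on
    the functions p G only and reaches g by duality. The term |c q| in the rate of decrease is
    affordable because the splitting loses energy: the squared norms of the two halves fall short of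
    that of p G by multiples of those of c G and q G.

    In the upper bound the error stays bounded while the norm grows, so the ratio of the norm on E
    to the full norm comes as close to 1 as desired.

    The transform is given by the closure of a graph and by chosen representatives. On the functions
    p G it is a linear map of polynomials, so isometry, surjectivity and the conjugation symmetry
    are proved there with ladder operators and extended by density. *)

Definition mf f := measurable_fun [set: T] (f : T -> R).
Definition itg f := mu.-integrable [set: T] (EFin \o (f : T -> R)).
Definition Int f : R := Rintegral mu [set: T] (f : T -> R).

Lemma lebesgue_id_measurable :
  measurable_fun [set: T] (idfun : T -> measurableTypeR R).
Proof.
move=> _ A mA; rewrite setTI; exact: sub_caratheodory.
Qed.

Lemma borel_lebesgue (A : set R) : measurable (A : set (measurableTypeR R)) ->
  measurable (A : set T).
Proof. exact: sub_caratheodory. Qed.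

Lemma mf_borel f : measurable_fun [set: measurableTypeR R] f -> mf f.
Proof.
move=> mf0; exact: (measurableT_comp mf0 lebesgue_id_measurable).
Qed.

Lemma mf_continuous f : continuous f -> mf f.
Proof. by move=> cf; apply: mf_borel; exact: continuous_measurable_fun. Qed.

Lemma itg_mf f : itg f -> mf f.
Proof. by move=> /integrableP[/measurable_EFinP]. Qed.

(** The Borel Lebesgue measure is the image of the completed one under the identity, so results on
    Borel integrals transfer along this map. *)
Lemma ge0_integral_borel (f : R -> \bar R) :
  measurable_fun [set: measurableTypeR R] f -> (forall x, 0 <= f x)%E ->
  (\int[mu]_(x in [set: T]) f x)%E = (\int[leb]_(x in [set: measurableTypeR R]) f x)%E.
Proof.
move=> mf0 f0.
have := @ge0_integral_pushforward _ _ T (measurableTypeR R) R idfun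
  lebesgue_id_measurable mu setT f measurableT mf0 (fun x _ => f0 x).
rewrite preimage_setT => <-.
by apply: eq_measure_integral; first exact: lebesgue_id_measurable.
Qed.

Lemma itg_borel f : leb.-integrable [set: measurableTypeR R] (EFin \o f) -> itg f.
Proof.
move=> /integrableP[mf0 fy]; apply/integrableP; split.
  by apply/measurable_EFinP; apply: mf_borel; exact/measurable_EFinP.
rewrite ge0_integral_borel//.
exact: (measurableT_comp _ mf0).
Qed.

Lemma Int_borel f : leb.-integrable [set: measurableTypeR R] (EFin \o f) ->
  Int f = Rintegral leb [set: measurableTypeR R] f.
Proof.
move=> lf; congr fine.
have itf := itg_borel lf.
have [mf0 _] := integrableP _ _ _ lf.
have := @integral_pushforward _ _ T (measurableTypeR R) R idfun
  lebesgue_id_measurable mu setT (EFin \o f) mf0.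
rewrite preimage_setT => /(_ itf measurableT) <-.
by apply: eq_measure_integral; first exact: lebesgue_id_measurable.
Qed.

Lemma mf_cst c : mf (fun=> c).
Proof. exact: measurable_cst. Qed.

Lemma mfD f g : mf f -> mf g -> mf (fun x => f x + g x).
Proof. exact: measurable_funD. Qed.
Lemma mfB f g : mf f -> mf g -> mf (fun x => f x - g x).
Proof. exact: measurable_funB. Qed.
Lemma mfM f g : mf f -> mf g -> mf (fun x => f x * g x).
Proof. exact: measurable_funM. Qed.
Lemma mfN f : mf f -> mf (fun x => - f x).
Proof. by move=> mf0; apply: (measurableT_comp _ mf0). Qed.
Lemma mf_norm f : mf f -> mf (fun x => `|f x|).
Proof. by move=> mf0; apply: (measurableT_comp _ mf0). Qed.
Lemma mfX n f : mf f -> mf (fun x => f x ^+ n).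
Proof. exact: measurable_funX. Qed.
Lemma mf_indic (A : set R) : measurable (A : set T) -> mf (\1_A).
Proof. exact: measurable_indic. Qed.

Lemma itg_le f g : mf f -> (forall x, `|f x| <= g x) -> itg g -> itg f.
Proof.
move=> mf0 fg ig; apply: (le_integrable measurableT _ _ ig).
  exact/measurable_EFinP.
by move=> x _ /=; rewrite lee_fin (le_trans (fg x)) ?ler_norm.
Qed.

Lemma itg_norm f : itg f -> itg (fun x => `|f x|).
Proof. by move=> /integrable_abse. Qed.
Lemma itgD f g : itg f -> itg g -> itg (fun x => f x + g x).
Proof. by move=> itf itg0; exact: (integrableD _ itf itg0). Qed.
Lemma itgN f : itg f -> itg (fun x => - f x).
Proof. by move=> itf; exact: (integrableN itf). Qed.
Lemma itgB f g : itg f -> itg g -> itg (fun x => f x - g x).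
Proof. by move=> itf itg0; apply: itgD => //; exact: itgN. Qed.
Lemma itgZ c f : itg f -> itg (fun x => c * f x).
Proof. by move=> itf; exact: (integrableZl _ _ itf). Qed.
Lemma itg0 : itg (fun=> 0).
Proof. exact: integrable0. Qed.

Lemma IntD f g : itg f -> itg g -> Int (fun x => f x + g x) = Int f + Int g.
Proof. exact: RintegralD. Qed.
Lemma IntB f g : itg f -> itg g -> Int (fun x => f x - g x) = Int f - Int g.
Proof. exact: RintegralB. Qed.
Lemma IntZ c f : itg f -> Int (fun x => c * f x) = c * Int f.
Proof. by move=> ?; exact: RintegralZl. Qed.
Lemma IntN f : itg f -> Int (fun x => - f x) = - Int f.
Proof.
by move=> itf; rewrite -mulN1r -IntZ//; congr Int; apply/funext => x; rewrite mulN1r.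
Qed.
Lemma Int0 : Int (fun=> 0) = 0.
Proof. by rewrite /Int /Rintegral (integral0 mu). Qed.
Lemma Int_ge0 f : (forall x, 0 <= f x) -> 0 <= Int f.
Proof. by move=> f0; exact: Rintegral_ge0. Qed.
Lemma Int_le f g : itg f -> itg g -> (forall x, f x <= g x) -> Int f <= Int g.
Proof. by move=> itf itg0 fg; apply: le_Rintegral. Qed.
Lemma Int_norm f : itg f -> `|Int f| <= Int (fun x => `|f x|).
Proof. by move=> itf; exact: le_normr_Rintegral. Qed.
Lemma Int_EFin f : itg f -> (\int[mu]_x (f x)%:E)%E = (Int f)%:E.
Proof. by move=> itf; rewrite /Int /Rintegral fineK//; exact: integrable_fin_num. Qed.

Lemma itg_ge0P f : mf f -> (forall x, 0 <= f x) -> (\int[mu]_x (f x)%:E < +oo)%E -> itg f.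
Proof.
move=> mf0 f0 fy; apply/integrableP; split; first exact/measurable_EFinP.
by under eq_integral do rewrite /= ger0_norm//.
Qed.

Lemma Int_dominated (f_ : nat -> R -> R) f h : (forall n, mf (f_ n)) -> mf f ->
  {ae mu, forall x : T, f_ n x @[n --> \oo] --> f x} -> itg h ->
  (forall n x, `|f_ n x| <= h x) ->
  itg f /\ Int (f_ n) @[n --> \oo] --> Int f.
Proof.
move=> mf_ mf0 cf ih fh.
have mE n : measurable_fun [set: T] (EFin \o (f_ n : T -> R)).
  by apply/measurable_EFinP; exact: mf_.
have mE' : measurable_fun [set: T] (EFin \o (f : T -> R)) by exact/measurable_EFinP.
have ca : {ae mu, forall x : T, setT x ->
    (EFin \o (f_ n : T -> R)) x @[n --> \oo] --> (EFin \o (f : T -> R)) x}.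
  by apply: filterS cf => x cx _; apply/cvg_EFin => //; exact: nearW.
have da : {ae mu, forall x (n : nat), setT x ->
    (`|(EFin \o (f_ n : T -> R)) x| <= (EFin \o (h : T -> R)) x)%E}.
  by apply: aeW => x n _ /=; rewrite lee_fin.
have [itf _ cvg] := dominated_convergence measurableT mE mE' ca ih da.
split => //.
have cvg' : (\int[mu]_x (f_ n x)%:E)%E @[n --> \oo] --> (Int f)%:E.
  by rewrite -(Int_EFin itf).
exact: (fine_cvg cvg').
Qed.

Lemma ae_imply (P Q : R -> Prop) : {ae mu, forall x : T, P x} ->
  (forall x, P x -> Q x) -> {ae mu, forall x : T, Q x}.
Proof.
move=> aP PQ; apply: (@filterS _ _ (ae_filter_ringOfSetsType mu) _ _ _ aP) => x.
exact: PQ.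
Qed.

Lemma ae_imply2 (P Q S : R -> Prop) : {ae mu, forall x : T, P x} ->
  {ae mu, forall x : T, Q x} -> (forall x, P x -> Q x -> S x) -> {ae mu, forall x : T, S x}.
Proof.
move=> aP aQ PQ; apply: (@filterS2 _ _ (ae_filter_ringOfSetsType mu) _ _ _ _ aP aQ) => x.
exact: PQ.
Qed.

Lemma ae_eq_Int f g : mf f -> mf g -> {ae mu, forall x : T, f x = g x} -> Int f = Int g.
Proof.
move=> /measurable_EFinP mf0 /measurable_EFinP mg fg; congr fine.
apply: ae_eq_integral.
- exact: measurableT.
- exact: mf0.
- exact: mg.
- by apply: filterS fg => x /= -> _.
Qed.

Lemma ae_itg f g : mf g -> {ae mu, forall x : T, f x = g x} -> itg f -> itg g.
Proof.
move=> /measurable_EFinP mg fg itf; apply/integrableP; split; first exact: mg.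
have /integrableP[mf0] := itf; apply: le_lt_trans.
rewrite le_eqVlt; apply/orP; left; apply/eqP.
apply: ae_eq_integral.
- exact: measurableT.
- exact: (measurableT_comp _ mg).
- exact: (measurableT_comp _ mf0).
- by apply: filterS fg => x /= -> _.
Qed.

Lemma Int_eq0 f : itg f -> (forall x, 0 <= f x) -> Int f = 0 ->
  {ae mu, forall x : T, f x = 0}.
Proof.
move=> itf f0 If.
have mf0 := itg_mf itf.
have /ae_eq_integral_abs H : measurable_fun [set: T] (EFin \o (f : T -> R)).
  exact/measurable_EFinP.
have : (\int[mu]_x `|(EFin \o (f : T -> R)) x|)%E = 0%E.
  under eq_integral do rewrite /= ger0_norm//.
  by rewrite Int_EFin// If.
move/(H mu measurableT); apply: filterS => x /(_ I) /= [].
done.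
Qed.

End Integral.

(** * Complex L^2 functions as a real inner product space *)

Section L2.
Variable R : realType.
Local Notation T := (lebesgueType R).
Local Notation mu := (@completed_lebesgue_measure R).
Local Notation Re := complex.Re.
Local Notation Im := complex.Im.
Implicit Types (f g h : R -> R[i]) (E : set R).

Definition nsq (z : R[i]) : R := Re z ^+ 2 + Im z ^+ 2.
(** The real part of z times the conjugate of w. A real inner product suffices: only norms,
    orthogonality and real duality bounds occur. *)
Definition dot (z w : R[i]) : R := Re z * Re w + Im z * Im w.
Definition ip f g : R := Int (fun x => dot (f x) (g x)).
Definition L2 f := [/\ mf (fun x => Re (f x)), mf (fun x => Im (f x)) &
  itg (fun x => nsq (f x))].
Definition nrm f : R := Num.sqrt (ip f f).

Lemma nsq_ge0 z : 0 <= nsq z.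
Proof. by rewrite addr_ge0// sqr_ge0. Qed.

Lemma dotzz z : dot z z = nsq z.
Proof. by rewrite /dot -!expr2. Qed.

Lemma normc_nsq z : Normc.normc z = Num.sqrt (nsq z).
Proof. by case: z. Qed.

Lemma normc_sqr z : Normc.normc z ^+ 2 = nsq z.
Proof. by rewrite normc_nsq sqr_sqrtr// nsq_ge0. Qed.

Lemma mf_nsq f : mf (fun x => Re (f x)) -> mf (fun x => Im (f x)) ->
  mf (fun x => nsq (f x)).
Proof. by move=> mr mi; apply: mfD; apply: mfX. Qed.

Lemma cLnorm2_integral f : cLnorm 2%:E f =
  ((\int[mu]_x (nsq (f x))%:E) `^ 2^-1)%E.
Proof.
rewrite /cLnorm Lnorm.unlock; congr (_ `^ _)%E; apply: eq_integral => x _.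
by rewrite /= normc_nsq ger0_norm ?sqrtr_ge0// powR_mulrn ?sqrtr_ge0// sqr_sqrtr// nsq_ge0.
Qed.

Lemma L2P f : cL 2%:E f <-> L2 f.
Proof.
rewrite /cL /= cLnorm2_integral; split => [[[mr mi]] ny|[mr mi itf]].
  split => //; apply: itg_ge0P; [exact: mf_nsq|by move=> x; exact: nsq_ge0|].
  rewrite ltey; apply/eqP => iy; move: ny; rewrite iy poweRyr ?ltxx//.
by split=> //; rewrite (Int_EFin itf) poweR_EFin ltry.
Qed.

Lemma ipff f : ip f f = Int (fun x => nsq (f x)).
Proof. by congr Int; apply/funext => x; rewrite dotzz. Qed.

Lemma cLnorm2E f : L2 f -> cLnorm 2%:E f = (nrm f)%:E.
Proof.
move=> [mr mi itf]; rewrite cLnorm2_integral (Int_EFin itf) poweR_EFin.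
congr EFin; rewrite powR12_sqrt//; last by apply: Int_ge0 => x; exact: nsq_ge0.
Qed.

Lemma ip_ge0 f : 0 <= ip f f.
Proof. by rewrite ipff; apply: Int_ge0 => x; exact: nsq_ge0. Qed.

Lemma nrm_ge0 f : 0 <= nrm f.
Proof. exact: sqrtr_ge0. Qed.

Lemma nrm_sqr f : nrm f ^+ 2 = ip f f.
Proof. by rewrite sqr_sqrtr// ip_ge0. Qed.

Lemma dot_le z w : `|dot z w| <= nsq z + nsq w.
Proof.
rewrite /dot /nsq; case: z => a b; case: w => c d /=.
rewrite ler_norml; apply/andP; split.
  have := sqr_ge0 (a + c); have := sqr_ge0 (b + d); have := sqr_ge0 (a - c).
  have := sqr_ge0 (b - d); nra.
have := sqr_ge0 (a + c); have := sqr_ge0 (b + d); have := sqr_ge0 (a - c).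
have := sqr_ge0 (b - d); nra.
Qed.

Lemma itg_dot f g : L2 f -> L2 g -> itg (fun x => dot (f x) (g x)).
Proof.
move=> [fr fi ff] [gr gi gg]; apply: (itg_le _ _ (itgD ff gg)).
  by apply: mfD; apply: mfM.
by move=> x; exact: dot_le.
Qed.

Lemma L20 : L2 (fun=> 0).
Proof.
split; try exact: mf_cst.
rewrite (_ : (fun _ => _) = fun=> 0); first exact: itg0.
by apply/funext => x; rewrite /nsq /= expr0n/= addr0.
Qed.

Lemma L2_le f (k : R -> R) : mf (fun x => Re (f x)) -> mf (fun x => Im (f x)) ->
  itg k -> (forall x, nsq (f x) <= k x) -> L2 f.
Proof.
move=> mr mi ik fk; split => //; apply: (itg_le _ _ ik); first exact: mf_nsq.
by move=> x; rewrite ger0_norm// nsq_ge0.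
Qed.

Lemma nsqD z w : nsq (z + w) <= 2 * (nsq z + nsq w).
Proof.
rewrite /nsq; case: z => a b; case: w => c d /=.
by have := sqr_ge0 (a - c); have := sqr_ge0 (b - d); nra.
Qed.

Lemma nsqN z : nsq (- z) = nsq z.
Proof. by rewrite /nsq; case: z => a b /=; rewrite !sqrrN. Qed.

Lemma nsqM z w : nsq (z * w) = nsq z * nsq w.
Proof. rewrite /nsq; case: z => a b; case: w => c d /=; ring. Qed.

Lemma L2D f g : L2 f -> L2 g -> L2 (f \+ g).
Proof.
move=> [fr fi ff] [gr gi gg]; apply: (@L2_le _ (fun x => 2 * (nsq (f x) + nsq (g x)))).
- rewrite (_ : (fun _ => _) = fun x => Re (f x) + Re (g x)); first exact: mfD.
  by apply/funext => x /=; case: (f x) => ? ?; case: (g x).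
- rewrite (_ : (fun _ => _) = fun x => Im (f x) + Im (g x)); first exact: mfD.
  by apply/funext => x /=; case: (f x) => ? ?; case: (g x).
- by apply: itgZ; exact: itgD.
- by move=> x; exact: nsqD.
Qed.

Lemma L2N f : L2 f -> L2 (fun x => - f x).
Proof.
move=> [fr fi ff]; split.
- rewrite (_ : (fun _ => _) = fun x => - Re (f x)); first exact: mfN.
  by apply/funext => x /=; case: (f x).
- rewrite (_ : (fun _ => _) = fun x => - Im (f x)); first exact: mfN.
  by apply/funext => x /=; case: (f x).
- by under eq_fun do rewrite nsqN.
Qed.

Lemma L2B f g : L2 f -> L2 g -> L2 (f \- g).
Proof. by move=> f2 g2; apply: L2D => //; exact: L2N. Qed.

Lemma L2Z (c : R[i]) f : L2 f -> L2 (fun x => c * f x).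
Proof.
move=> [fr fi ff]; split.
- rewrite (_ : (fun _ => _) = fun x => Re c * Re (f x) - Im c * Im (f x)).
    by apply: mfB; apply: mfM => //; exact: mf_cst.
  by apply/funext => x /=; case: (f x) => ? ?; case: c.
- rewrite (_ : (fun _ => _) = fun x => Re c * Im (f x) + Im c * Re (f x)).
    by apply: mfD; apply: mfM => //; exact: mf_cst.
  by apply/funext => x /=; case: (f x) => ? ?; case: c.
- by under eq_fun do rewrite nsqM; apply: itgZ.
Qed.

Lemma ipC f g : ip f g = ip g f.
Proof. by congr Int; apply/funext => x; rewrite /dot mulrC [X in _ + X]mulrC. Qed.

Lemma dotDl z w v : dot (z + w) v = dot z v + dot w v.
Proof. by case: z => ? ?; case: w => ? ?; rewrite /dot /=; ring. Qed.

Lemma dotNl z v : dot (- z) v = - dot z v.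
Proof. by case: z => ? ?; rewrite /dot /=; ring. Qed.

Lemma ipDl f g h : L2 f -> L2 g -> L2 h -> ip (f \+ g) h = ip f h + ip g h.
Proof.
move=> f2 g2 h2; rewrite -IntD; try exact: itg_dot.
by congr Int; apply/funext => x /=; rewrite dotDl.
Qed.

Lemma ipNl f g : L2 f -> L2 g -> ip (fun x => - f x) g = - ip f g.
Proof.
move=> f2 g2; rewrite -IntN; last exact: itg_dot.
by congr Int; apply/funext => x /=; rewrite dotNl.
Qed.

Lemma ipBl f g h : L2 f -> L2 g -> L2 h -> ip (f \- g) h = ip f h - ip g h.
Proof.
by move=> f2 g2 h2; rewrite -ipNl// -ipDl//; exact: L2N.
Qed.

Lemma ipDr f g h : L2 f -> L2 g -> L2 h -> ip h (f \+ g) = ip h f + ip h g.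
Proof. by move=> *; rewrite ipC ipDl// ![ip h _]ipC. Qed.

Lemma ipBr f g h : L2 f -> L2 g -> L2 h -> ip h (f \- g) = ip h f - ip h g.
Proof. by move=> *; rewrite ipC ipBl// ![ip h _]ipC. Qed.

Lemma ipZl (t : R) f g : L2 f -> L2 g -> ip (fun x => t%:C%C * f x) g = t * ip f g.
Proof.
move=> f2 g2; rewrite -IntZ; last exact: itg_dot.
congr Int; apply/funext => x; rewrite /dot; case: (f x) => a b /=.
by rewrite !mul0r subr0 addr0; ring.
Qed.

Lemma nrmD_sqr f g : L2 f -> L2 g ->
  nrm (f \+ g) ^+ 2 = nrm f ^+ 2 + 2 * ip f g + nrm g ^+ 2.
Proof.
move=> f2 g2; rewrite !nrm_sqr ipDl ?ipDr//; try exact: L2D.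
by rewrite [ip g f]ipC; ring.
Qed.

Lemma nrmB_sqr f g : L2 f -> L2 g ->
  nrm (f \- g) ^+ 2 = nrm f ^+ 2 - 2 * ip f g + nrm g ^+ 2.
Proof.
move=> f2 g2; rewrite !nrm_sqr ipBl ?ipBr//; try exact: L2B.
by rewrite [ip g f]ipC; ring.
Qed.

Lemma ip_le_sqr f g : L2 f -> L2 g -> ip f g ^+ 2 <= ip f f * ip g g.
Proof.
move=> f2 g2; set a := ip f f; set b := ip f g; set c := ip g g.
have H (s t : R) : 0 <= s ^+ 2 * a - 2 * s * t * b + t ^+ 2 * c.
  have fs : L2 (fun x => s%:C%C * f x) by exact: L2Z.
  have gt : L2 (fun x => t%:C%C * g x) by exact: L2Z.
  have := sqr_ge0 (nrm ((fun x => s%:C%C * f x) \- (fun x => t%:C%C * g x))).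
  rewrite nrmB_sqr// !nrm_sqr !ipZl// ![ip _ (fun x => _ * _)]ipC !ipZl//.
  by rewrite [ip g f]ipC -/a -/b -/c; move=> H; apply: le_trans H _; rewrite le_eqVlt; apply/orP; left; apply/eqP; ring.
have a0 : 0 <= a := ip_ge0 f.
have [c0|c0] := eqVneq c 0.
  have [b0|b0] := eqVneq b 0; first by rewrite c0 b0 mulr0 expr0n.
  (* For c = 0 the form is affine in its second variable, and here it takes the value -1. *)
  have := H 1 ((a + 1) / (2 * b)); rewrite c0.
  rewrite (_ : _ + _ = -1) ?ler0N1//.
  by field.
have {}c0 : 0 < c by rewrite lt_neqAle eq_sym c0 ip_ge0.
(* The minimising direction of the form, up to scaling. *)
have := H c b; rewrite (_ : _ - _ + _ = c * (a * c - b ^+ 2)); last by ring.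
by rewrite pmulr_rge0// subr_ge0.
Qed.

Lemma ip_le f g : L2 f -> L2 g -> `|ip f g| <= nrm f * nrm g.
Proof.
move=> f2 g2; rewrite -(ler_sqr) ?nnegrE ?mulr_ge0 ?nrm_ge0//.
by rewrite exprMn !nrm_sqr -normrX ger0_norm ?sqr_ge0// ip_le_sqr.
Qed.

Lemma nrmD f g : L2 f -> L2 g -> nrm (f \+ g) <= nrm f + nrm g.
Proof.
move=> f2 g2; rewrite -(ler_sqr) ?nnegrE ?addr_ge0 ?nrm_ge0//.
rewrite nrmD_sqr//; have := le_trans (ler_norm _) (ip_le f2 g2); nra.
Qed.

Lemma nrmN f : nrm (fun x => - f x) = nrm f.
Proof. by rewrite /nrm !ipff; under eq_fun do rewrite nsqN. Qed.

Lemma nrmBC f g : nrm (f \- g) = nrm (g \- f).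
Proof.
by rewrite -nrmN; congr nrm; apply/funext => x /=; rewrite opprB.
Qed.

Lemma nrm0 : nrm (fun=> 0) = 0.
Proof.
rewrite /nrm ipff (_ : (fun _ => _) = fun=> 0) ?Int0 ?sqrtr0//.
by apply/funext => x; rewrite /nsq /= expr0n/= addr0.
Qed.

Lemma nsq_eq0 z : nsq z = 0 -> z = 0.
Proof.
case: z => a b /eqP; rewrite /nsq /= paddr_eq0 ?sqr_ge0// !sqrf_eq0.
by move=> /andP[/eqP-> /eqP->].
Qed.

Lemma nrm_eq0 f : L2 f -> nrm f = 0 -> {ae mu, forall x : T, f x = 0}.
Proof.
move=> [_ _ ff] nf0.
have : Int (fun x => nsq (f x)) = 0.
  by rewrite -ipff -nrm_sqr nf0 expr0n.
move/(Int_eq0 ff (fun x => nsq_ge0 (f x))); apply: filterS => x.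
exact: nsq_eq0.
Qed.

Lemma ae_nrm f g : L2 f -> L2 g -> {ae mu, forall x : T, f x = g x} -> nrm f = nrm g.
Proof.
move=> [fr fi ff] [gr gi gg] fg; rewrite /nrm !ipff; congr Num.sqrt.
by apply: ae_eq_Int; [exact: mf_nsq|exact: mf_nsq|apply: filterS fg => x ->].
Qed.

Lemma ae_nrmB f g : L2 f -> L2 g -> {ae mu, forall x : T, f x = g x} -> nrm (f \- g) = 0.
Proof.
move=> f2 g2 fg; rewrite -nrm0; apply: ae_nrm; [exact: L2B|exact: L20|].
by apply: filterS fg => x /= ->; rewrite subrr.
Qed.

Lemma nrmB_eq0 f g : L2 f -> L2 g -> nrm (f \- g) = 0 -> {ae mu, forall x : T, f x = g x}.
Proof.
move=> f2 g2 /(nrm_eq0 (L2B f2 g2)); apply: filterS => x /= /eqP.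
by rewrite subr_eq0 => /eqP.
Qed.

Lemma cLnorm_cvg (u : nat -> R -> R[i]) : (forall n, L2 (u n)) ->
  cLnorm 2%:E (u n) @[n --> \oo] --> 0%E <-> nrm (u n) @[n --> \oo] --> 0.
Proof.
move=> u2; split => H.
  have : (nrm (u n))%:E @[n --> \oo] --> 0%:E.
    by under eq_fun do rewrite -cLnorm2E//.
  by move/fine_cvg.
by under eq_fun do rewrite cLnorm2E//; apply/cvg_EFin => //; exact: nearW.
Qed.

Lemma PopE E f x : Pop E f x = if x \in E then f x else 0.
Proof.
rewrite /Pop indicE; case: ifP => _ /=; first by rewrite mul1r.
by rewrite mul0r.
Qed.

Lemma L2_Pop E f : measurable (E : set T) -> L2 f -> L2 (Pop E f).
Proof.
move=> mE [fr fi ff]; apply: (@L2_le _ (fun x => nsq (f x))) => //.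
- rewrite (_ : (fun _ => _) = fun x => \1_E x * Re (f x)).
    by apply: mfM => //; exact: mf_indic.
  by apply/funext => x; rewrite PopE indicE; case: ifP; rewrite (mul1r, mul0r).
- rewrite (_ : (fun _ => _) = fun x => \1_E x * Im (f x)).
    by apply: mfM => //; exact: mf_indic.
  by apply/funext => x; rewrite PopE indicE; case: ifP; rewrite (mul1r, mul0r).
- move=> x; rewrite PopE; case: ifP => // _.
  by rewrite {1}/nsq /= expr0n/= addr0 nsq_ge0.
Qed.

Lemma ip_Pop E f g : ip (Pop E f) g = ip f (Pop E g).
Proof.
congr Int; apply/funext => x; rewrite !PopE; case: ifP => // _.
by rewrite /dot /= !mul0r !mulr0.
Qed.

Lemma PopK E f : Pop E (Pop E f) = Pop E f.
Proof. by apply/funext => x; rewrite !PopE; case: (x \in E). Qed.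

Lemma nrm_Pop_le E f : measurable (E : set T) -> L2 f -> nrm (Pop E f) <= nrm f.
Proof.
move=> mE f2; have [_ _ ff] := f2; have [_ _ pf] := L2_Pop mE f2.
rewrite ler_sqrt ?ip_ge0// !ipff Int_le// => x.
rewrite PopE; case: ifP => // _.
by rewrite {1}/nsq /= expr0n/= addr0 nsq_ge0.
Qed.

Lemma nrm_Pop_compl E f : measurable (E : set T) -> L2 f ->
  nrm (Pop E f) ^+ 2 + nrm (f \- Pop E f) ^+ 2 = nrm f ^+ 2.
Proof.
move=> mE f2; have p2 := L2_Pop mE f2.
rewrite nrmB_sqr// (_ : ip f (Pop E f) = nrm (Pop E f) ^+ 2); first by ring.
by rewrite nrm_sqr ip_Pop PopK.
Qed.

End L2.

(** * Completeness of L^2 *)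

Section Completeness.
Variable R : realType.
Local Notation T := (lebesgueType R).
Local Notation mu := (@completed_lebesgue_measure R).
Local Notation Re := complex.Re.
Local Notation Im := complex.Im.
Local Notation normc := Normc.normc.
Implicit Types (f g : R -> R[i]).

Lemma normc_ge0 (z : R[i]) : 0 <= normc z.
Proof. by rewrite normc_nsq sqrtr_ge0. Qed.

Lemma Re_le_normc (z : R[i]) : `|Re z| <= normc z.
Proof.
rewrite normc_nsq -(@ler_sqr _ `|_|) ?nnegrE ?sqrtr_ge0//.
by rewrite sqr_sqrtr ?nsq_ge0// real_normK ?num_real// lerDl sqr_ge0.
Qed.

Lemma Im_le_normc (z : R[i]) : `|Im z| <= normc z.
Proof.
rewrite normc_nsq -(@ler_sqr _ `|_|) ?nnegrE ?sqrtr_ge0//.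
by rewrite sqr_sqrtr ?nsq_ge0// real_normK ?num_real// lerDr sqr_ge0.
Qed.

Lemma mf_normc f : L2 f -> mf (fun x => normc (f x)).
Proof.
move=> [fr fi _]; under eq_fun do rewrite normc_nsq.
apply: (measurableT_comp (continuous_measurable_fun (@sqrt_continuous R))).
exact: mf_nsq.
Qed.

Lemma L2_normc f : L2 f -> L2 (fun x => (normc (f x))%:C%C).
Proof.
move=> f2; have [fr fi ff] := f2; split.
- exact: mf_normc.
- exact: mf_cst.
- by under eq_fun do rewrite /nsq /= normc_sqr expr0n/= addr0.
Qed.

Lemma nrm_normc f : nrm (fun x => (normc (f x))%:C%C) = nrm f.
Proof.
rewrite /nrm !ipff; congr (Num.sqrt (Int _)); apply/funext => x.
by rewrite /nsq /= normc_sqr expr0n/= addr0.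
Qed.

(** The increments of [s] add up to at most [B - s 0], so the telescoping series of [a] converges
    absolutely. *)
Lemma cvg_bounded_variation (a s : nat -> R) (B : R) :
  (forall n, `|a n.+1 - a n| <= s n.+1 - s n) -> (forall n, s n <= B) -> cvgn a.
Proof.
move=> ad sB.
have H : cvgn (series (telescope a)).
  apply: normed_cvg; apply: nondecreasing_is_cvgn.
    by apply: nondecreasing_series => n _ _; exact: normr_ge0.
  exists (B - s 0%N) => _ [n _ <-].
  apply: (@le_trans _ _ (s n - s 0%N)); last by rewrite lerD2r.
  elim: n => [|n IH]; first by rewrite [leLHS]big_geq// subrr.
  rewrite [leLHS]big_nat_recr//= (le_trans (lerD IH (ad n)))//.
  by rewrite addrC addrA subrK.
have -> : a = (fun n => a 0%N + series (telescope a) n).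
  by apply/funext => n; exact: eq_sum_telescope.
by apply: is_cvgD => //; exact: is_cvg_cst.
Qed.

Lemma cvg_nsq (z : nat -> R[i]) (w : R[i]) :
  Re (z n) @[n --> \oo] --> Re w -> Im (z n) @[n --> \oo] --> Im w ->
  nsq (z n) @[n --> \oo] --> nsq w.
Proof. by move=> zr zi; apply: cvgD; rewrite expr2; under eq_fun do rewrite expr2; exact: cvgM. Qed.

(** The geometric gaps keep the norms of the sums of pointwise increments below 2, so by monotone
    convergence the total is finite almost everywhere. There [g] converges, and the square of the
    total dominates |g n - f|^2. *)
Lemma L2_complete (g : nat -> R -> R[i]) : (forall n, L2 (g n)) ->
  (forall n, nrm (g n.+1 \- g n) <= 2^-1 ^+ n) ->
  exists2 f, L2 f & nrm (g n \- f) @[n --> \oo] --> 0.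
Proof.
move=> g2 gd.
pose d n x := normc (g n.+1 x - g n x).
pose s n x := \sum_(0 <= k < n) d k x.
have d0 n x : 0 <= d n x by exact: normc_ge0.
have sS n x : s n.+1 x = s n x + d n x by rewrite /s big_nat_recr.
have s0 n x : 0 <= s n x by apply: sumr_ge0.
have snd x : {homo s ^~ x : n m / (n <= m)%N >-> n <= m}.
  by apply/nondecreasing_seqP => n; rewrite sS lerDl.
have sL2 n : L2 (fun x => (s n x)%:C%C) /\ nrm (fun x => (s n x)%:C%C) <= 2 * (1 - 2^-1 ^+ n).
  elim: n => [|n [IH1 IH2]].
    rewrite (_ : (fun _ => _) = fun=> 0).
      by split; [exact: L20|rewrite nrm0 expr0 subrr mulr0].
    by apply/funext => x; rewrite /s big_geq.
  have gg := L2B (g2 n.+1) (g2 n).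
  rewrite (_ : (fun _ => _) = (fun x => (s n x)%:C%C) \+ (fun x => (d n x)%:C%C)).
    split; first by apply: L2D => //; exact: (L2_normc gg).
    apply: le_trans (nrmD IH1 (L2_normc gg)) _.
    rewrite nrm_normc (le_trans (lerD IH2 (gd n)))// exprS.
    by rewrite le_eqVlt; apply/orP; left; apply/eqP; field.
  by apply/funext => x /=; rewrite sS rmorphD.
have ms n : mf (s n) by have [[]] := sL2 n.
pose phi n x := s n x ^+ 2.
have phi0 n x : 0 <= phi n x by exact: sqr_ge0.
have mphi n : mf (phi n) by apply: mfX.
have phind x : {homo phi ^~ x : n m / (n <= m)%N >-> n <= m}.
  by move=> n m nm; rewrite /phi ler_sqr ?nnegrE// snd.
pose L x := limn (fun n => (phi n x)%:E).
have cL x : (phi n x)%:E @[n --> \oo] --> L x.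
  by apply: ereal_nondecreasing_is_cvgn => n m nm; rewrite lee_fin phind.
have mE n : measurable_fun [set: T] (fun x : T => (phi n x)%:E).
  by apply/measurable_EFinP; exact: mphi.
have mL : measurable_fun [set: T] (L : T -> \bar R).
  by apply: (emeasurable_fun_cvg (fun n (x : T) => (phi n x)%:E)) => // x _; exact: cL.
have phiL n x : ((phi n x)%:E <= L x)%E.
  apply: lime_ge; first by apply/cvg_ex; exists (L x); exact: cL.
  by exists n => // m /= nm; rewrite lee_fin phind.
have L0 x : (0 <= L x)%E by apply: le_trans (phiL 0%N x); rewrite lee_fin.
have iL : (\int[mu]_x L x <= 4%:E)%E.
  rewrite monotone_convergence//; [|by move=> n x _; rewrite lee_fin|by move=> x _ n m nm; rewrite lee_fin phind].
  apply: lime_le.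
    apply: ereal_nondecreasing_is_cvgn => n m nm; apply: ge0_le_integral => //.
      by move=> x _; rewrite lee_fin.
    by move=> x _; rewrite lee_fin phind.
  apply: nearW => n.
  have [[_ _ iphi] nphi] := sL2 n.
  have phiE : (fun x : R => nsq (s n x)%:C%C) = phi n.
    by apply/funext => x; rewrite /nsq /= expr0n/= addr0.
  rewrite phiE in iphi.
  rewrite (Int_EFin iphi) lee_fin -phiE -ipff -nrm_sqr.
  have e0 : 0 <= 2^-1 ^+ n :> R by rewrite exprn_ge0.
  by have := nrm_ge0 (fun x => (s n x)%:C%C); nra.
pose A := [set x : R | (L x < +oo)%E].
have mA : measurable (A : set T).
  have := mL measurableT _ (emeasurable_itv `]-oo, (+oo)%E[).
  rewrite setTI (_ : _ @^-1` _ = A)//; by apply/seteqP; split => x /=; rewrite in_itv.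
have aeA : {ae mu, forall x : T, A x}.
  have : mu.-integrable [set: T] (L : T -> \bar R).
    apply/integrableP; split => //.
    under eq_integral do rewrite gee0_abs//.
    by rewrite (le_lt_trans iL)// ltry.
  move/(integrable_ae measurableT); apply: filterS => x /(_ Logic.I).
  by rewrite ge0_fin_numE.
have sA x : A x -> exists2 B, (forall n, s n x <= B) & (B ^+ 2)%:E = L x.
  move=> Ax; have Lf : L x \is a fin_num by rewrite ge0_fin_numE.
  have fL0 : 0 <= fine (L x) by exact: fine_ge0.
  exists (Num.sqrt (fine (L x))) => [n|]; last by rewrite sqr_sqrtr// fineK.
  rewrite -(@ler_sqr _ (s n x)) ?nnegrE ?sqrtr_ge0// sqr_sqrtr// -lee_fin fineK//; exact: phiL.
have cRe x : A x -> cvgn (fun n => Re (g n x)).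
  move=> /sA[B sB _]; apply: (@cvg_bounded_variation _ (s ^~ x) B) => // n.
  rewrite sS addrAC subrr add0r -(raddfB (@complex.Re R)); exact: Re_le_normc.
have cIm x : A x -> cvgn (fun n => Im (g n x)).
  move=> /sA[B sB _]; apply: (@cvg_bounded_variation _ (s ^~ x) B) => // n.
  rewrite sS addrAC subrr add0r -(raddfB (@complex.Im R)); exact: Im_le_normc.
(* Outside [A] the sequence may diverge. The limit and the bound are 0 there, and [g n] is replaced
   by [Pop A (g n)], equal to it almost everywhere. *)
pose f x := if x \in A then Complex (limn (fun n => Re (g n x))) (limn (fun n => Im (g n x))) else 0.
pose h x := if x \in A then fine (L x) else 0.
have gf x n : nsq (Pop A (g n) x - f x) <= h x.
  rewrite PopE /f /h; case: ifPn => [|_]; last by rewrite subr0 /nsq /= expr0n/= addr0.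
  rewrite inE => Ax; have [B sB BL] := sA _ Ax.
  rewrite -BL /=.
  have C1 : nsq (g n x - g m x) @[m --> \oo] --> nsq (g n x - Complex (limn (fun n => Re (g n x))) (limn (fun n => Im (g n x)))).
    apply: cvg_nsq.
      rewrite raddfB /=; under eq_fun do rewrite raddfB /=.
      by apply: cvgB; [exact: cvg_cst|exact: cRe].
    rewrite raddfB /=; under eq_fun do rewrite raddfB /=.
    by apply: cvgB; [exact: cvg_cst|exact: cIm].
  apply: (cvgr_to_le C1); exists n => // m /= nm.
  rewrite -normc_sqr ler_sqr ?nnegrE ?normc_ge0//; last exact: le_trans (s0 0%N x) (sB _).
  apply: le_trans (sB m); rewrite -(subnK nm); elim: (m - n)%N => [|k IH].
    by rewrite add0n subrr normc_nsq /nsq/= expr0n/= addr0 sqrtr0 s0.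
  rewrite addSn sS.
  apply: le_trans (_ : normc (g n x - g (k + n)%N x) + normc (g (k + n)%N x - g (k + n).+1 x) <= _).
    by rewrite -{1}(subrK (g (k + n)%N x) (g n x)) -addrA; exact: (@le_normcD R).
  by rewrite lerD// /d !normc_nsq -[in leLHS]nsqN opprB.
have mfun (u : nat -> R -> R) : (forall n, mf (u n)) -> (forall x, A x -> cvgn (u ^~ x)) ->
    mf (fun x => if x \in A then limn (u ^~ x) else 0).
  move=> mu0 cu; apply: (measurable_fun_cvg (h := fun n (x : T) => \1_A x * u n x)).
    by move=> n; apply: mfM => //; exact: mf_indic.
  move=> x _; rewrite indicE; case: ifPn => [|_].
    by rewrite inE => Ax; under eq_fun do rewrite mul1r; exact: cu.
  by under eq_fun do rewrite mul0r; exact: cvg_cst.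
have mh : mf h.
  rewrite (_ : h = fun x => if x \in A then limn (phi ^~ x) else 0).
    apply: mfun => // x Ax; apply: nondecreasing_is_cvgn => //.
    have [B sB _] := sA _ Ax.
    by exists (B ^+ 2) => _ [n _ <-]; rewrite /phi ler_sqr ?nnegrE//; exact: le_trans (s0 0%N x) (sB _).
  apply/funext => x; rewrite /h; case: ifPn => //; rewrite inE => Ax.
  apply/esym/cvg_lim => //; apply: (@fine_cvg _ _ _ _ (fun n => (phi n x)%:E)).
  by rewrite fineK ?ge0_fin_numE//; exact: cL.
have ih : itg h.
  have h0 x : 0 <= h x by rewrite /h; case: ifP => // _; exact: fine_ge0.
  apply: itg_ge0P => //; apply: le_lt_trans (_ : _ <= 4%:E)%E (ltry _).
  apply: le_trans iL; apply: ge0_le_integral.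
  - exact: measurableT.
  - by move=> x _; rewrite lee_fin.
  - by apply/measurable_EFinP; exact: mh.
  - exact: mL.
  - move=> x _; rewrite /h; case: ifPn => [|_ //].
    by rewrite inE => Ax; rewrite fineK// ge0_fin_numE.
have mfr : mf (fun x => Re (f x)).
  rewrite (_ : (fun _ => _) = fun x => if x \in A then limn (fun n => Re (g n x)) else 0).
    by apply: mfun => // n; have [] := g2 n.
  by apply/funext => x; rewrite /f; case: ifP.
have mfi : mf (fun x => Im (f x)).
  rewrite (_ : (fun _ => _) = fun x => if x \in A then limn (fun n => Im (g n x)) else 0).
    by apply: mfun => // n; have [] := g2 n.
  by apply/funext => x; rewrite /f; case: ifP.
have pg2 n : L2 (Pop A (g n)) by exact: L2_Pop.
have f2 : L2 f.
  apply: (@L2_le _ _ (fun x => 2 * (nsq (Pop A (g 0%N) x) + h x))) => //.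
    by apply: itgZ; apply: itgD => //; have [] := pg2 0%N.
  move=> x; rewrite -(subKr (Pop A (g 0%N) x) (f x)).
  by rewrite (le_trans (nsqD _ _))// ler_pM2l// lerD2l nsqN.
exists f => //.
have -> : (fun n => nrm (g n \- f)) = (fun n => Num.sqrt (Int (fun x => nsq (Pop A (g n) x - f x)))).
  apply/funext => n; rewrite -[RHS]/(Num.sqrt (Int (fun x => nsq ((Pop A (g n) \- f) x)))) -ipff.
  have e : {ae mu, forall x : T, (g n \- f) x = (Pop A (g n) \- f) x}.
    by apply: (ae_imply aeA) => x Ax /=; rewrite PopE mem_set.
  exact: (ae_nrm (L2B (g2 n) f2) (L2B (pg2 n) f2) e).
have C0 : Int (fun x => nsq (Pop A (g n) x - f x)) @[n --> \oo] --> (0 : R).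
  rewrite -(Int0 R).
  apply: (proj2 (@Int_dominated _ (fun n x => nsq (Pop A (g n) x - f x)) (fun=> 0) h _ _ _ ih _)).
  - by move=> n; have [? ? _] := L2B (pg2 n) f2; exact: mf_nsq.
  - exact: mf_cst.
  - apply: (ae_imply aeA) => x Ax.
    have -> : 0 = nsq (0 : R[i]) by rewrite /nsq/= expr0n/= addr0.
    apply: cvg_nsq.
      rewrite -[X in _ --> X](subrr (Re (f x))) /=.
      under eq_fun do rewrite raddfB /= PopE mem_set//.
      by apply: cvgB; [rewrite /f mem_set//=; exact: cRe|exact: cvg_cst].
    rewrite -[X in _ --> X](subrr (Im (f x))) /=.
    under eq_fun do rewrite raddfB /= PopE mem_set//.
    by apply: cvgB; [rewrite /f mem_set//=; exact: cIm|exact: cvg_cst].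
  - by move=> n x; rewrite ger0_norm ?nsq_ge0.
rewrite -[X in _ --> X]sqrtr0.
exact: (continuous_cvg _ (@sqrt_continuous R 0) C0).
Qed.

End Completeness.

(** * Calculus of explicit derivatives *)

Section Derivatives.
Variable R : realType.
Implicit Types f g : R -> R.

(** The derivative is carried as a function, so that the rules build it together with the expression
    and [has_deriv_eq] normalises it at the end. *)
Definition has_deriv f (f' : R -> R) := forall x : R, is_derive x 1 f (f' x).

Lemma has_deriv_eq f f' g' : has_deriv f f' -> (forall x, f' x = g' x) -> has_deriv f g'.
Proof. by move=> H e x; rewrite -e. Qed.

Lemma has_deriv_cst c : has_deriv (fun=> c) (fun=> 0).
Proof. by move=> x; exact: is_derive_cst. Qed.

Lemma has_deriv_id : has_deriv (fun x => x) (fun=> 1).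
Proof. by move=> x; exact: is_derive_id. Qed.

Lemma has_derivD f g f' g' : has_deriv f f' -> has_deriv g g' -> has_deriv (fun x => f x + g x) (fun x => f' x + g' x).
Proof. by move=> hf hg x; exact: (is_deriveD (hf x) (hg x)). Qed.

Lemma has_derivN f f' : has_deriv f f' -> has_deriv (fun x => - f x) (fun x => - f' x).
Proof. by move=> hf x; exact: (is_deriveN (hf x)). Qed.

Lemma has_derivM f g f' g' : has_deriv f f' -> has_deriv g g' ->
  has_deriv (fun x => f x * g x) (fun x => f' x * g x + f x * g' x).
Proof.
move=> hf hg x; have := is_deriveM (hf x) (hg x).
have -> : f x *: g' x + g x *: f' x = f' x * g x + f x * g' x.
  by change (f x * g' x + g x * f' x = f' x * g x + f x * g' x); rewrite addrC [g x * _]mulrC.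
exact.
Qed.

Lemma has_derivZ c f f' : has_deriv f f' -> has_deriv (fun x => c * f x) (fun x => c * f' x).
Proof.
move=> hf; apply: (has_deriv_eq (has_derivM (has_deriv_cst c) hf)) => x.
by rewrite mul0r add0r.
Qed.

Lemma has_deriv_comp f g f' g' : has_deriv f f' -> has_deriv g g' -> has_deriv (fun x => f (g x)) (fun x => f' (g x) * g' x).
Proof. by move=> hf hg x; exact: (is_derive1_comp (hf _) (hg x)). Qed.

Lemma has_deriv_cos : has_deriv cos (fun x => - sin x).
Proof. by move=> x; exact: is_derive_cos. Qed.
Lemma has_deriv_sin : has_deriv sin cos.
Proof. by move=> x; exact: is_derive_sin. Qed.
Lemma has_deriv_exp : has_deriv expR expR.
Proof. by move=> x; exact: is_derive_expR. Qed.

Lemma has_deriv_poly (p : {poly R}) : has_deriv (fun x => p.[x]) (fun x => p^`().[x]).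
Proof.
elim/poly_ind: p => [|p c IH].
  rewrite deriv0; under eq_fun do rewrite horner0.
  exact: has_deriv_cst.
have e : (fun x => (p * 'X + c%:P).[x]) = (fun x => p.[x] * x + c).
  by apply/funext => x; rewrite hornerMXaddC.
rewrite e; have h := has_derivD (has_derivM IH has_deriv_id) (has_deriv_cst c); apply: (has_deriv_eq h) => x.
by rewrite mulr1 addr0 derivD derivC addr0 derivM derivX mulr1 hornerD hornerM hornerX.
Qed.

Lemma has_deriv_continuous f f' : has_deriv f f' -> continuous f.
Proof.
move=> hf x; apply: differentiable_continuous; apply/derivable1_diffP.
by case: (hf x).
Qed.

Lemma has_deriv_zero_cst f x y : has_deriv f (fun=> 0) -> f x = f y.
Proof. exact: is_derive_0_is_cst. Qed.

End Derivatives.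

(** * Fundamental theorem of calculus on segments and on the line *)

Section LineIntegral.
Variable R : realType.
Local Notation T := (lebesgueType R).
Local Notation leb := (@lebesgue_measure R).
Implicit Types f : R -> R.

Lemma itv_measurable (i : interval R) : measurable ([set` i] : set T).
Proof. by apply: borel_lebesgue; exact: measurable_itv. Qed.

Lemma Int_itv f F (a b : R) : a <= b -> has_deriv F f -> continuous f ->
  Int (fun x => \1_`[a, b] x * f x) = F b - F a /\ itg (fun x => \1_`[a, b] x * f x).
Proof.
move=> ab hF cf.
have ci : leb.-integrable `[a, b] (EFin \o f).
  apply: continuous_compact_integrable; first exact: segment_compact.
  by apply: continuous_subspaceT.
have e : (fun x => \1_`[a, b] x * f x) = f \_ `[a, b].
  apply/funext => x; rewrite patchE indicE; case: ifP => _; by rewrite ?mul1r ?mul0r.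
have lc : leb.-integrable [set: measurableTypeR R] (EFin \o (fun x => \1_`[a, b] x * f x)).
  have mab : measurable (`[a, b]%classic : set (measurableTypeR R)) by exact: measurable_itv.
  have H := proj1 (integrable_mkcond (EFin \o (f : measurableTypeR R -> R)) mab) ci.
  rewrite restrict_EFin -e in H.
  exact: H.
split; last exact: itg_borel.
rewrite Int_borel// e -Rintegral_mkcond.
move: ab; rewrite le_eqVlt => /predU1P[->|ab].
  by rewrite set_itv1 Rintegral_set1 subrr.
rewrite /Rintegral (@continuous_FTC2 _ f F a b ab)//.
- by apply: continuous_subspaceT.
- split => [x _| |].
  + by case: (hF x).
  + by apply: cvg_at_right_filter; exact: (has_deriv_continuous hF).
  + by apply: cvg_at_left_filter; exact: (has_deriv_continuous hF).
- by move=> x _; rewrite derive1E; apply: derive_val.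
Qed.

Lemma Int_cvg_itv f : itg f ->
  Int (fun x => \1_`[- n%:R, n%:R] x * f x) @[n --> \oo] --> Int f.
Proof.
move=> itf; have mf0 := itg_mf itf.
apply: (proj2 (@Int_dominated _ (fun n x => \1_`[- n%:R, n%:R] x * f x) f
  (fun x => `|f x|) _ mf0 _ (itg_norm itf) _)).
- by move=> n; apply: mfM => //; apply: mf_indic; exact: itv_measurable.
- apply: aeW => x; apply: cvg_near_cst.
  near=> n; rewrite indicE mem_set ?mul1r//= in_itv/= -ler_norml.
  near: n; exact: nbhs_infty_ger.
- move=> n x; rewrite normrM ler_piMl// indicE.
  by case: (_ \in _); rewrite ?normr1 ?normr0.
Unshelve. all: by end_near. Qed.

Lemma Int_derive_eq0 f F : has_deriv F f -> continuous f -> itg f ->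
  F n%:R @[n --> \oo] --> 0 -> F (- n%:R) @[n --> \oo] --> 0 -> Int f = 0.
Proof.
move=> hF cf itf F1 F2.
have H : F n%:R - F (- n%:R) @[n --> \oo] --> (0 : R) - 0 by exact: cvgB.
rewrite subr0 in H.
have H2 := Int_cvg_itv itf.
apply: (cvg_unique _ H2) => //.
suff -> : (fun n : nat => Int (fun x => \1_`[- n%:R, n%:R] x * f x)) =
  (fun n => F n%:R - F (- n%:R)) by [].
apply/funext => n; apply: (proj1 (Int_itv _ hF cf)).
by rewrite (@le_trans _ _ 0)// oppr_le0.
Qed.

End LineIntegral.

(** * Gaussians times polynomials *)

Section Gauss.
Variable R : realType.
Implicit Types (a : R) (p : {poly R}).

Definition ga a (x : R) : R := expR (- (a * x ^+ 2)).
Definition gauss := ga pi.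
Local Notation G := gauss.

Lemma has_deriv_ga a : has_deriv (ga a) (fun x => - (2 * a * x) * ga a x).
Proof.
have h1 := has_derivN (has_derivZ a (has_derivM (@has_deriv_id R) (@has_deriv_id R))).
apply: (has_deriv_eq (has_deriv_comp (@has_deriv_exp R) h1)) => x; rewrite /ga expr2; ring.
Qed.

Lemma ga_gt0 a x : 0 < ga a x. Proof. exact: expR_gt0. Qed.

Lemma gaM a b x : ga a x * ga b x = ga (a + b) x.
Proof. by rewrite /ga -expRD -opprD mulrDl. Qed.

Lemma Int_ga_normal a : 0 < a -> itg (ga a) /\
  Int (ga a) = Num.sqrt (pi / a).
Proof.
move=> a0.
(* The standard deviation of the normal density proportional to [ga a]. *)
pose s := Num.sqrt (2 * a)^-1.
have s0 : 0 < s by rewrite sqrtr_gt0 invr_gt0 mulr_gt0.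
have ss : s ^+ 2 = (2 * a)^-1 by rewrite sqr_sqrtr// invr_ge0 mulr_ge0// ltW.
have pk : normal_peak s = (Num.sqrt (pi / a))^-1.
  by rewrite /normal_peak ss; congr (Num.sqrt _)^-1; field; rewrite gt_eqF.
have sp0 : 0 < Num.sqrt (pi / a) by rewrite sqrtr_gt0 divr_gt0// pi_gt0.
have e : ga a = (fun x => Num.sqrt (pi / a) * normal_pdf 0 s x).
  apply/funext => x; rewrite normal_pdfE ?gt_eqF// pk mulrA mulfV ?mul1r ?gt_eqF//.
  by rewrite /normal_fun subr0 ss /ga; congr expR; field; rewrite gt_eqF.
have li := integrable_normal_pdf 0 s.
have il := itg_borel li.
split; first by rewrite e; exact: itgZ.
rewrite e IntZ// Int_borel// /Rintegral integral_normal_pdf /= mulr1//.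
Qed.

Lemma itg_ga a : 0 < a -> itg (ga a).
Proof. by move=> /Int_ga_normal[]. Qed.

Lemma Int_G : Int G = 1.
Proof. by rewrite (proj2 (Int_ga_normal (pi_gt0 R))) divff ?sqrtr1// gt_eqF// pi_gt0. Qed.

(** Each factor x is paid for with half of the exponent, hence the induction over all [a]. *)
Lemma poly_le_exp p a : 0 < a -> exists2 C, 0 <= C & forall x, `|p.[x]| <= C * expR (a * x ^+ 2).
Proof.
elim/poly_ind: p a => [|p c IH] a a0.
  by exists 0 => // x; rewrite horner0 normr0 mul0r.
have [C C0 Cp] := IH (a / 2) (divr_gt0 a0 (ltr0n _ 2)).
(* With this constant, K (1 + a x^2 / 2) is at least 1 + x^2, hence at least |x|. *)
pose K := 1 + 2 / a.
have K0 : 0 <= K by rewrite addr_ge0// divr_ge0// ltW.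
have Kx x : `|x| <= K * expR (a / 2 * x ^+ 2).
  have h1 := @expR_ge1Dx R (a / 2 * x ^+ 2).
  apply: (@le_trans _ _ (K * (1 + a / 2 * x ^+ 2))); last exact: ler_wpM2l.
  have -> : K * (1 + a / 2 * x ^+ 2) = 1 + x ^+ 2 + 2 / a + a / 2 * x ^+ 2.
    by rewrite /K; field; rewrite gt_eqF.
  have h2 : 0 <= 2 / a by rewrite divr_ge0// ltW.
  have h3 : 0 <= a / 2 * x ^+ 2 by rewrite mulr_ge0 ?sqr_ge0// divr_ge0// ltW.
  have h4 := sqr_ge0 (`|x| - 1).
  have h5 : `|x| ^+ 2 = x ^+ 2 by rewrite -normrX ger0_norm// sqr_ge0.
  have h6 := sqr_ge0 x.
  have : `|x| <= 1 + x ^+ 2 by nra.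
  lra.
exists (C * K + `|c|) => [|x]; first by rewrite addr_ge0// mulr_ge0.
rewrite hornerMXaddC (le_trans (ler_normD _ _))// normrM.
have e1 : 1 <= expR (a * x ^+ 2).
  by rewrite -expR0 ler_expR mulr_ge0 ?sqr_ge0// ltW.
rewrite mulrDl lerD//; last by rewrite ler_peMr.
have -> : expR (a * x ^+ 2) = expR (a / 2 * x ^+ 2) * expR (a / 2 * x ^+ 2).
  by rewrite -expRD; congr expR; field.
by rewrite mulrACA ler_pM.
Qed.

Lemma poly_ga_le p a : 0 < a -> exists2 C, 0 <= C & forall x, `|p.[x] * ga a x| <= C * ga (a / 2) x.
Proof.
move=> a0; have [C C0 Cp] := poly_le_exp p (divr_gt0 a0 (ltr0n _ 2)).
exists C => // x; rewrite normrM (gtr0_norm (ga_gt0 _ _)).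
have -> : ga a x = ga (a / 2) x * ga (a / 2) x by rewrite gaM -splitr.
rewrite mulrA ler_pM2r ?ga_gt0//.
apply: le_trans (ler_wpM2r (ltW (ga_gt0 _ _)) (Cp x)) _.
by rewrite /ga -[C * _ * _]mulrA -expRD subrr expR0 mulr1.
Qed.

Lemma has_deriv_poly_ga p a : has_deriv (fun x => p.[x] * ga a x) (fun x => (p^`() - (2 * a) *: ('X * p)).[x] * ga a x).
Proof.
apply: (has_deriv_eq (has_derivM (has_deriv_poly p) (has_deriv_ga a))) => x; rewrite !(hornerD,hornerN,hornerZ,hornerM,hornerX); ring.
Qed.

Lemma continuous_poly_ga p a : continuous (fun x => p.[x] * ga a x).
Proof. exact: (has_deriv_continuous (has_deriv_poly_ga p a)). Qed.

Lemma itg_poly_ga p a : 0 < a -> itg (fun x => p.[x] * ga a x).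
Proof.
move=> a0; have [C C0 Cp] := poly_ga_le p a0.
apply: (itg_le _ Cp).
  by apply: mf_continuous; exact: continuous_poly_ga.
by apply: itgZ; apply: itg_ga; rewrite divr_gt0.
Qed.

Lemma ga_le_inv a x : 0 < a -> x != 0 -> ga a x <= (a * x ^+ 2)^-1.
Proof.
move=> a0 x0; have y0 : 0 < a * x ^+ 2 by rewrite mulr_gt0// exprn_even_gt0.
rewrite /ga expRN lef_pV2 ?posrE ?expR_gt0//.
by have := expR_ge1Dx (a * x ^+ 2); lra.
Qed.

Lemma ga_cvg0 a : 0 < a -> ga a n%:R @[n --> \oo] --> 0.
Proof.
move=> a0; apply: (@squeeze_cvgr _ _ _ _ (fun=> 0) (fun n : nat => a^-1 * n%:R^-1)).
- near=> n; rewrite ltW ?ga_gt0//=.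
  have n0 : (0 < n)%N by near: n; exact: nbhs_infty_gt.
  have n1 : 1 <= n%:R :> R by rewrite ler1n.
  rewrite (le_trans (ga_le_inv a0 _)) ?pnatr_eq0 -?lt0n//.
  rewrite invfM ler_pM2l ?invr_gt0// lef_pV2 ?posrE ?exprn_gt0 ?ltr0n//.
  by rewrite expr2 ler_peMl.
- exact: cvg_cst.
- rewrite -[X in _ --> X](mulr0 a^-1); apply: cvgM; first exact: cvg_cst.
  apply/cvgrPdist_lt => e e0; near=> n.
  rewrite sub0r normrN ger0_norm ?invr_ge0//.
  have n0 : (0 < n)%N by near: n; exact: nbhs_infty_gt.
  rewrite -(invrK e) ltf_pV2 ?posrE ?invr_gt0 ?ltr0n//.
  near: n; exact: nbhs_infty_gtr.
Unshelve. all: by end_near. Qed.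

Lemma poly_ga_cvg0 p a : 0 < a -> (fun x => p.[x] * ga a x) n%:R @[n --> \oo] --> 0 /\
  (fun x => p.[x] * ga a x) (- n%:R) @[n --> \oo] --> 0.
Proof.
move=> a0; have [C C0 Cp] := poly_ga_le p a0.
have a2 : 0 < a / 2 by rewrite divr_gt0.
have H : C * ga (a / 2) n%:R @[n --> \oo] --> 0.
  by rewrite -[X in _ --> X](mulr0 C); apply: cvgM; [exact: cvg_cst|exact: ga_cvg0].
split; apply: norm_cvg0;
  apply: (@squeeze_cvgr _ _ _ _ (fun=> 0) (fun n : nat => C * ga (a / 2) n%:R)); try exact: cvg_cst; try exact: H.
  by apply: nearW => n; rewrite normr_ge0 Cp.
apply: nearW => n; rewrite normr_ge0 (le_trans (Cp _))//.
by rewrite /ga sqrrN.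
Qed.

(* The boundary terms vanish: [k] will be [1], [cos] or [sin]. *)
Lemma Int_poly_ga_parts p a (k k' : R -> R) : 0 < a -> has_deriv k k' -> continuous k' ->
  (forall x, `|k x| <= 1) -> (exists B, forall x, `|k' x| <= B) ->
  Int (fun x => p^`().[x] * ga a x * k x) - 2 * a * Int (fun x => ('X * p).[x] * ga a x * k x)
  + Int (fun x => p.[x] * ga a x * k' x) = 0.
Proof.
move=> a0 hk ck' k1 [B kB].
have mk : mf k by apply: mf_continuous; exact: has_deriv_continuous hk.
have mk' : mf k' by exact: mf_continuous.
have mp q : mf (fun x => q.[x] * ga a x) by apply: mf_continuous; exact: continuous_poly_ga.
have ik q : itg (fun x => q.[x] * ga a x * k x).
  apply: (itg_le _ _ (itg_norm (itg_poly_ga q a0))); first exact: mfM.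
  by move=> x; rewrite normrM ler_piMr.
have ik' q : itg (fun x => q.[x] * ga a x * k' x).
  apply: (itg_le _ _ (itgZ B (itg_norm (itg_poly_ga q a0)))); first exact: mfM.
  by move=> x; rewrite normrM mulrC ler_wpM2r.
have hF := has_derivM (has_deriv_poly_ga p a) hk.
rewrite -IntZ// -IntB ?itgZ// -IntD ?itgB ?itgZ//.
have [c1 c2] := poly_ga_cvg0 p a0.
rewrite -[RHS](Int_derive_eq0 hF).
- by congr Int; apply/funext => x; rewrite !(hornerD,hornerN,hornerZ,hornerM,hornerX); ring.
- move=> x; apply: cvgD.
    by apply: cvgM; [exact: continuous_poly_ga|exact: (has_deriv_continuous hk)].
  by apply: cvgM; [exact: continuous_poly_ga|exact: ck'].
- by apply: itgD.
- apply: norm_cvg0; apply: (@squeeze_cvgr _ _ _ _ (fun=> 0) (fun n : nat => `|p.[n%:R] * ga a n%:R|)).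
  + by apply: nearW => n; rewrite normr_ge0 normrM ler_piMr.
  + exact: cvg_cst.
  + have h := cvg_norm c1; rewrite normr0 in h; exact: h.
- apply: norm_cvg0; apply: (@squeeze_cvgr _ _ _ _ (fun=> 0) (fun n : nat => `|p.[- n%:R] * ga a (- n%:R)|)).
  + by apply: nearW => n; rewrite normr_ge0 normrM ler_piMr.
  + exact: cvg_cst.
  + have h := cvg_norm c2; rewrite normr0 in h; exact: h.
Qed.

(** Integration by parts with k = 1. For a = 2 pi, where [ga a] is the square of [gauss], it makes
    the ladder operators adjoint. *)
Lemma Int_poly_ga_adjoint p a : 0 < a ->
  2 * a * Int (fun x => ('X * p).[x] * ga a x) = Int (fun x => p^`().[x] * ga a x).
Proof.
move=> a0.
have c0 : continuous (fun _ : R => 0 : R) by exact: cst_continuous.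
have H1 (x : R) : `|1 : R| <= 1 by rewrite normr1.
have H2 : exists B : R, forall x : R, `|0 : R| <= B by exists 0 => x; rewrite normr0.
have := @Int_poly_ga_parts p a (fun=> 1) (fun=> 0) a0 (@has_deriv_cst R 1) c0 H1 H2.
have -> : (fun x => p.[x] * ga a x * 0) = (fun=> 0) by apply/funext => x; rewrite mulr0.
have e q : (fun x => q.[x] * ga a x * 1) = (fun x => q.[x] * ga a x) by apply/funext => x; rewrite mulr1.
by rewrite Int0 addr0 !e => /eqP; rewrite subr_eq0 => /eqP.
Qed.

End Gauss.

(** * Integrable complex functions and Fourier integrals *)

Section L1.
Variable R : realType.
Local Notation mu := (@completed_lebesgue_measure R).
Local Notation Re := complex.Re.
Local Notation Im := complex.Im.
Local Notation normc := Normc.normc.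
Implicit Types (f g : R -> R[i]).

Definition L1 f := itg (fun x => Re (f x)) /\ itg (fun x => Im (f x)).

Lemma normc_le_ReIm (z : R[i]) : normc z <= `|Re z| + `|Im z|.
Proof.
rewrite normc_nsq -(@ler_sqr _ (Num.sqrt _)) ?nnegrE ?sqrtr_ge0 ?addr_ge0//.
rewrite sqr_sqrtr ?nsq_ge0// sqrrD !real_normK ?num_real// /nsq.
by rewrite lerD2r lerDl mulrn_wge0// mulr_ge0.
Qed.

Lemma mf_normc' f : mf (fun x => Re (f x)) -> mf (fun x => Im (f x)) ->
  mf (fun x => normc (f x)).
Proof.
move=> fr fi; under eq_fun do rewrite normc_nsq.
apply: (measurableT_comp (continuous_measurable_fun (@sqrt_continuous R))).
exact: mf_nsq.
Qed.

Lemma L1_normc f : L1 f -> itg (fun x => normc (f x)).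
Proof.
move=> [fr fi]; apply: (itg_le _ _ (itgD (itg_norm fr) (itg_norm fi))).
  by apply: mf_normc'; exact: itg_mf.
by move=> x; rewrite ger0_norm ?normc_ge0// normc_le_ReIm.
Qed.

Lemma L1P f : cL 1%:E f <-> L1 f.
Proof.
rewrite /cL /cLnorm /= Lnorm1.
have E : (\int[mu]_x `|(normc (f x))%:E|)%E = (\int[mu]_x (normc (f x))%:E)%E.
  by apply: eq_integral => x _; rewrite /= ger0_norm ?normc_ge0.
rewrite E; split => [[[mr mi]] ny|f1].
  have H : itg (fun x => normc (f x)).
    by apply: itg_ge0P; [exact: mf_normc'|exact: (fun x => normc_ge0 (f x))|exact: ny].
  split; first by apply: (itg_le _ _ H) => // x; exact: Re_le_normc.
  by apply: (itg_le _ _ H) => // x; exact: Im_le_normc.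
split; first by case: f1 => /itg_mf ? /itg_mf.
by rewrite (Int_EFin (L1_normc f1)) ltry.
Qed.

Lemma ReD (z w : R[i]) : Re (z + w) = Re z + Re w.
Proof. by case: z; case: w. Qed.
Lemma ImD (z w : R[i]) : Im (z + w) = Im z + Im w.
Proof. by case: z; case: w. Qed.
Lemma ReN (z : R[i]) : Re (- z) = - Re z.
Proof. by case: z. Qed.
Lemma ImN (z : R[i]) : Im (- z) = - Im z.
Proof. by case: z. Qed.
Lemma ReM (z w : R[i]) : Re (z * w) = Re z * Re w - Im z * Im w.
Proof. by case: z; case: w. Qed.
Lemma ImM (z w : R[i]) : Im (z * w) = Re z * Im w + Im z * Re w.
Proof. by case: z; case: w. Qed.
Lemma complexE (z w : R[i]) : Re z = Re w -> Im z = Im w -> z = w.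
Proof. by case: z => ? ?; case: w => ? ? /= -> ->. Qed.

Lemma L1D f g : L1 f -> L1 g -> L1 (f \+ g).
Proof.
move=> [fr fi] [gr gi]; split.
  by under eq_fun do rewrite ReD; exact: itgD.
by under eq_fun do rewrite ImD; exact: itgD.
Qed.

Lemma L1Z c f : L1 f -> L1 (fun x => c * f x).
Proof.
move=> [fr fi]; split.
  by under eq_fun do rewrite ReM; apply: itgB; exact: itgZ.
by under eq_fun do rewrite ImM; apply: itgD; exact: itgZ.
Qed.

Lemma L1N f : L1 f -> L1 (fun x => - f x).
Proof. by move=> /(L1Z (-1)); under eq_fun do rewrite mulN1r. Qed.

Lemma L1B f g : L1 f -> L1 g -> L1 (f \- g).
Proof. by move=> f1 g1; apply: L1D => //; exact: L1N. Qed.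

Lemma normc_expi (t : R) : normc (expi t) = 1.
Proof. by rewrite normc_nsq /nsq /= cos2Dsin2 sqrtr1. Qed.

Lemma mf_trig (k : R -> R) (a : R) : continuous k -> mf (fun x => k (- (2 * pi * x * a))).
Proof.
move=> ck; apply: mf_continuous => x.
apply: (continuous_comp (f := fun x => - (2 * pi * x * a))); last exact: ck.
apply: cvgN; apply: cvgM; last exact: cvg_cst.
by apply: cvgM; [exact: cvg_cst|exact: cvg_id].
Qed.

Lemma L1_fourier f xi : L1 f -> L1 (fun x => expi (- (2 * pi * x * xi)) * f x).
Proof.
move=> f1; have [fr fi] := f1; have H := L1_normc f1.
have mc := mf_trig xi (@continuous_cos R); have ms := mf_trig xi (@continuous_sin R).
split; apply: (itg_le _ _ H).
- by under eq_fun do rewrite ReM; apply: mfB; apply: mfM => //; exact: itg_mf.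
- by move=> x; rewrite (le_trans (Re_le_normc _))// Normc.normcM normc_expi mul1r.
- by under eq_fun do rewrite ImM; apply: mfD; apply: mfM => //; exact: itg_mf.
- by move=> x; rewrite (le_trans (Im_le_normc _))// Normc.normcM normc_expi mul1r.
Qed.

Lemma cintegralD f g : L1 f -> L1 g -> cintegral (f \+ g) = cintegral f + cintegral g.
Proof.
move=> [fr fi] [gr gi]; apply: complexE.
  by rewrite ReD /= -[RHS](IntD fr gr); congr Int; apply/funext => x; rewrite ReD.
by rewrite ImD /= -[RHS](IntD fi gi); congr Int; apply/funext => x; rewrite ImD.
Qed.

Lemma cintegralZ c f : L1 f -> cintegral (fun x => c * f x) = c * cintegral f.
Proof.
move=> [fr fi]; apply: complexE.
  rewrite ReM /= -[X in X - _](IntZ _ fr) -[X in _ - X](IntZ _ fi) -IntB ?itgZ//.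
  by congr Int; apply/funext => x; rewrite ReM.
rewrite ImM /= -[X in X + _](IntZ _ fi) -[X in _ + X](IntZ _ fr) -IntD ?itgZ//.
by congr Int; apply/funext => x; rewrite ImM.
Qed.

Lemma fourierD f g xi : L1 f -> L1 g -> fourier (f \+ g) xi = fourier f xi + fourier g xi.
Proof.
move=> f1 g1; rewrite -[RHS](cintegralD (L1_fourier xi f1) (L1_fourier xi g1)).
by congr cintegral; apply/funext => x /=; rewrite mulrDr.
Qed.

Lemma fourierZ c f xi : L1 f -> fourier (fun x => c * f x) xi = c * fourier f xi.
Proof.
move=> f1; rewrite -[RHS](cintegralZ c (L1_fourier xi f1)).
by congr cintegral; apply/funext => x /=; rewrite mulrCA.
Qed.

Lemma fourierB f g xi : L1 f -> L1 g -> fourier (f \- g) xi = fourier f xi - fourier g xi.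
Proof.
move=> f1 g1; rewrite -[- fourier g xi]mulN1r -(fourierZ (-1) xi g1) -fourierD//; last exact: L1Z.
by congr (fourier _ xi); apply/funext => x /=; rewrite mulN1r.
Qed.

Lemma normc_fourier_le f xi : L1 f ->
  `|Re (fourier f xi)| <= Int (fun x => normc (f x)) /\
  `|Im (fourier f xi)| <= Int (fun x => normc (f x)).
Proof.
move=> f1; have [ir ii] := L1_fourier xi f1; have H := L1_normc f1.
split.
  apply: le_trans (Int_norm ir) _; apply: Int_le => //; first exact: itg_norm.
  by move=> x; rewrite (le_trans (Re_le_normc _))// Normc.normcM normc_expi mul1r.
apply: le_trans (Int_norm ii) _; apply: Int_le => //; first exact: itg_norm.
by move=> x; rewrite (le_trans (Im_le_normc _))// Normc.normcM normc_expi mul1r.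
Qed.

End L1.

(** * The Fourier transform of the Gaussian *)

Section GaussFourier.
Variable R : realType.
Local Notation T := (lebesgueType R).
Local Notation mu := (@completed_lebesgue_measure R).
Local Notation G := (@gauss R).
Implicit Types (p : {poly R}).

Lemma has_deriv_Int (f f' : R -> R -> R) (h : R -> R) :
  (forall t, itg (f t)) -> (forall x, has_deriv (f ^~ x) (f' ^~ x)) ->
  itg h -> (forall t x, `|f' t x| <= h x) ->
  has_deriv (fun t => Int (f t)) (fun t => Int (f' t)).
Proof.
move=> itf hf ih fh t.
have h0 x : 0 <= h x by exact: le_trans (normr_ge0 _) (fh 0 x).
(* The bound [h] is uniform in t, so any bounded neighbourhood of t serves. *)
have tI : `]t - 1, t + 1[%classic t by rewrite /= in_itv/= gtrDl ltrN10 ltrDl ltr01.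
have P1 s x : partial1of2 f s x = f' s x.
  by rewrite partial1of2E; exact: (@derive_val _ _ _ _ _ _ _ (hf x s)).
have A1 (x : R) : `]t - 1, t + 1[%classic x -> mu.-integrable [set: T] (EFin \o (f x : T -> R)).
  by move=> _; exact: itf.
have A2 (x : R) (y : T) : `]t - 1, t + 1[%classic x -> [set: T] y -> derivable (fun z : R => f z y) x 1.
  by move=> _ _; case: (hf y x).
have A3 (x : R) (y : T) : `]t - 1, t + 1[%classic x -> [set: T] y -> `|partial1of2 (f : R -> T -> R) x y| <= h y.
  by move=> _ _; rewrite P1.
have D := @derivable_under_integral R _ T mu f setT measurableT t (t - 1) (t + 1) tI A1 A2 h h0 ih A3.
have E := @differentiation_under_integral R _ T mu f setT measurableT t (t - 1) (t + 1) tI A1 A2 h h0 ih A3.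
apply: DeriveDef; first exact: D.
rewrite -derive1E E; congr fine; apply: eq_integral => x _.
by rewrite P1.
Qed.

Definition gcos p (t : R) := Int (fun x => p.[x] * G x * cos (2 * pi * x * t)).
Definition gsin p (t : R) := Int (fun x => p.[x] * G x * sin (2 * pi * x * t)).

Lemma has_deriv_lin (c : R) : has_deriv (fun x : R => c * x) (fun=> c).
Proof. by apply: (has_deriv_eq (has_derivZ c (@has_deriv_id R))) => x; rewrite mulr1. Qed.

Lemma has_deriv_coslin (c : R) : has_deriv (fun x : R => cos (c * x)) (fun x => - c * sin (c * x)).
Proof. by apply: (has_deriv_eq (has_deriv_comp (@has_deriv_cos R) (has_deriv_lin c))) => x; rewrite mulrC mulrN mulNr. Qed.

Lemma has_deriv_sinlin (c : R) : has_deriv (fun x : R => sin (c * x)) (fun x => c * cos (c * x)).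
Proof. by apply: (has_deriv_eq (has_deriv_comp (@has_deriv_sin R) (has_deriv_lin c))) => x; rewrite mulrC. Qed.

Lemma cos_le1_norm (x : R) : `|cos x| <= 1.
Proof. by rewrite ler_norml cos_geN1 cos_le1. Qed.
Lemma sin_le1_norm (x : R) : `|sin x| <= 1.
Proof. by rewrite ler_norml sin_geN1 sin_le1. Qed.

Lemma itg_poly_G p : itg (fun x => p.[x] * G x).
Proof. exact: (itg_poly_ga p (pi_gt0 R)). Qed.

Lemma itg_poly_G_bounded p (k : R -> R) : continuous k -> (forall x, `|k x| <= 1) ->
  itg (fun x => p.[x] * G x * k x).
Proof.
move=> ck k1; apply: (itg_le _ _ (itg_norm (itg_poly_G p))).
  by apply: mfM; apply: mf_continuous => //; exact: continuous_poly_ga.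
by move=> x; rewrite normrM ler_piMr.
Qed.

(** Integration by parts trades the factor x for a derivative of p and a factor t, because G' = -2
    pi x G. With [gsin_parts] this is the real form of the rule [FTX]. *)
Lemma gcos_parts p t : gcos ('X * p) t = (2 * pi)^-1 * gcos p^`() t - t * gsin p t.
Proof.
have pi0 := pi_gt0 R.
have hk := has_deriv_coslin (2 * pi * t).
have ck' : continuous (fun x => - (2 * pi * t) * sin (2 * pi * t * x)).
  move=> x; apply: cvgM; first exact: cvg_cst.
  exact: (has_deriv_continuous (has_deriv_sinlin _)).
have H := Int_poly_ga_parts p pi0 hk ck' (fun x => cos_le1_norm _).
have B : exists B : R, forall x, `|- (2 * pi * t) * sin (2 * pi * t * x)| <= B.
  exists `|- (2 * pi * t)| => x; rewrite normrM ler_piMr// sin_le1_norm//.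
move: H => /(_ B).
have e1 q : Int (fun x => q.[x] * ga pi x * cos (2 * pi * t * x)) = gcos q t.
  by congr Int; apply/funext => x; rewrite [2 * pi * t * x]mulrAC.
have e2 : Int (fun x => p.[x] * ga pi x * (- (2 * pi * t) * sin (2 * pi * t * x))) = - (2 * pi * t) * gsin p t.
  rewrite -IntZ; last first.
    apply: itg_poly_G_bounded (fun x => sin_le1_norm _).
    by apply: has_deriv_continuous; under eq_fun do rewrite mulrAC; exact: has_deriv_sinlin.
  by congr Int; apply/funext => x; rewrite -[G x]/(ga pi x); rewrite [2 * pi * x * t]mulrAC; ring.
rewrite !e1 e2 => H.
have : 2 * pi * gcos ('X * p) t = gcos p^`() t - 2 * pi * t * gsin p t by lra.
move=> {}H; apply: (@mulfI _ (2 * pi)); first by rewrite gt_eqF// mulr_gt0.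
rewrite H mulrBr mulrA divff ?mul1r ?mulrA//.
by rewrite gt_eqF// mulr_gt0.
Qed.

Lemma gsin_parts p t : gsin ('X * p) t = (2 * pi)^-1 * gsin p^`() t + t * gcos p t.
Proof.
have pi0 := pi_gt0 R.
have hk := has_deriv_sinlin (2 * pi * t).
have ck' : continuous (fun x => (2 * pi * t) * cos (2 * pi * t * x)).
  move=> x; apply: cvgM; first exact: cvg_cst.
  exact: (has_deriv_continuous (has_deriv_coslin _)).
have H := Int_poly_ga_parts p pi0 hk ck' (fun x => sin_le1_norm _).
have B : exists B : R, forall x, `|(2 * pi * t) * cos (2 * pi * t * x)| <= B.
  exists `|2 * pi * t| => x; rewrite normrM ler_piMr// cos_le1_norm//.
move: H => /(_ B).
have e1 q : Int (fun x => q.[x] * ga pi x * sin (2 * pi * t * x)) = gsin q t.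
  by congr Int; apply/funext => x; rewrite [2 * pi * t * x]mulrAC.
have e2 : Int (fun x => p.[x] * ga pi x * ((2 * pi * t) * cos (2 * pi * t * x))) = (2 * pi * t) * gcos p t.
  rewrite -IntZ; last first.
    apply: itg_poly_G_bounded (fun x => cos_le1_norm _).
    by apply: has_deriv_continuous; under eq_fun do rewrite mulrAC; exact: has_deriv_coslin.
  by congr Int; apply/funext => x; rewrite -[G x]/(ga pi x); rewrite [2 * pi * x * t]mulrAC; ring.
rewrite !e1 e2 => H.
have : 2 * pi * gsin ('X * p) t = gsin p^`() t + 2 * pi * t * gcos p t by lra.
move=> {}H; apply: (@mulfI _ (2 * pi)); first by rewrite gt_eqF// mulr_gt0.
rewrite H [RHS]mulrDr [in RHS]mulrA divff ?mul1r ?mulrA//.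
by rewrite gt_eqF// mulr_gt0.
Qed.

Lemma gcos_poly0 t : gcos 0 t = 0.
Proof. by rewrite /gcos -[RHS](Int0 R); congr Int; apply/funext => x; rewrite horner0 !mul0r. Qed.
Lemma gsin_poly0 t : gsin 0 t = 0.
Proof. by rewrite /gsin -[RHS](Int0 R); congr Int; apply/funext => x; rewrite horner0 !mul0r. Qed.

Lemma continuous_trig (k k' : R -> R) t : has_deriv k k' -> continuous (fun x => k (2 * pi * x * t)).
Proof.
move=> hk; apply: (@has_deriv_continuous _ _ (fun x => k' (2 * pi * x * t) * (2 * pi * t))).
have h : has_deriv (fun x => 2 * pi * x * t) (fun=> 2 * pi * t).
  by under eq_fun do rewrite mulrAC; exact: has_deriv_lin.
exact: (has_deriv_comp hk h).
Qed.

Lemma itg_poly_cos p t : itg (fun x => p.[x] * G x * cos (2 * pi * x * t)).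
Proof.
apply: (@itg_poly_G_bounded p (fun x => cos (2 * pi * x * t))).
  exact: (@continuous_trig cos _ t (@has_deriv_cos R)).
by move=> x; exact: cos_le1_norm.
Qed.

Lemma itg_poly_sin p t : itg (fun x => p.[x] * G x * sin (2 * pi * x * t)).
Proof.
apply: (@itg_poly_G_bounded p (fun x => sin (2 * pi * x * t))).
  exact: (@continuous_trig sin _ t (@has_deriv_sin R)).
by move=> x; exact: sin_le1_norm.
Qed.

(** The product of y with the reciprocal Gaussian has derivative zero. *)
Lemma has_deriv_gauss_ode (y : R -> R) : has_deriv y (fun t => - (2 * pi * t) * y t) ->
  forall t, y t = y 0 * G t.
Proof.
move=> hy t.
have h := has_derivM hy (has_deriv_ga (- pi)).
have /(has_deriv_zero_cst t 0) : has_deriv (fun x => y x * ga (- pi) x) (fun=> 0).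
  by apply: (has_deriv_eq h) => x; ring.
have g0 : ga (- pi) (0 : R) = 1 by rewrite /ga expr0n/= mulr0 oppr0 expR0.
rewrite g0 mulr1 => <-.
by rewrite -mulrA gaM addNr /ga mul0r oppr0 expR0 mulr1.
Qed.

(** Differentiating under the integral brings out a factor x, and integration by parts turns it into
    t. Both integrals therefore solve y' = -2 pi t y, with values 1 and 0 at the origin. *)
Lemma gauss_transform t : gcos 1 t = G t /\ gsin 1 t = 0.
Proof.
have pi0 := pi_gt0 R.
have hcos : has_deriv (gcos 1) (fun t => - (2 * pi * t) * gcos 1 t).
  have H := @has_deriv_Int (fun t x => (1 : {poly R}).[x] * G x * cos (2 * pi * x * t))
     (fun t x => (1 : {poly R}).[x] * G x * (- (2 * pi * x) * sin (2 * pi * x * t)))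
     (fun x => `|(2 * pi) * (('X : {poly R}).[x] * G x)|).
    apply: (has_deriv_eq (H _ _ _ _)).
  - by move=> s; exact: itg_poly_cos.
  - by move=> x; apply: has_derivZ; exact: has_deriv_coslin.
  - by apply: itg_norm; apply: itgZ; exact: itg_poly_G.
  - move=> s x; rewrite hornerC mul1r hornerX.
    have -> : G x * (- (2 * pi * x) * sin (2 * pi * x * s)) = - (2 * pi * (x * G x)) * sin (2 * pi * x * s) by ring.
    by rewrite normrM normrN ler_piMr// sin_le1_norm.
  - move=> s.
    have := gsin_parts 1 s; rewrite derivC gsin_poly0 mulr0 add0r mulr1 => e.
    have -> : - (2 * pi * s) * gcos 1 s = - (2 * pi) * (s * gcos 1 s) by ring.
    rewrite -e /gsin -IntZ.
      by congr Int; apply/funext => x; rewrite hornerC hornerX; ring.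
    exact: itg_poly_sin.
have hsin : has_deriv (gsin 1) (fun t => - (2 * pi * t) * gsin 1 t).
  have H := @has_deriv_Int (fun t x => (1 : {poly R}).[x] * G x * sin (2 * pi * x * t))
     (fun t x => (1 : {poly R}).[x] * G x * ((2 * pi * x) * cos (2 * pi * x * t)))
     (fun x => `|(2 * pi) * (('X : {poly R}).[x] * G x)|).
  apply: (has_deriv_eq (H _ _ _ _)).
  - by move=> s; exact: itg_poly_sin.
  - by move=> x; apply: has_derivZ; exact: has_deriv_sinlin.
  - by apply: itg_norm; apply: itgZ; exact: itg_poly_G.
  - move=> s x; rewrite hornerC mul1r hornerX.
    have -> : G x * ((2 * pi * x) * cos (2 * pi * x * s)) = (2 * pi * (x * G x)) * cos (2 * pi * x * s) by ring.
    by rewrite normrM ler_piMr// cos_le1_norm.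
  - move=> s.
    have := gcos_parts 1 s; rewrite derivC gcos_poly0 mulr0 add0r mulr1 => e.
    have -> : - (2 * pi * s) * gsin 1 s = 2 * pi * (- (s * gsin 1 s)) by ring.
    rewrite -e /gcos -IntZ.
      by congr Int; apply/funext => x; rewrite hornerC hornerX; ring.
    exact: itg_poly_cos.
rewrite (has_deriv_gauss_ode hcos) (has_deriv_gauss_ode hsin).
have -> : gcos 1 0 = 1.
  rewrite -[RHS](Int_G R); congr Int; apply/funext => x.
  by rewrite hornerC mul1r mulr0 cos0 mulr1.
have -> : gsin 1 0 = 0.
  rewrite -[RHS](Int0 R); congr Int; apply/funext => x.
  by rewrite mulr0 sin0 mulr0.
by rewrite mul1r mul0r.
Qed.

End GaussFourier.

(** * The transform as a linear map of polynomials *)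

Section PolyGauss.
Variable R : realType.
Local Notation Re := complex.Re.
Local Notation Im := complex.Im.
Local Notation C := R[i].
Local Notation G := (@gauss R).
Implicit Types (p q : {poly C}) (a : {poly R}).

Definition pRe p : {poly R} := map_poly (@complex.Re R) p.
Definition pIm p : {poly R} := map_poly (@complex.Im R) p.

Lemma coef_pRe p i : (pRe p)`_i = Re p`_i.
Proof. by rewrite coef_map_id0. Qed.
Lemma coef_pIm p i : (pIm p)`_i = Im p`_i.
Proof. by rewrite coef_map_id0. Qed.

Lemma pRe_MXaddC p c : pRe (p * 'X + c%:P) = pRe p * 'X + (Re c)%:P.
Proof.
apply/polyP => i; rewrite coef_pRe !coefD !coefMX !coefC ReD coef_pRe.
by case: ifP.
Qed.
Lemma pIm_MXaddC p c : pIm (p * 'X + c%:P) = pIm p * 'X + (Im c)%:P.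
Proof.
apply/polyP => i; rewrite coef_pIm !coefD !coefMX !coefC ImD coef_pIm.
by case: ifP.
Qed.

Lemma ReMn (z : C) n : Re (z *+ n) = Re z *+ n.
Proof. by elim: n => // n IH; rewrite !mulrS ReD IH. Qed.
Lemma ImMn (z : C) n : Im (z *+ n) = Im z *+ n.
Proof. by elim: n => // n IH; rewrite !mulrS ImD IH. Qed.

Lemma pRe_deriv p : pRe p^`() = (pRe p)^`().
Proof. by apply/polyP => i; rewrite coef_pRe !coef_deriv ReMn coef_pRe. Qed.
Lemma pIm_deriv p : pIm p^`() = (pIm p)^`().
Proof. by apply/polyP => i; rewrite coef_pIm !coef_deriv ImMn coef_pIm. Qed.

Lemma Re_horner p (x : R) : Re p.[x%:C%C] = (pRe p).[x].
Proof.
elim/poly_ind: p => [|p c IH].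
  by rewrite horner0 (_ : pRe 0 = 0) ?horner0//; apply/polyP => i; rewrite coef_pRe !coef0.
by rewrite pRe_MXaddC !hornerMXaddC ReD ReM /= mulr0 subr0 IH.
Qed.
Lemma Im_horner p (x : R) : Im p.[x%:C%C] = (pIm p).[x].
Proof.
elim/poly_ind: p => [|p c IH].
  by rewrite horner0 (_ : pIm 0 = 0) ?horner0//; apply/polyP => i; rewrite coef_pIm !coef0.
by rewrite pIm_MXaddC !hornerMXaddC ImD ImM /= mulr0 add0r IH.
Qed.

Definition pG p (x : R) : C := p.[x%:C%C] * (G x)%:C%C.

Lemma Re_pG p x : Re (pG p x) = (pRe p).[x] * G x.
Proof. by rewrite /pG ReM /= mulr0 subr0 Re_horner. Qed.
Lemma Im_pG p x : Im (pG p x) = (pIm p).[x] * G x.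
Proof. by rewrite /pG ImM /= mulr0 add0r Im_horner. Qed.

Lemma pGD p q : pG (p + q) = pG p \+ pG q.
Proof. by apply/funext => x; rewrite /pG hornerD mulrDl. Qed.
Lemma pGZ c p : pG (c *: p) = (fun x => c * pG p x).
Proof. by apply/funext => x; rewrite /pG hornerZ mulrA. Qed.
Lemma pGN p : pG (- p) = (fun x => - pG p x).
Proof. by apply/funext => x; rewrite /pG hornerN mulNr. Qed.
Lemma pGB p q : pG (p - q) = pG p \- pG q.
Proof. by apply/funext => x; rewrite pGD pGN. Qed.

Lemma L1_pG p : L1 (pG p).
Proof.
split.
  by under eq_fun do rewrite Re_pG; exact: itg_poly_G.
by under eq_fun do rewrite Im_pG; exact: itg_poly_G.
Qed.

Lemma itg_poly_GG a : itg (fun x => a.[x] * (G x * G x)).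
Proof.
under eq_fun do rewrite -[G _ * G _]/(ga pi _ * ga pi _) gaM.
by apply: itg_poly_ga; rewrite addr_gt0// pi_gt0.
Qed.

Lemma nsq_pG p x : nsq (pG p x) = (pRe p ^+ 2 + pIm p ^+ 2).[x] * (G x * G x).
Proof. by rewrite /nsq Re_pG Im_pG hornerD !horner_exp; ring. Qed.

Lemma L2_pG p : L2 (pG p).
Proof.
have [/itg_mf mr /itg_mf mi] := L1_pG p; split => //.
by under eq_fun do rewrite nsq_pG; exact: itg_poly_GG.
Qed.

Definition c2 : C := ((2 * pi)^-1)%:C%C.
Local Notation ii := ('i%C : C).

(** [hm n] is the factor of G in the transform of x^n G, a rescaled Hermite polynomial. The
    recursion goes back two steps, so consecutive pairs are computed. *)
Fixpoint hpair (n : nat) : {poly C} * {poly C} :=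
  if n is n'.+1 then
    let ab := hpair n' in
    (ab.2, - ii *: ('X * ab.2) + (c2 *+ n) *: ab.1)
  else (1, - ii *: 'X).
Definition hm n := (hpair n).1.

Lemma hm0 : hm 0 = 1. Proof. by []. Qed.
Lemma hm1 : hm 1 = - ii *: 'X. Proof. by []. Qed.
Lemma hmSS n : hm n.+2 = - ii *: ('X * hm n.+1) + (c2 *+ n.+1) *: hm n.
Proof. by []. Qed.
Lemma hmS n : hm n.+1 = - ii *: ('X * hm n) + (c2 *+ n) *: hm n.-1.
Proof. by case: n => [|n]; rewrite ?hmSS// hm1 hm0 mulr1 mulr0n scale0r addr0. Qed.

(** The action of the Fourier transform on the polynomial factor of [pG p], as [fourier_pG]
    shows. *)
Definition FT p : {poly C} := \sum_(i < size p) p`_i *: hm i.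

Lemma FT_wide n p : (size p <= n)%N -> FT p = \sum_(i < n) p`_i *: hm i.
Proof.
move=> pn; rewrite /FT (big_ord_widen n (fun i => p`_i *: hm i) pn) big_mkcond /=.
apply: eq_bigr => i _; case: ifPn => //; rewrite -leqNgt => pi.
by rewrite nth_default// scale0r.
Qed.

Lemma FTD p q : FT (p + q) = FT p + FT q.
Proof.
pose n := maxn (size p) (size q).
rewrite (@FT_wide n (p + q)) ?size_polyD// (@FT_wide n p) ?leq_maxl// (@FT_wide n q) ?leq_maxr//.
by rewrite -big_split /=; apply: eq_bigr => i _; rewrite coefD scalerDl.
Qed.

Lemma FTZ c p : FT (c *: p) = c *: FT p.
Proof.
rewrite (@FT_wide (size p) (c *: p)) ?size_scale_leq//.
by rewrite /FT scaler_sumr; apply: eq_bigr => i _; rewrite coefZ scalerA.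
Qed.

Lemma FTN p : FT (- p) = - FT p.
Proof. by rewrite -scaleN1r FTZ scaleN1r. Qed.

Lemma FTB p q : FT (p - q) = FT p - FT q.
Proof. by rewrite FTD FTN. Qed.

Lemma FT0 : FT 0 = 0.
Proof. by rewrite /FT size_poly0 big_ord0. Qed.

Lemma FTC c : FT c%:P = c%:P.
Proof.
rewrite (@FT_wide 1) ?size_polyC ?leq_b1// big_ord1 coefC eqxx hm0.
by rewrite -mul_polyC mulr1.
Qed.

(** Monomial by monomial this is the recursion [hmS]. It expresses that multiplication by x becomes
    i / (2 pi) times the derivative. *)
Lemma FTX p : FT ('X * p) = - ii *: ('X * FT p) + c2 *: FT p^`().
Proof.
have s1 : (size ('X * p)%R <= (size p).+1)%N.
  by rewrite (leq_trans (size_polyMleq _ _))// size_polyX.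
have s2 : (size p^`() <= size p)%N.
  by apply/leq_sizeP => j pj; rewrite coef_deriv nth_default ?mul0rn// ltnW.
rewrite (FT_wide s1) big_ord_recl coefXM eqxx scale0r add0r.
rewrite (FT_wide (leqnn (size p))).
have -> : FT p^`() = \sum_(i < size p) (p`_i *+ i) *: hm i.-1.
  case E : (size p) => [|n].
    by move/eqP: E; rewrite size_poly_eq0 => /eqP ->; rewrite deriv0 FT0 big_ord0.
  rewrite big_ord_recl mulr0n scale0r add0r.
  rewrite (@FT_wide n); last by rewrite -ltnS -E lt_size_deriv// -size_poly_eq0 E.
  by apply: eq_bigr => i _; rewrite coef_deriv.
rewrite mulr_sumr !scaler_sumr -big_split /=; apply: eq_bigr => i _.
rewrite coefXM /= hmS scalerDr !scalerA -scalerAr scalerA.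
by rewrite add0n [_ * - _]mulrC !mulrnAr [_ * c2]mulrC.
Qed.

(** Expanding by [FTX] leaves derivatives of the transforms of p and of p', hence the induction on
    the size. *)
Lemma FT_deriv p : (FT p)^`() = - ii *: FT p^`().
Proof.
have [n] := ubnP (size p); elim: n p => // n IH p.
elim/poly_ind: p => [|p c _].
  by rewrite deriv0 FT0 deriv0 scaler0.
have [->|p0] := eqVneq p 0.
  by rewrite mul0r add0r FTC !derivC FT0 scaler0.
rewrite size_MXaddC (negPf p0) /= ltnS => pn.
rewrite [p * _]mulrC FTD FTC FTX !derivD !derivC !addr0 !derivZ derivM derivX mul1r.
rewrite (IH p)// derivM derivX mul1r FTD FTX.
have [d0|d0] := eqVneq p^`() 0.
  by rewrite d0 !(FT0, deriv0, scaler0, mulr0, addr0).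
rewrite (IH p^`()); last by rewrite (leq_trans (lt_size_deriv p0)) // ltnW.
rewrite -scalerAr [c2 *: (_ *: _)]scalerA [c2 * _]mulrC -scalerA -scalerDr.
by rewrite -addrA.
Qed.

(** The Fourier integral obeys the same rule for a factor x as [FT] ([X1] against [FTX]), and the
    two agree on constants by [gauss_transform]. The rule also calls p', hence the induction on the
    size. *)
Lemma fourier_pG p xi : fourier (pG p) xi = pG (FT p) xi.
Proof.
have J q : fourier (pG q) xi = Complex (gcos (pRe q) xi + gsin (pIm q) xi) (gcos (pIm q) xi - gsin (pRe q) xi).
  apply: complexE.
    rewrite /= -IntD; [|exact: itg_poly_cos|exact: itg_poly_sin].
    congr Int; apply/funext => x; rewrite ReM /= Re_pG Im_pG cosN sinN; ring.
  rewrite /= -IntB; [|exact: itg_poly_cos|exact: itg_poly_sin].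
  congr Int; apply/funext => x; rewrite ImM /= Re_pG Im_pG cosN sinN; ring.
have X1 q : fourier (pG ('X * q)) xi = - ii * xi%:C%C * fourier (pG q) xi + c2 * fourier (pG q^`()) xi.
  rewrite !J.
  have e1 : pRe ('X * q) = 'X * pRe q.
    by apply/polyP => i; rewrite coef_pRe !coefXM coef_pRe; case: ifP.
  have e2 : pIm ('X * q) = 'X * pIm q.
    by apply/polyP => i; rewrite coef_pIm !coefXM coef_pIm; case: ifP.
  rewrite e1 e2 !gcos_parts !gsin_parts pRe_deriv pIm_deriv.
  rewrite /c2; move: ((2 * pi)^-1) (gcos (pRe q) xi) (gcos (pIm q) xi) (gsin (pRe q) xi) (gsin (pIm q) xi).
  move: (gcos (pRe q)^`() xi) (gcos (pIm q)^`() xi) (gsin (pRe q)^`() xi) (gsin (pIm q)^`() xi) => *.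
  by apply: complexE; rewrite ?(ReD,ImD,ReM,ImM,ReN,ImN) /=; ring.
have [n] := ubnP (size p); elim: n p => // n IH p.
elim/poly_ind: p => [|p c _ pn].
  rewrite FT0 /pG horner0 mul0r => _; rewrite -[RHS](mul0r (fourier (pG 0) xi)).
  rewrite -fourierZ; last exact: L1_pG.
  by congr (fourier _ xi); apply/funext => x; rewrite mul0r horner0 mul0r.
have Cc : fourier (pG c%:P) xi = pG c%:P xi.
  have -> : c%:P = c *: 1 by rewrite -mul_polyC mulr1.
  rewrite !pGZ fourierZ; last exact: L1_pG.
  congr (_ * _); rewrite J.
  have -> : pRe 1 = 1 by apply/polyP => i; rewrite coef_pRe !coef1; case: (i == 0)%N.
  have -> : pIm 1 = 0 by apply/polyP => i; rewrite coef_pIm !coef1 coef0; case: (i == 0)%N.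
  have [-> ->] := gauss_transform xi.
  rewrite gcos_poly0 gsin_poly0 addr0 subr0 /pG hornerC mul1r.
  by [].
rewrite pGD fourierD; [|exact: L1_pG|exact: L1_pG].
rewrite FTD FTC pGD /= Cc; congr (_ + _).
have [->|p0] := eqVneq p 0.
  rewrite mul0r FT0 /pG horner0 mul0r -[RHS](mul0r (fourier (pG 0) xi)).
  rewrite -fourierZ; last exact: L1_pG.
  by congr (fourier _ xi); apply/funext => x; rewrite mul0r horner0 mul0r.
move: pn; rewrite size_MXaddC (negPf p0) /= ltnS => pn.
rewrite mulrC X1 FTX (IH p)// pGD !pGZ /=.
have -> : fourier (pG p^`()) xi = pG (FT p^`()) xi.
  by apply: IH; rewrite (leq_ltn_trans _ pn)// ltnW// lt_size_deriv.
by rewrite /pG hornerM hornerX; ring.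
Qed.

(* [cre] and [ann] are conjugated by the Gaussian: on the functions [pG p] they
   are the operators [x - (2 pi)^-1 d/dx] and [x + (2 pi)^-1 d/dx]. *)
Definition cre p : {poly C} := 2 *: ('X * p) - c2 *: p^`().
Definition ann p : {poly C} := c2 *: p^`().

(** The transform commutes with each ladder operator up to a phase, -i here and i for [ann]. These
    two relations do the work of a Hermite eigenbasis. *)
Lemma FT_cre p : FT (cre p) = - ii *: cre (FT p).
Proof.
rewrite /cre FTB !FTZ FTX FT_deriv scalerBr !scalerDr !scalerA.
have i2 : ii * ii = -1 by rewrite -expr2 sqr_i.
have -> : - ii * c2 * - ii = - c2 by rewrite mulrAC mulrNN i2 mulN1r.
rewrite scaleNr opprK -addrA; congr (_ + _); first by rewrite mulrC.
by rewrite -scalerBl mulr2n mulrDl mul1r addrK.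
Qed.

Lemma FT_ann p : FT (ann p) = ii *: ann (FT p).
Proof.
rewrite /ann FTZ FT_deriv !scalerA.
have i2 : ii * ii = -1 by rewrite -expr2 sqr_i.
by rewrite mulrN mulrAC i2 mulN1r opprK.
Qed.

Lemma creD p q : cre (p + q) = cre p + cre q.
Proof. by rewrite /cre mulrDr derivD !scalerDr opprD addrACA. Qed.

Lemma creZ c p : cre (c *: p) = c *: cre p.
Proof. by rewrite /cre derivZ -scalerAr scalerBr !scalerA ![c * _]mulrC. Qed.

(** The leading term of [cre (a *: 'X^m)] is 2 a X^(m+1), so every nonconstant leading term can be
    removed. The size condition means size q <= size p - 1 with truncated subtraction, which also
    covers p = 0. *)
Lemma cre_decomp p : exists c q, p = c%:P + cre q /\ (size q < (size p).-1.+1)%N.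
Proof.
have [n] := ubnP (size p); elim: n p => // n IH p pn.
have [p1|p1] := leqP (size p) 1.
  exists p`_0, 0; split; last by rewrite size_poly0.
  by rewrite /cre mulr0 deriv0 !scaler0 subr0 addr0; exact: size1_polyC.
pose m := (size p).-2; have sp : size p = m.+2 by rewrite /m; case: (size p) p1 => [|[]].
pose a := lead_coef p / 2.
pose r := p - cre (a *: 'X^m).
have sm : (size (a *: 'X^m) <= m.+1)%N by rewrite (leq_trans (size_scale_leq _ _))// size_polyXn.
have rn : (size r <= m.+1)%N.
  apply/leq_sizeP => j; rewrite leq_eqVlt => /predU1P[<-|mj].
    rewrite coefB /cre coefB !coefZ coefXM /= coefZ coefXn eqxx mulr1 coef_deriv.
    rewrite coefZ coefXn gtn_eqF// mulr0 mul0rn mulr0 subr0.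
    rewrite -[p`_m.+1](_ : lead_coef p = _); last by rewrite lead_coefE sp.
    by rewrite /a mulrCA divff ?mulr1 ?subrr// pnatr_eq0.
  rewrite coefB /cre coefB !coefZ coefXM coef_deriv !coefZ !coefXn.
  rewrite nth_default ?sp// sub0r.
  have -> : (j == 0)%N = false by case: j mj.
  rewrite !gtn_eqF ?mulr0 ?mul0rn ?mulr0 ?subr0 ?oppr0//; last by case: j mj.
  by rewrite (leq_trans (ltnW mj)).
have [c [q [rE qs]]] := IH r (leq_ltn_trans rn (leq_trans (eq_leq (esym sp)) pn)).
exists c, (q + a *: 'X^m); split.
  by rewrite creD addrA -rE /r subrK.
rewrite sp /= ltnS (leq_trans (size_polyD _ _))// geq_max sm andbT.
by rewrite -ltnS (leq_trans qs)// ltnS (leq_trans (leq_pred _)).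
Qed.

(** Integration by parts against G^2, whose logarithmic derivative is -4 pi x. *)
Lemma Int_cre_ann (a b : {poly R}) :
  Int (fun x => (2 *: ('X * a) - (2 * pi)^-1 *: a^`()).[x] * b.[x] * (G x * G x)) =
  Int (fun x => a.[x] * ((2 * pi)^-1 *: b^`()).[x] * (G x * G x)).
Proof.
have pi0 := pi_gt0 R.
have H := Int_poly_ga_adjoint (a * b) (addr_gt0 pi0 pi0).
have e (q : {poly R}) : (fun x : R => q.[x] * ga (pi + pi) x) = (fun x => q.[x] * (G x * G x)).
  by apply/funext => x; rewrite -gaM.
rewrite !e derivM in H.
have e1 : (fun x => (2 *: ('X * a) - (2 * pi)^-1 *: a^`()).[x] * b.[x] * (G x * G x)) =
  (fun x => 2 * (('X * (a * b)).[x] * (G x * G x)) - (2 * pi)^-1 * ((a^`() * b).[x] * (G x * G x))).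
  by apply/funext => x; rewrite !(hornerD,hornerN,hornerZ,hornerM,hornerX); ring.
have e2 : (fun x => a.[x] * ((2 * pi)^-1 *: b^`()).[x] * (G x * G x)) =
  (fun x => (2 * pi)^-1 * ((a * b^`()).[x] * (G x * G x))).
  by apply/funext => x; rewrite !(hornerD,hornerN,hornerZ,hornerM,hornerX); ring.
rewrite e1 e2 IntB ?itgZ ?itg_poly_GG//.
rewrite !IntZ ?itg_poly_GG//.
have e3 : (fun x => (a^`() * b + a * b^`()).[x] * (G x * G x)) =
  (fun x => (a^`() * b).[x] * (G x * G x) + (a * b^`()).[x] * (G x * G x)).
  by apply/funext => x; rewrite hornerD mulrDl.
rewrite e3 IntD ?itg_poly_GG// in H.
move: H; set I1 := Int _; set I2 := Int _; set I3 := Int _ => H.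
apply/eqP; rewrite -subr_eq0; apply/eqP.
transitivity ((2 * pi)^-1 * (2 * (pi + pi) * I1 - (I2 + I3))); last by rewrite H subrr mulr0.
have pn0 : (pi : R) != 0 by rewrite gt_eqF.
clearbody I1 I2 I3; clear e e1 e2 e3 pi0; move: (pi : R) pn0 H => c c0 H.
by field.
Qed.

Lemma pRe_scaler (r : R) p : pRe (r%:C%C *: p) = r *: pRe p.
Proof. by apply/polyP => i; rewrite coef_pRe !coefZ coef_pRe ReM /= mul0r subr0. Qed.
Lemma pIm_scaler (r : R) p : pIm (r%:C%C *: p) = r *: pIm p.
Proof. by apply/polyP => i; rewrite coef_pIm !coefZ coef_pIm ImM /= mul0r addr0. Qed.
Lemma pReB p q : pRe (p - q) = pRe p - pRe q.
Proof. by apply/polyP => i; rewrite !(coef_pRe,coefB) ReD ReN. Qed.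
Lemma pImB p q : pIm (p - q) = pIm p - pIm q.
Proof. by apply/polyP => i; rewrite !(coef_pIm,coefB) ImD ImN. Qed.
Lemma pReX p : pRe ('X * p) = 'X * pRe p.
Proof. by apply/polyP => i; rewrite coef_pRe !coefXM coef_pRe; case: ifP. Qed.
Lemma pImX p : pIm ('X * p) = 'X * pIm p.
Proof. by apply/polyP => i; rewrite coef_pIm !coefXM coef_pIm; case: ifP. Qed.

Lemma two_complex : (2 : C) = (2 : R)%:C%C.
Proof. by rewrite rmorphMn rmorph1. Qed.

Lemma pRe_cre p : pRe (cre p) = 2 *: ('X * pRe p) - (2 * pi)^-1 *: (pRe p)^`().
Proof. by rewrite /cre two_complex pReB !pRe_scaler pReX pRe_deriv. Qed.
Lemma pIm_cre p : pIm (cre p) = 2 *: ('X * pIm p) - (2 * pi)^-1 *: (pIm p)^`().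
Proof. by rewrite /cre two_complex pImB !pIm_scaler pImX pIm_deriv. Qed.

Lemma ip_cre_ann p q : ip (pG (cre p)) (pG q) = ip (pG p) (pG (ann q)).
Proof.
have s (a b c d : {poly R}) : Int (fun x => a.[x] * b.[x] * (G x * G x) + c.[x] * d.[x] * (G x * G x)) =
  Int (fun x => a.[x] * b.[x] * (G x * G x)) + Int (fun x => c.[x] * d.[x] * (G x * G x)).
  by rewrite IntD//; under eq_fun do rewrite -hornerM; exact: itg_poly_GG.
have d u v : ip (pG u) (pG v) = Int (fun x => (pRe u).[x] * (pRe v).[x] * (G x * G x)) + Int (fun x => (pIm u).[x] * (pIm v).[x] * (G x * G x)).
  by rewrite -s; congr Int; apply/funext => x; rewrite /dot !Re_pG !Im_pG; ring.
rewrite !d pRe_cre pIm_cre !Int_cre_ann /ann pRe_scaler pIm_scaler.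
by rewrite pRe_deriv pIm_deriv.
Qed.

Lemma dotZZ (c z w : C) : nsq c = 1 -> dot (c * z) (c * w) = dot z w.
Proof.
rewrite /nsq /dot; case: c => a b; case: z => ? ?; case: w => ? ? /= e.
by rewrite -[RHS]mul1r -e; ring.
Qed.

Lemma ipZZ c p q : nsq c = 1 -> ip (pG (c *: p)) (pG (c *: q)) = ip (pG p) (pG q).
Proof. by move=> c1; congr Int; apply/funext => x; rewrite !pGZ dotZZ. Qed.

Lemma nsq_ii : nsq ii = 1.
Proof. by rewrite /nsq /= expr0n/= expr1n add0r. Qed.

Lemma ip_pGDl p q r : ip (pG (p + q)) (pG r) = ip (pG p) (pG r) + ip (pG q) (pG r).
Proof. by rewrite pGD ipDl//; exact: L2_pG. Qed.
Lemma ip_pGDr p q r : ip (pG r) (pG (p + q)) = ip (pG r) (pG p) + ip (pG r) (pG q).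
Proof. by rewrite ipC ip_pGDl ![ip (pG r) _]ipC. Qed.

(** [ann] kills constants, and it is the adjoint of [cre]. *)
Lemma ip_pG_const_cre (c : C) q : ip (pG c%:P) (pG (cre q)) = 0.
Proof.
rewrite ipC ip_cre_ann /ann derivC scaler0.
have -> : pG 0 = (fun x => 0 * pG 1 x) by rewrite -pGZ scale0r.
rewrite ipC -[RHS](mul0r (ip (pG 1) (pG q))) -(ipZl 0 (L2_pG 1) (L2_pG q)).
by congr ip; apply/funext => x; rewrite mul0r.
Qed.

(** The induction is on p alone. The constant part of p is fixed by [FT] and orthogonal to the image
    of [cre]; the rest is [cre p1], and the operator moves to the other side as [ann], with phases
    that cancel. The new right factor may be anything. *)
Lemma ip_FT p q : ip (pG (FT p)) (pG (FT q)) = ip (pG p) (pG q).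
Proof.
have [n] := ubnP (size p); elim: n p q => // n IH p q pn.
have [c [p1 [pE p1s]]] := cre_decomp p.
have [d [q1 [qE _]]] := cre_decomp q.
have A : ip (pG (FT c%:P)) (pG (FT q)) = ip (pG c%:P) (pG q).
  by rewrite qE FTD !FTC FT_cre -creZ ip_pGDr [RHS]ip_pGDr !ip_pG_const_cre.
have B : ip (pG (FT (cre p1))) (pG (FT q)) = ip (pG (cre p1)) (pG q).
  have [p10|p10] := eqVneq p1 0.
    have -> : cre p1 = 0 by rewrite p10 /cre mulr0 deriv0 !scaler0 subr0.
    rewrite FT0.
    have -> : pG 0 = (fun x => 0%:C%C * pG 1 x).
      by rewrite -[in LHS](scale0r (1 : {poly C})) pGZ.
    by rewrite !(ipZl _ (L2_pG _) (L2_pG _)) !mul0r.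
  have p1n : (size p1 < n)%N.
    move: p1s pn; rewrite -size_poly_gt0 in p10.
    case: (size p) => [|m] /=; first by rewrite ltnS leqNgt p10.
    by move=> a b; rewrite (leq_trans a).
  rewrite FT_cre.
  rewrite -(ipZZ _ _ nsq_ii) scalerA mulrN -expr2 sqr_i opprK scale1r.
  rewrite ip_cre_ann [RHS]ip_cre_ann -[RHS]IH//; congr (ip _ (pG _)).
  by rewrite FT_ann /ann derivZ !scalerA mulrC.
by rewrite pE FTD ip_pGDl [RHS]ip_pGDl A B.
Qed.

Lemma nrm_FT p : nrm (pG (FT p)) = nrm (pG p).
Proof. by rewrite /nrm ip_FT. Qed.

(** The phase -i of [FT_cre] is compensated by a factor i in the preimage. With the isometry this
    provides inverse transforms without an inversion formula. *)
Lemma FT_surj q : exists p, FT p = q.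
Proof.
have [n] := ubnP (size q); elim: n q => // n IH q qn.
have [c [q1 [qE q1s]]] := cre_decomp q.
have [q10|q10] := eqVneq q1 0.
  exists c%:P; rewrite FTC qE q10 /cre mulr0 deriv0 !scaler0 subr0 addr0//.
have q1n : (size q1 < n)%N.
  move: q1s qn; rewrite -size_poly_gt0 in q10.
  case: (size q) => [|m] /=; first by rewrite ltnS leqNgt q10.
  by move=> a b; rewrite (leq_trans a).
have [p1 p1E] := IH _ q1n.
exists (c%:P + cre (ii *: p1)).
rewrite FTD FTC FT_cre FTZ -creZ scalerA mulNr -expr2 sqr_i opprK scale1r p1E.
by rewrite -qE.
Qed.

End PolyGauss.

(** * Density of polynomials times the Gaussian: cosines *)

Section Density.
Variable R : realType.
Local Notation T := (lebesgueType R).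
Local Notation mu := (@completed_lebesgue_measure R).
Local Notation G := (@gauss R).
Implicit Types (f g : R -> R) (p q : {poly R}).

(** Approximation in both norms by the same p: the L^1 error controls Fourier integrals pointwise,
    the L^2 error controls norms. *)
Definition appr f := [/\ mf f, itg f, itg (fun x => f x ^+ 2) &
  forall e : R, 0 < e -> exists p, Int (fun x => `|f x - p.[x] * G x|) < e /\
    Int (fun x => (f x - p.[x] * G x) ^+ 2) < e].

Lemma itg_poly_G_sqr p : itg (fun x => (p.[x] * G x) ^+ 2).
Proof.
have e : (fun x => (p.[x] * G x) ^+ 2) = (fun x => (p ^+ 2).[x] * (G x * G x)).
  by apply/funext => x; rewrite horner_exp; ring.
by rewrite e; exact: itg_poly_GG.
Qed.

Lemma mf_poly_G p : mf (fun x => p.[x] * G x).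
Proof. exact: itg_mf (itg_poly_G p). Qed.

Lemma itgB_sqr f g : mf f -> mf g -> itg (fun x => f x ^+ 2) -> itg (fun x => g x ^+ 2) ->
  itg (fun x => (f x - g x) ^+ 2).
Proof.
move=> mf0 mg f2 g2; apply: (itg_le _ _ (itgZ 2 (itgD f2 g2))).
  by apply: mfX; exact: mfB.
move=> x; rewrite ger0_norm ?sqr_ge0//.
have := sqr_ge0 (f x + g x); lra.
Qed.

Lemma itgD_sqr f g : mf f -> mf g -> itg (fun x => f x ^+ 2) -> itg (fun x => g x ^+ 2) ->
  itg (fun x => (f x + g x) ^+ 2).
Proof.
move=> mf0 mg f2 g2; apply: (itg_le _ _ (itgZ 2 (itgD f2 g2))).
  by apply: mfX; exact: mfD.
move=> x; rewrite ger0_norm ?sqr_ge0//.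
have := sqr_ge0 (f x - g x); lra.
Qed.

Lemma apprP p : appr (fun x => p.[x] * G x).
Proof.
split; [exact: mf_poly_G|exact: itg_poly_G|exact: itg_poly_G_sqr|].
move=> e e0; exists p; split.
  rewrite (_ : (fun _ => _) = fun=> 0) ?Int0//.
  by apply/funext => x; rewrite subrr normr0.
rewrite (_ : (fun _ => _) = fun=> 0) ?Int0//.
by apply/funext => x; rewrite subrr expr0n.
Qed.

Lemma appr_lim f : mf f -> itg f -> itg (fun x => f x ^+ 2) ->
  (forall e : R, 0 < e -> exists2 g, appr g & Int (fun x => `|f x - g x|) < e /\
    Int (fun x => (f x - g x) ^+ 2) < e) -> appr f.
Proof.
move=> mf0 if0 f2 H; split => // e e0.
have e8 : 0 < e / 8 by rewrite divr_gt0.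
have [g [mg ig g2 ga] [fg1 fg2]] := H _ e8.
have [p [p1 p2]] := ga _ e8.
have mp := mf_poly_G p; have ip := itg_poly_G p; have p2' := itg_poly_G_sqr p.
exists p; split.
  apply: (@le_lt_trans _ _ (Int (fun x => `|f x - g x| + `|g x - p.[x] * G x|))).
    apply: Int_le.
    - by apply: itg_norm; exact: itgB.
    - by apply: itgD; apply: itg_norm; exact: itgB.
    - by move=> x; rewrite -(subrKA (g x)) ler_normD.
  rewrite IntD; [|by apply: itg_norm; exact: itgB|by apply: itg_norm; exact: itgB].
  lra.
apply: (@le_lt_trans _ _ (Int (fun x => 2 * ((f x - g x) ^+ 2 + (g x - p.[x] * G x) ^+ 2)))).
  apply: Int_le.
  - exact: itgB_sqr.
  - by apply: itgZ; apply: itgD; exact: itgB_sqr.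
  - move=> x; rewrite -(subrKA (g x)).
    by have := sqr_ge0 (f x - g x - (g x - p.[x] * G x)); nra.
rewrite IntZ; last by apply: itgD; exact: itgB_sqr.
rewrite IntD; [|exact: itgB_sqr|exact: itgB_sqr].
lra.
Qed.

Lemma appr_dominated (f_ : nat -> R -> R) f h : (forall n, appr (f_ n)) -> mf f ->
  {ae mu, forall x : T, f_ n x @[n --> \oo] --> f x} ->
  itg h -> itg (fun x => h x ^+ 2) -> (forall n x, `|f_ n x| <= h x) -> appr f.
Proof.
move=> fa mf0 cf ih h2 fh.
have mf_ n : mf (f_ n) by have [] := fa n.
have h0 x : 0 <= h x by exact: le_trans (normr_ge0 _) (fh 0%N x).
have sqh n x : `|f_ n x ^+ 2| <= h x ^+ 2.
  by rewrite normrX ler_sqr ?nnegrE.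
have [if0 _] := Int_dominated mf_ mf0 cf ih fh.
have [if2 _] : itg (fun x => f x ^+ 2) /\ Int (fun x => f_ n x ^+ 2) @[n --> \oo] --> Int (fun x => f x ^+ 2).
  apply: (@Int_dominated _ (fun n x => f_ n x ^+ 2) _ _ _ _ _ h2) => //.
  - by move=> n; exact: mfX.
  - exact: mfX.
  - by apply: (ae_imply cf) => x c; under eq_fun do rewrite expr2; rewrite expr2; exact: cvgM.
have c1 : Int (fun x => `|f x - f_ n x|) @[n --> \oo] --> (0 : R).
  rewrite -(Int0 R).
  apply: (proj2 (@Int_dominated _ (fun n x => `|f x - f_ n x|) (fun=> 0) (fun x => `|f x| + h x) _ _ _ _ _)).
  - by move=> n; apply: mf_norm; exact: mfB.
  - exact: mf_cst.
  - apply: (ae_imply cf) => x c; rewrite -[X in _ --> X](normr0 R) -(subrr (f x)).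
    by apply: cvg_norm; apply: cvgB => //; exact: cvg_cst.
  - by apply: itgD => //; exact: itg_norm.
  - by move=> n x; rewrite normr_id (le_trans (ler_normB _ _))// lerD2l.
have c2 : Int (fun x => (f x - f_ n x) ^+ 2) @[n --> \oo] --> (0 : R).
  rewrite -(Int0 R).
  apply: (proj2 (@Int_dominated _ (fun n x => (f x - f_ n x) ^+ 2) (fun=> 0) (fun x => 2 * (f x ^+ 2 + h x ^+ 2)) _ _ _ _ _)).
  - by move=> n; apply: mfX; exact: mfB.
  - exact: mf_cst.
  - apply: (ae_imply cf) => x c; rewrite -[X in _ --> X](mulr0 0) -(subrr (f x)).
    under eq_fun do rewrite expr2.
    by apply: cvgM; apply: cvgB => //; exact: cvg_cst.
  - by apply: itgZ; exact: itgD.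
  - move=> n x; rewrite ger0_norm ?sqr_ge0//.
    have := sqh n x; rewrite ger0_norm ?sqr_ge0// => ?.
    by have := sqr_ge0 (f x + f_ n x); nra.
apply: appr_lim => // e e0.
have /cvgrPdist_lt/(_ e e0) H1 := c1.
have /cvgrPdist_lt/(_ e e0) H2 := c2.
near \oo => n.
exists (f_ n) => //; split.
  have := near H1 n; rewrite sub0r normrN => /(_ _) H.
  by apply: le_lt_trans (ler_norm _) _; near: n; under eq_near do rewrite -normrN -sub0r.
by apply: le_lt_trans (ler_norm _) _; near: n; under eq_near do rewrite -normrN -sub0r.
Unshelve. all: by end_near. Qed.

Lemma appr_ae f g : appr f -> mf g -> {ae mu, forall x : T, f x = g x} -> appr g.
Proof.
move=> [mf0 if0 f2 fa] mg fg.
have gf2 : {ae mu, forall x : T, f x ^+ 2 = g x ^+ 2} by apply: (ae_imply fg) => x ->.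
split => //.
- exact: (ae_itg mg fg if0).
- exact: (ae_itg (mfX 2 mg) gf2 f2).
- move=> e e0; have [p [p1 p2]] := fa e e0; exists p; have mp := mf_poly_G p; split.
    rewrite -(@ae_eq_Int _ (fun x => `|f x - p.[x] * G x|))//.
    + by apply: mf_norm; exact: mfB.
    + by apply: mf_norm; exact: mfB.
    + by apply: (ae_imply fg) => x ->.
  rewrite -(@ae_eq_Int _ (fun x => (f x - p.[x] * G x) ^+ 2))//.
  + by apply: mfX; exact: mfB.
  + by apply: mfX; exact: mfB.
  + by apply: (ae_imply fg) => x ->.
Qed.

Lemma apprD f g : appr f -> appr g -> appr (fun x => f x + g x).
Proof.
move=> [mf0 if0 f2 fa] [mg ig g2 ga]; split.
- exact: mfD.
- exact: itgD.
- exact: itgD_sqr.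
- move=> e e0; have e8 : 0 < e / 8 by rewrite divr_gt0.
  have [p [p1 p2]] := fa _ e8; have [q [q1 q2]] := ga _ e8.
  have mp := mf_poly_G p; have ip := itg_poly_G p; have p2' := itg_poly_G_sqr p.
  have mq := mf_poly_G q; have iq := itg_poly_G q; have q2' := itg_poly_G_sqr q.
  have E x : f x + g x - (p + q).[x] * G x = (f x - p.[x] * G x) + (g x - q.[x] * G x).
    by rewrite hornerD; ring.
  exists (p + q); split.
    under eq_fun do rewrite E.
    apply: (@le_lt_trans _ _ (Int (fun x => `|f x - p.[x] * G x| + `|g x - q.[x] * G x|))).
      apply: Int_le.
      - by apply: itg_norm; apply: itgD; exact: itgB.
      - by apply: itgD; apply: itg_norm; exact: itgB.
      - by move=> x; exact: ler_normD.
    rewrite IntD; [|by apply: itg_norm; exact: itgB|by apply: itg_norm; exact: itgB].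
    lra.
  under eq_fun do rewrite E.
  apply: (@le_lt_trans _ _ (Int (fun x => 2 * ((f x - p.[x] * G x) ^+ 2 + (g x - q.[x] * G x) ^+ 2)))).
    apply: Int_le.
    - by apply: itgD_sqr; [exact: mfB|exact: mfB|exact: itgB_sqr|exact: itgB_sqr].
    - by apply: itgZ; apply: itgD; exact: itgB_sqr.
    - by move=> x; have := sqr_ge0 (f x - p.[x] * G x - (g x - q.[x] * G x)); nra.
  rewrite IntZ; last by apply: itgD; exact: itgB_sqr.
  rewrite IntD; [|exact: itgB_sqr|exact: itgB_sqr].
  lra.
Qed.

Lemma apprZ c f : appr f -> appr (fun x => c * f x).
Proof.
move=> [mf0 if0 f2 fa]; split.
- by apply: mfM => //; exact: mf_cst.
- exact: itgZ.
- by under eq_fun do rewrite exprMn; exact: itgZ.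
- move=> e e0; pose d := e / (1 + `|c| + c ^+ 2).
  have D0 : 0 < 1 + `|c| + c ^+ 2 by rewrite ltr_wpDr ?sqr_ge0// ltr_wpDr.
  have d0 : 0 < d by rewrite divr_gt0.
  have [p [p1 p2]] := fa _ d0.
  have mp := mf_poly_G p; have ip := itg_poly_G p; have p2' := itg_poly_G_sqr p.
  have E x : c * f x - (c *: p).[x] * G x = c * (f x - p.[x] * G x).
    by rewrite hornerZ; ring.
  have de : d * (1 + `|c| + c ^+ 2) = e by rewrite /d divfK// gt_eqF.
  exists (c *: p); split.
    under eq_fun do rewrite E normrM.
    rewrite IntZ; last by apply: itg_norm; exact: itgB.
    apply: (@le_lt_trans _ _ (`|c| * d)); first by rewrite ler_wpM2l// ltW.
    by rewrite -de mulrC ltr_pM2l//; have := sqr_ge0 c; lra.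
  under eq_fun do rewrite E exprMn.
  rewrite IntZ; last exact: itgB_sqr.
  apply: (@le_lt_trans _ _ (c ^+ 2 * d)); first by rewrite ler_wpM2l ?sqr_ge0// ltW.
  by rewrite -de mulrC ltr_pM2l//; have := normr_ge0 c; lra.
Qed.

(** From |b x| <= b^2 + x^2 / 4; the decay left over is pi - 1/4, which is positive. *)
Lemma expR_abs_G_le b x : expR `|b * x| * G x <= expR (b ^+ 2) * ga (pi - 4^-1) x.
Proof.
rewrite /Defs.lebesgueType -[G x]/(expR (- (pi * x ^+ 2))) /ga -!expRD ler_expR.
have h : `|b * x| <= b ^+ 2 + 4^-1 * x ^+ 2.
  rewrite ler_norml; apply/andP; split.
    by have := sqr_ge0 (b + x / 2); nra.
  by have := sqr_ge0 (b - x / 2); nra.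
by move: (pi : R) => c; nra.
Qed.

Lemma pi_quarter_gt0 : 0 < (pi : R) - 4^-1.
Proof. by have := pi_ge2 R; move: (pi : R) => c; lra. Qed.

Lemma itg_expR_abs_G b : itg (fun x => expR `|b * x| * G x) /\
  itg (fun x => (expR `|b * x| * G x) ^+ 2).
Proof.
have m : mf (fun x => expR `|b * x| * G x).
  apply: mfM; last exact: itg_mf (itg_ga (pi_gt0 R)).
  apply: mf_continuous => x; apply: (continuous_comp (f := fun x => `|b * x|)); last exact: continuous_expR.
  by apply: cvg_norm; apply: cvgM; [exact: cvg_cst|exact: cvg_id].
have p0 x : 0 <= expR `|b * x| * G x by rewrite mulr_ge0 ?expR_ge0.
split.
  apply: (itg_le m _ (itgZ (expR (b ^+ 2)) (itg_ga pi_quarter_gt0))) => x.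
  by rewrite ger0_norm// expR_abs_G_le.
apply: (itg_le (mfX 2 m) _ (itgZ (expR (b ^+ 2) ^+ 2) (itg_ga (addr_gt0 pi_quarter_gt0 pi_quarter_gt0)))) => x.
rewrite -gaM ger0_norm ?sqr_ge0// -expr2 -exprMn ler_sqr ?nnegrE// ?expR_abs_G_le//.
by rewrite mulr_ge0 ?expR_ge0.
Qed.

(** Here [c y n] is the n-th term of the power series of k at y. Its partial sums are polynomials in
    x, and their products with G are dominated by exp |b x| G, which is integrable together with its
    square. *)
Lemma appr_series (k : R -> R) (c : R -> nat -> R) b : continuous k ->
  (forall x, series (c x) n @[n --> \oo] --> k x) ->
  (forall y x n, c y n * x ^+ n = c (y * x) n) ->
  (forall y n, `|c y n| <= exp_coeff `|y| n) -> appr (fun x => k (b * x) * G x).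
Proof.
move=> ck cs cM cb; have [i1 i2] := itg_expR_abs_G b.
have E n x : (\poly_(i < n) c b i).[x] = series (c (b * x)) n.
  by rewrite horner_poly /series /= big_mkord; apply: eq_bigr => i _; rewrite cM.
apply: (@appr_dominated (fun n x => (\poly_(i < n) c b i).[x] * G x) _ _ _ _ _ i1 i2).
- by move=> n; exact: apprP.
- apply: mfM; last exact: itg_mf (itg_ga (pi_gt0 R)).
  apply: mf_continuous => x; apply: (continuous_comp (f := fun x => b * x)); last exact: ck.
  by apply: cvgM; [exact: cvg_cst|exact: cvg_id].
- apply: aeW => x; apply: cvgM; last exact: cvg_cst.
  by under eq_fun do rewrite E; exact: cs.
- move=> n x; rewrite normrM (ger0_norm (expR_ge0 _)) ler_pM2r ?expR_gt0//.
  rewrite E (le_trans (ler_norm_sum _ _ _))//.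
  apply: (@le_trans _ _ (series (exp_coeff `|b * x|) n)).
    by apply: ler_sum => i _; exact: cb.
  apply: nondecreasing_cvgn_le; last exact: is_cvg_series_exp_coeff.
  by apply: nondecreasing_series => i _ _; exact: exp_coeff_ge0.
Qed.

Lemma trig_coeff_le (t : bool) (m n : nat) (y : R) :
  `|t%:R * (-1) ^+ m * y ^+ n / n`!%:R| <= exp_coeff `|y| n.
Proof.
rewrite /exp_coeff /= !normrM normfV [X in _ / X]ger0_norm//.
apply: ler_wpM2r; first by rewrite invr_ge0.
rewrite normrX normrN1 expr1n mulr1 normrX.
by apply: ler_piMl; [rewrite exprn_ge0|case: t; rewrite ?normr1 ?normr0].
Qed.

Lemma appr_cos b : appr (fun x => cos (b * x) * G x).
Proof.
apply: (@appr_series cos cos_coeff b).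
- exact: continuous_cos.
- by move=> x; rewrite cos.unlock; exact: is_cvg_series_cos_coeff.
- by move=> y x n; rewrite /cos_coeff /= exprMn; ring.
- by move=> y n; exact: trig_coeff_le.
Qed.

Lemma appr_sin b : appr (fun x => sin (b * x) * G x).
Proof.
apply: (@appr_series sin sin_coeff b).
- exact: continuous_sin.
- by move=> x; rewrite sin.unlock; exact: is_cvg_series_sin_coeff.
- by move=> y x n; rewrite /sin_coeff /= exprMn; ring.
- by move=> y n; exact: trig_coeff_le.
Qed.

Lemma appr_cosD b d : appr (fun x => cos (b * x + d) * G x).
Proof.
have -> : (fun x => cos (b * x + d) * G x) =
  (fun x => cos d * (cos (b * x) * G x) + - sin d * (sin (b * x) * G x)).
  by apply/funext => x; rewrite cosD; ring.
by apply: apprD; apply: apprZ; [exact: appr_cos|exact: appr_sin].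
Qed.

(** Powers of a cosine are linearised by cos a cos b = (cos (a + b) + cos (a - b)) / 2. The extra
    factor with free frequency and phase absorbs one cosine at each step. *)
Lemma appr_poly_cos (Q : {poly R}) be ga b d :
  appr (fun x => Q.[cos (be * x + ga)] * cos (b * x + d) * G x).
Proof.
elim/poly_ind: Q b d => [|Q c IH] b d.
  have -> : (fun x => 0.[cos (be * x + ga)] * cos (b * x + d) * G x) = (fun x => 0 * (cos (b * x + d) * G x)).
    by apply/funext => x; rewrite horner0 !mul0r.
  by apply: apprZ; exact: appr_cosD.
have -> : (fun x => (Q * 'X + c%:P).[cos (be * x + ga)] * cos (b * x + d) * G x) =
  (fun x => (2^-1 * (Q.[cos (be * x + ga)] * cos ((be + b) * x + (ga + d)) * G x) +
     2^-1 * (Q.[cos (be * x + ga)] * cos ((be - b) * x + (ga - d)) * G x)) + c * (cos (b * x + d) * G x)).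
  apply/funext => x; rewrite hornerMXaddC.
  have -> : (be + b) * x + (ga + d) = (be * x + ga) + (b * x + d) by ring.
  have -> : (be - b) * x + (ga - d) = (be * x + ga) - (b * x + d) by ring.
  by rewrite (cosD (be * x + ga)) (cosB (be * x + ga)); field.
apply: apprD; last by apply: apprZ; exact: appr_cosD.
by apply: apprD; apply: apprZ; exact: IH.
Qed.

End Density.

(** * Density: from cosines to indicators and to all functions *)

Section Density2.
Variable R : realType.
Local Notation T := (lebesgueType R).
Local Notation G := (@gauss R).
Implicit Types (f g : R -> R).

Lemma bernoulli (y : R) n : -1 <= y -> 1 + n%:R * y <= (1 + y) ^+ n.
Proof.
move=> y1; elim: n => [|n IH]; first by rewrite mul0r addr0 expr0.
rewrite exprSr.
have y0 : 0 <= 1 + y by lra.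
apply: le_trans (ler_wpM2r y0 IH); rewrite -natr1.
have : 0 <= n%:R * y ^+ 2 :> R by rewrite mulr_ge0 ?sqr_ge0.
by nra.
Qed.

Lemma pow_le_inv (y : R) n : 0 <= y -> y <= 1 -> (1 - y) ^+ n <= (1 + n%:R * y)^-1.
Proof.
move=> y0 y1.
have h1 : 0 < 1 + n%:R * y by rewrite ltr_wpDr// mulr_ge0.
have h2 : 1 + n%:R * y <= (1 + y) ^+ n by apply: bernoulli; lra.
have h3 : 0 < (1 + y) ^+ n by exact: lt_le_trans h1 h2.
apply: (@le_trans _ _ ((1 + y) ^- n)); last by rewrite lef_pV2 ?posrE.
rewrite -div1r ler_pdivlMr// -exprMn.
by rewrite exprn_ile1//; nra.
Qed.

Lemma cvg_inv_nat (c : R) : c / n.+1%:R @[n --> \oo] --> 0.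
Proof.
rewrite -[X in _ --> X](mulr0 c); apply: cvgM; first exact: cvg_cst.
exact: cvg_harmonic.
Qed.

(* Brosowski and Deutsch: these polynomials, with values in [0, 1] on [0, 1],
   tend to the indicator of [0, 1/2[. *)
Definition cut_poly (n : nat) : {poly R} := (1 - 'X^(n.+1) : {poly R}) ^+ (n.+1 * 2 ^ n.+1)%N.

Lemma cut_polyE n (u : R) : (cut_poly n).[u] = (1 - u ^+ n.+1) ^+ (n.+1 * 2 ^ n.+1)%N.
Proof. by rewrite horner_exp hornerD hornerN hornerXn hornerC. Qed.

Lemma cut_poly_bound n (u : R) : 0 <= u <= 1 -> 0 <= (cut_poly n).[u] <= 1.
Proof.
move=> /andP[u0 u1]; rewrite cut_polyE.
have h1 : 0 <= u ^+ n.+1 by rewrite exprn_ge0.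
have h2 : u ^+ n.+1 <= 1 by rewrite exprn_ile1.
by rewrite exprn_ge0 ?exprn_ile1//; lra.
Qed.

(** For w = sqrt v, the bound w^n <= 1 / (n (1 - w)) is squared, which leaves a factor 1 / n. *)
Lemma cvg_nat_geometric (v : R) : 0 <= v < 1 -> n.+1%:R * v ^+ n.+1 @[n --> \oo] --> 0.
Proof.
move=> /andP[v0 v1].
pose w := Num.sqrt v.
have w0 : 0 <= w by exact: sqrtr_ge0.
have wv : v = w ^+ 2 by rewrite sqr_sqrtr.
have w1 : w < 1 by rewrite -(@ltr_sqr _ w 1) ?nnegrE// expr1n -wv.
pose y := 1 - w; have y0 : 0 < y by rewrite /y; lra.
have b n : 0 <= n.+1%:R * v ^+ n.+1 <= (y ^- 2) / n.+1%:R.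
  rewrite mulr_ge0 ?exprn_ge0//= wv -exprM mulnC exprM.
  have -> : w = 1 - y by rewrite /y; ring.
  have n0 : 0 < n.+1%:R :> R by rewrite ltr0n.
  have h1 : 0 <= (1 - y) ^+ n.+1 by rewrite exprn_ge0// /y; lra.
  have h2 : (1 - y) ^+ n.+1 <= (n.+1%:R * y)^-1.
    apply: le_trans (pow_le_inv n.+1 (ltW y0) _) _; first by rewrite /y; lra.
    rewrite lef_pV2 ?posrE ?mulr_gt0// ?ltr_wpDl ?mulr_gt0//; lra.
  apply: (@le_trans _ _ (n.+1%:R * (n.+1%:R * y)^-1 ^+ 2)).
    by rewrite ler_pM2l// ler_sqr ?nnegrE// invr_ge0 mulr_ge0// ltW.
  rewrite le_eqVlt; apply/orP; left; apply/eqP.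
  by field; rewrite ?pnatr_eq0 ?gt_eqF.
apply: (@squeeze_cvgr _ _ _ _ (fun=> 0) (fun n => (y ^- 2) / n.+1%:R)).
- by apply: nearW => n; exact: b.
- exact: cvg_cst.
- exact: cvg_inv_nat.
Qed.

(** Bernoulli's inequality bounds the value from below by 1 - (n+1) (2u)^(n+1), and 2u < 1. *)
Lemma cut_poly_lt (u : R) : 0 <= u < 2^-1 -> (cut_poly n).[u] @[n --> \oo] --> (1 : R).
Proof.
move=> /andP[u0 u1].
have c := @cvg_nat_geometric (2 * u).
have {}c := c (introT andP (conj (mulr_ge0 (ler0n _ 2) u0) _)).
have {}c : n.+1%:R * (2 * u) ^+ n.+1 @[n --> \oo] --> (0 : R) by apply: c; lra.
apply: (@squeeze_cvgr _ _ _ _ (fun n => 1 - n.+1%:R * (2 * u) ^+ n.+1) (fun=> 1)).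
- apply: nearW => n; have u01 : 0 <= u <= 1 by apply/andP; split; lra.
  rewrite (andP (cut_poly_bound n u01)).2 andbT cut_polyE.
  have h2 : u ^+ n.+1 <= 1 by rewrite exprn_ile1//; lra.
  apply: le_trans (bernoulli _ _); last by lra.
  by rewrite natrM natrX exprMn mulrN mulrA.
- rewrite -[X in _ --> X]subr0; apply: cvgB => //; exact: cvg_cst.
- exact: cvg_cst.
Qed.

(** The exponent times u^(n+1) equals (n+1) (2u)^(n+1), which is at least n+1, so [pow_le_inv]
    applies. *)
Lemma cut_poly_ge (u : R) : 2^-1 <= u <= 1 -> (cut_poly n).[u] @[n --> \oo] --> (0 : R).
Proof.
move=> /andP[u0 u1].
apply: (@squeeze_cvgr _ _ _ _ (fun=> 0) (fun n => 1 / n.+1%:R)).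
- apply: nearW => n; have u01 : 0 <= u <= 1 by apply/andP; split; lra.
  rewrite (andP (cut_poly_bound n u01)).1/= cut_polyE.
  have h1 : 0 <= u ^+ n.+1 by rewrite exprn_ge0//; lra.
  have h2 : u ^+ n.+1 <= 1 by rewrite exprn_ile1//; lra.
  apply: le_trans (pow_le_inv _ h1 h2) _; rewrite div1r lef_pV2 ?posrE ?ltr0n//; last first.
    by rewrite ltr_wpDr// mulr_ge0.
  rewrite natrM natrX -mulrA -exprMn.
  have : 1 <= (2 * u) ^+ n.+1 by rewrite exprn_ege1//; lra.
  have : 0 <= n.+1%:R :> R by [].
  by nra.
- exact: cvg_cst.
- exact: cvg_inv_nat.
Qed.

Lemma itg_G_sqr : itg (fun x => G x ^+ 2).
Proof.
have -> : (fun x => G x ^+ 2) = ga (pi + pi) by apply/funext => x; rewrite -gaM expr2.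
by apply: itg_ga; rewrite addr_gt0// pi_gt0.
Qed.

Lemma itg_G : itg G.
Proof. exact: (itg_ga (pi_gt0 R)). Qed.

Lemma appr_lim_G (k_ : nat -> R -> R) k : (forall n, appr (fun x => k_ n x * G x)) -> mf k ->
  (forall x, k_ n x @[n --> \oo] --> k x) -> (forall n x, `|k_ n x| <= 1) ->
  appr (fun x => k x * G x).
Proof.
move=> ka mk ck k1.
apply: (@appr_dominated _ _ _ G ka _ _ itg_G itg_G_sqr).
- by apply: mfM => //; exact: itg_mf itg_G.
- by apply: aeW => x; apply: cvgM; [exact: ck|exact: cvg_cst].
- by move=> n x; rewrite normrM (gtr0_norm (expR_gt0 _)) ler_piMl// expR_ge0.
Qed.

Lemma mf_lt f g : mf f -> mf g -> mf (\1_[set x | f x < g x]).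
Proof.
move=> mf0 mg; apply: mf_indic.
have := mfB mg mf0 measurableT (measurable_itv `]0, +oo[).
rewrite setTI (_ : _ @^-1` _ = [set x | f x < g x])//.
by apply/seteqP; split => x /=; rewrite in_itv/= andbT subr_gt0.
Qed.

Lemma appr_cos_cut (m L c : R) : `|c| <= 1 ->
  appr (fun x => \1_[set x | c < cos ((x - m) / L)] x * G x).
Proof.
move=> c1.
(* Affine in the cosine, with values in [0, 1], and below 1/2 exactly where the cosine exceeds c. *)
pose u x := 2^-1 + (c - cos ((x - m) / L)) / 4.
have u01 x : 0 <= u x <= 1.
  move: c1; rewrite ler_norml /u => /andP[? ?].
  by have := cos_geN1 ((x - m) / L); have := cos_le1 ((x - m) / L) => h1 h2; apply/andP; split; lra.
have mcos : mf (fun x => cos ((x - m) / L)).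
  apply: mf_continuous => x; apply: (continuous_comp (f := fun x => (x - m) / L)); last exact: continuous_cos.
  by apply: cvgM; [apply: cvgB; [exact: cvg_id|exact: cvg_cst]|exact: cvg_cst].
apply: (@appr_lim_G (fun n x => (cut_poly n).[u x])).
- move=> n.
  have -> : (fun x => (cut_poly n).[u x] * G x) =
    (fun x => (cut_poly n \Po ((2^-1 + c / 4)%:P - 4^-1 *: 'X)).[cos (L^-1 * x + - (m / L))] * cos (0 * x + 0) * G x).
    apply/funext => x; rewrite mul0r add0r cos0 mulr1 horner_comp hornerD hornerN hornerZ hornerX hornerC.
    congr (_.[_] * _); rewrite /u.
    have -> : L^-1 * x + - (m / L) = (x - m) / L by ring.
    by field.
  exact: appr_poly_cos.
- by apply: mf_lt => //; exact: mf_cst.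
- move=> x; rewrite indicE; case: (boolP (_ \in _)).
    rewrite inE /= => cx; apply: cut_poly_lt.
    by have /andP[u0 _] := u01 x; rewrite u0 /u /=; lra.
  rewrite notin_setE /= => /negP; rewrite -leNgt => cx; apply: cut_poly_ge.
  by have /andP[_ ->] := u01 x; rewrite andbT /u; lra.
- by move=> n x; have /andP[? ?] := cut_poly_bound n (u01 x); rewrite ger0_norm.
Qed.

(** As the period grows, the arcs where the stretched cosine exceeds cos (r / (n+1)) move off to
    infinity, except the one around m, which is the given interval. *)
Lemma appr_itv_bounded (a b : R) : appr (fun x => \1_`]a, b[ x * G x).
Proof.
have [ab|ba] := ltP a b; last first.
  rewrite set_itv_ge ?bnd_simp -?leNgt//.
  have -> : (fun x => \1_set0 x * G x) = (fun x => (0 : {poly R}).[x] * G x).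
    by apply/funext => x; rewrite indic0 horner0.
  exact: apprP.
pose m := (a + b) / 2; pose r := (b - a) / 2.
have r0 : 0 < r by rewrite /r; lra.
have E x : (x \in `]a, b[) = (`|x - m| < r).
  rewrite in_itv /= ltr_norml /m /r; apply/idP/idP => /andP[? ?]; apply/andP; split; lra.
apply: (@appr_lim_G (fun n x => \1_[set x | cos (r / n.+1%:R) < cos ((x - m) / n.+1%:R)] x)).
- by move=> n; apply: appr_cos_cut; exact: cos_max.
- by apply: mf_indic; exact: itv_measurable.
- move=> x; apply: cvg_near_cst.
  near=> n.
  have n0 : 0 < n.+1%:R :> R by rewrite ltr0n.
  have pi0 := pi_gt0 R.
  have nB : (r + `|x - m|) / pi < n.+1%:R.
    apply: lt_trans (_ : n%:R < _); last by rewrite ltr_nat.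
    near: n; exact: nbhs_infty_gtr.
  rewrite ltr_pdivrMr// mulrC in nB.
  have h1 : r / n.+1%:R \in `[0, pi].
    rewrite in_itv/= divr_ge0 ?(ltW r0)//= ler_pdivrMr// (le_trans _ (ltW nB))//.
    by rewrite lerDl.
  have h2 : `|x - m| / n.+1%:R \in `[0, pi].
    rewrite in_itv/= divr_ge0//= ler_pdivrMr// (le_trans _ (ltW nB))//.
    by rewrite lerDr ltW.
  have e : cos ((x - m) / n.+1%:R) = cos (`|x - m| / n.+1%:R).
    by rewrite -cos_norm normrM normfV [`|n.+1%:R|]ger0_norm.
  rewrite !indicE; congr (_%:R); congr nat_of_bool.
  apply/idP/idP; rewrite !inE /= e ltr_cos// ltr_pM2r ?invr_gt0//; rewrite -E//.
- by move=> n x; rewrite indicE; case: (_ \in _); rewrite ?normr1 ?normr0.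
Unshelve. all: by end_near. Qed.

(** Dynkin induction from open rays. A ray is a limit of bounded intervals, and a disjoint union is
    the limit of its finite partial unions. *)
Lemma appr_indic_borel (A : set R) : measurable (A : set (measurableTypeR R)) ->
  appr (fun x => \1_A x * G x).
Proof.
move=> mA.
have mD B : measurable (B : set (measurableTypeR R)) -> mf (\1_B).
  by move=> mB; apply: mf_indic; exact: borel_lebesgue.
pose P (B : set (measurableTypeR R)) := appr (fun x => \1_B x * G x).
suff : P A by [].
have GE : (@measurable _ (measurableTypeR R)) = <<s @RGenOInfty.G R >>.
  exact: RGenOInfty.measurableE.
have aG : appr G.
  have -> : G = (fun x => (1 : {poly R}).[x] * G x) by apply/funext => x; rewrite hornerC mul1r.
  exact: apprP.
apply: (@dynkin_induction _ (measurableTypeR R) (@RGenOInfty.G R) P GE).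
- move=> _ _ [a ->] [b ->]; exists (Num.max a b).
  apply/seteqP; split => x /=; rewrite !in_itv/= !andbT gt_max.
    by move=> [-> ->].
  by move=> /andP[].
- by rewrite /P; under eq_fun do rewrite indicT mul1r.
- move=> _ [a ->].
  apply: (@appr_lim_G (fun n x => \1_`]a, (a + n%:R)[ x)).
  + by move=> n; exact: appr_itv_bounded.
  + by apply: mf_indic; exact: itv_measurable.
  + move=> x; apply: cvg_near_cst; near=> n; rewrite !indicE; congr (_%:R); congr nat_of_bool.
    apply/idP/idP; rewrite !inE /= !in_itv/= ?andbT; first by move=> /andP[].
    move=> ->/=; rewrite -ltrBlDl; near: n; exact: nbhs_infty_gtr.
  + by move=> n x; rewrite indicE; case: (_ \in _); rewrite ?normr1 ?normr0.
- move=> S mS PS; rewrite /P.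
  have -> : (fun x => \1_(~` S) x * G x) = (fun x => G x + -1 * (\1_S x * G x)).
    by apply/funext => x; rewrite !indicE in_setC; case: (x \in S) => /=; ring.
  by apply: apprD => //; exact: apprZ.
- move=> F mF tF PF; rewrite /P.
  apply: (@appr_lim_G (fun n x => \1_(\bigcup_(k < n) F k) x)).
  + move=> n; elim: n => [|n IH].
      rewrite bigcup0//.
      have -> : (fun x => \1_set0 x * G x) = (fun x => (0 : {poly R}).[x] * G x).
        by apply/funext => x; rewrite indic0 horner0.
      exact: apprP.
    have -> : (fun x => \1_(\bigcup_(k < n.+1) F k) x * G x) =
      (fun x => \1_(\bigcup_(k < n) F k) x * G x + \1_(F n) x * G x).
      apply/funext => x; rewrite -mulrDl; congr (_ * _).
      have -> : \bigcup_(k < n.+1) F k = \bigcup_(k < n) F k `|` F n.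
        apply/seteqP; split => y.
          move=> [k /=]; rewrite ltnS leq_eqVlt => /orP[/eqP ->|kn] Fy; [by right|left; by exists k].
        move=> [[k /= kn] Fy|Fy]; first by exists k => //=; exact: ltnW.
        by exists n => /=.
      have D : (x \in \bigcup_(k < n) F k) && (x \in F n) = false.
        apply/negP => /andP[/set_mem[k /= kn Fk] /set_mem Fn].
        have FkFn : F k `&` F n !=set0 by exists x.
        by have E := tF k n Logic.I Logic.I FkFn; move: kn; rewrite E ltnn.
      rewrite !indicE in_setU; move: D; case: (_ \in _); case: (_ \in _) => //= _.
      - by rewrite addr0.
      - by rewrite add0r.
      - by rewrite addr0.
    by apply: apprD => //; exact: PF.
  + by apply: mD; apply: bigcupT_measurable.
  + move=> x; rewrite !indicE.
    have [xF|xF] := pselect ((\bigcup_k F k) x).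
      have [k _ Fk] := xF; apply: cvg_near_cst; near=> n.
      have kn : (k < n)%N by near: n; exact: nbhs_infty_gt.
      have Hn : (\bigcup_(k < n) F k) x by exists k.
      by rewrite indicE (mem_set xF) (mem_set Hn).
    apply: cvg_near_cst; near=> n; have Hn : ~ (\bigcup_(k < n) F k) x by move=> [k _ Fk]; apply: xF; exists k.
    by rewrite indicE (memNset xF) (memNset Hn).
  + by move=> n x; rewrite indicE; case: (_ \in _); rewrite ?normr1 ?normr0.
- by rewrite -GE.
Unshelve. all: by end_near. Qed.

(** A Lebesgue measurable set is a Borel set up to a null set. *)
Lemma appr_indic (A : set R) : measurable (A : set T) -> appr (fun x => \1_A x * G x).
Proof.
move=> mA.
have : (completed_algebra_gen (@lebesgue_measure R)) A.
  by rewrite -g_sigma_completed_algebra_genE completed_caratheodory_measurable.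
move=> [B mB [N nN] BNA].
apply: (appr_ae (appr_indic_borel mB)).
  by apply: mfM; [exact: mf_indic|exact: itg_mf itg_G].
have [M [mM M0 NM]] := nN.
exists M; split.
- exact: borel_lebesgue.
- exact: M0.
- move=> x /= xM; apply: contrapT => xM'; apply: xM.
  rewrite -BNA !indicE; congr (_%:R * _); congr nat_of_bool.
  apply/idP/idP; rewrite !inE; first by left.
  by move=> [//|Nx]; case: xM'; exact: NM.
Qed.

Import HBNNSimple.

Lemma appr_nnsfun (k : {nnsfun T >-> R}) : appr (fun x : R => k (x : T) * G x).
Proof.
have -> : (fun x : R => k (x : T) * G x) = (fun x => \sum_(y <- finmap.enum_fset (fset_set (range k))) y * (\1_(k @^-1` [set y]) x * G x)).
  apply/funext => x; rewrite fimfunE fsbig_finite//= mulr_suml.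
  by apply: eq_bigr => i _; rewrite mulrA.
elim: (finmap.enum_fset _) => [|y s IH].
  have -> : (fun x => \sum_(y <- [::]) y * (\1_(k @^-1` [set y]) x * G x)) = (fun x => (0 : {poly R}).[x] * G x).
    by apply/funext => x; rewrite big_nil horner0 mul0r.
  exact: apprP.
under eq_fun do rewrite big_cons.
apply: apprD => //; apply: apprZ; apply: appr_indic; exact: measurable_funPTI.
Qed.

(** f / G is approximated from below by simple functions, so that the products with G are dominated
    by f itself. *)
Lemma appr_nneg f : mf f -> (forall x, 0 <= f x) -> itg f -> itg (fun x => f x ^+ 2) -> appr f.
Proof.
move=> mf0 f0 if0 f2.
pose k x := f x / G x.
have G0 x : 0 < G x by exact: expR_gt0.
have mk : mf k.
  rewrite (_ : k = fun x => f x * ga (- pi) x).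
    by apply: mfM => //; apply: mf_continuous; exact: (has_deriv_continuous (has_deriv_ga _)).
  by apply/funext => x; rewrite /k -[G x]/(expR (- (pi * x ^+ 2))) expRN invrK /ga mulNr opprK.
have mkE : measurable_fun [set: T] (EFin \o (k : T -> R)) by exact/measurable_EFinP.
have k0 x : [set: T] x -> (0 <= (EFin \o (k : T -> R)) x)%E by rewrite /= lee_fin divr_ge0// ltW.
pose s n : {nnsfun T >-> R} := nnsfun_approx measurableT mkE n.
have sk (x : R) : s n (x : T) @[n --> \oo] --> k x.
  by have /fine_cvg := cvg_nnsfun_approx measurableT mkE k0 (x := x) Logic.I.
have snd (x : R) : {homo (fun n => s n (x : T)) : n m / (n <= m)%N >-> n <= m}.
  move=> n m nm; have := nd_nnsfun_approx measurableT mkE nm.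
  by move=> /lefP; apply.
have sle n (x : R) : s n (x : T) <= k x.
  by apply: (cvgr_to_ge (sk x)); exists n => // m /= nm; exact: snd.
apply: (@appr_dominated _ (fun n (x : R) => s n (x : T) * G x) f f) => //.
- by move=> n; exact: appr_nnsfun.
- apply: aeW => x; have -> : f x = k x * G x by rewrite /k divfK// gt_eqF.
  by apply: cvgM; [exact: sk|exact: cvg_cst].
- move=> n x; have -> : f x = k x * G x by rewrite /k divfK// gt_eqF.
  by rewrite ger0_norm ?mulr_ge0 ?(ltW (G0 x))// ler_pM2r.
Qed.

Theorem poly_gauss_dense f : mf f -> itg f -> itg (fun x => f x ^+ 2) -> appr f.
Proof.
move=> mf0 if0 f2.
have E : f = (fun x => 2^-1 * (`|f x| + f x) + - 2^-1 * (`|f x| - f x)).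
  by apply/funext => x; field.
have i1 := itgD (itg_norm if0) if0; have i2 := itgB (itg_norm if0) if0.
have f2' : itg (fun x => `|f x| ^+ 2).
  by under eq_fun do rewrite -normrX ger0_norm ?sqr_ge0//.
have m1 := mf_norm mf0.
rewrite E; apply: apprD; apply: apprZ; apply: appr_nneg => //.
- exact: itg_mf i1.
- by move=> x; have := ler_norm (- f x); rewrite normrN; lra.
- exact: itgD_sqr.
- exact: itg_mf i2.
- by move=> x; have := ler_norm (f x); lra.
- exact: itgB_sqr.
Qed.

End Density2.

(** Abstracts norms and inner products into variables, so that only the linear relations between
    them remain. *)
Ltac gen_norms :=
  repeat match goal with
  | H : context [nrm ?f] |- _ => remember (nrm f) as x eqn:Hx in *; clear Hx
  | |- context [nrm ?f] => remember (nrm f) as x eqn:Hx in *; clear Hx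
  | |- context [ip ?f ?g] => remember (ip f g) as x eqn:Hx in *; clear Hx
  end.

(** * Plancherel theorem *)

Section Plancherel.
Variable R : realType.
Local Notation T := (lebesgueType R).
Local Notation mu := (@completed_lebesgue_measure R).
Local Notation Re := complex.Re.
Local Notation Im := complex.Im.
Local Notation normc := Normc.normc.
Local Notation C := R[i].
Local Notation G := (@gauss R).
Implicit Types (f g h u : R -> R[i]) (p q : {poly C}).

Lemma nrmB_tri f g h : L2 f -> L2 g -> L2 h ->
  nrm (f \- h) <= nrm (f \- g) + nrm (g \- h).
Proof.
move=> f2 g2 h2; have -> : f \- h = (f \- g) \+ (g \- h).
  by apply/funext => x /=; rewrite addrA subrK.
by apply: nrmD; exact: L2B.
Qed.

Lemma nrm_le_add f g : L2 f -> L2 g -> nrm f <= nrm g + nrm (f \- g).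
Proof.
move=> f2 g2; have E : f = g \+ (f \- g) by apply/funext => x /=; rewrite addrC subrK.
by rewrite {1}E; apply: nrmD => //; exact: L2B.
Qed.

Lemma L2_fatou (v : nat -> R -> C) (w : R -> C) (c : R) : (forall n, L2 (v n)) ->
  (forall x, Re (v n x) @[n --> \oo] --> Re (w x)) ->
  (forall x, Im (v n x) @[n --> \oo] --> Im (w x)) ->
  (forall n, nrm (v n) <= c) -> L2 w /\ nrm w <= c.
Proof.
move=> v2 vr vi vc.
have c0 : 0 <= c by exact: le_trans (nrm_ge0 _) (vc 0%N).
have mr : mf (fun x => Re (w x)).
  apply: (@measurable_fun_cvg _ T R setT (fun n (x : T) => Re (v n x))).
  - by move=> n; have [] := v2 n.
  - by move=> x _; exact: vr.
have mi : mf (fun x => Im (w x)).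
  apply: (@measurable_fun_cvg _ T R setT (fun n (x : T) => Im (v n x))).
  - by move=> n; have [] := v2 n.
  - by move=> x _; exact: vi.
have H : (\int[mu]_(x in [set: T]) (nsq (w x))%:E <= (c ^+ 2)%:E)%E.
  have vm n : measurable_fun [set: T] (fun x : T => (nsq (v n x))%:E).
    by apply/measurable_EFinP; have [r i _] := v2 n; exact: mf_nsq.
  have v0 n (x : T) : setT x -> (0 <= (nsq (v n x))%:E)%E by rewrite lee_fin nsq_ge0.
  have F := fatou mu measurableT vm v0.
  have E : (\int[mu]_(x in [set: T]) (nsq (w x))%:E =
            \int[mu]_(x in [set: T]) limn_einf (fun n => (nsq (v n x))%:E))%E.
    apply: eq_integral => x _; apply/esym.
    have C0 : (nsq (v n x))%:E @[n --> \oo] --> (nsq (w x))%:E.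
      by apply/cvg_EFin; [exact: nearW|exact: cvg_nsq].
    exact: (cvg_limn_einf_sup C0).1.
  rewrite E; apply: le_trans F _; rewrite limn_einf_lim; apply: lime_le.
    exact: is_cvg_einfs.
  apply: nearW => n; apply: le_trans (_ : (\int[mu]_(x in [set: T]) (nsq (v n x))%:E <= _)%E).
    by apply: ereal_inf_lbound; exists n => /=.
  have [_ _ iv] := v2 n.
  by rewrite (Int_EFin iv) lee_fin -ipff -nrm_sqr ler_sqr ?nnegrE ?nrm_ge0.
have iw : itg (fun x => nsq (w x)).
  apply: itg_ge0P; [exact: mf_nsq|by move=> x; exact: nsq_ge0|].
  by apply: le_lt_trans H _; exact: ltry.
split; first by split.
rewrite -ler_sqr ?nnegrE ?nrm_ge0// nrm_sqr ipff -lee_fin -(Int_EFin iw).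
exact: H.
Qed.

Lemma L1_L2_dense u (e : R) : L1 u -> L2 u -> 0 < e -> exists p,
  Int (fun x => normc (u x - pG p x)) < e /\ nrm (u \- pG p) < e.
Proof.
move=> [ir ii'] u2 e0; have [mr mi iu] := u2.
have ir2 : itg (fun x => Re (u x) ^+ 2).
  apply: (itg_le _ _ iu); first exact: mfX.
  by move=> x; rewrite ger0_norm ?sqr_ge0// lerDl sqr_ge0.
have ii2 : itg (fun x => Im (u x) ^+ 2).
  apply: (itg_le _ _ iu); first exact: mfX.
  by move=> x; rewrite ger0_norm ?sqr_ge0// lerDr sqr_ge0.
(* Real and imaginary parts both contribute: two L^1 errors have to stay below e, and two squared
   L^2 errors below e^2. *)
pose d := Num.min (e / 2) (e ^+ 2 / 2).
have d0 : 0 < d by rewrite lt_min !divr_gt0// exprn_gt0.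
have [_ _ _ /(_ _ d0)[a [a1 a2]]] := poly_gauss_dense mr ir ir2.
have [_ _ _ /(_ _ d0)[b [b1 b2]]] := poly_gauss_dense mi ii' ii2.
pose p : {poly C} := map_poly (real_complex R) a + 'i%C *: map_poly (real_complex R) b.
have pE x : p.[x%:C%C] = Complex a.[x] b.[x].
  rewrite hornerD hornerZ !horner_map/=.
  by apply: complexE; rewrite !(ReD,ImD,ReM,ImM) /= ?(mul0r,mulr0,mul1r,subr0,addr0,add0r).
have rE x : Re (u x - pG p x) = Re (u x) - a.[x] * G x.
  by rewrite ReD ReN /pG pE ReM /= mulr0 subr0.
have iE x : Im (u x - pG p x) = Im (u x) - b.[x] * G x.
  by rewrite ImD ImN /pG pE ImM /= mulr0 add0r.
have uB : L1 (u \- pG p) by apply: L1B; [split|exact: L1_pG].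
have uB2 : L2 (u \- pG p) by apply: L2B => //; exact: L2_pG.
have ja := itgB ir (itg_poly_G a); have jb := itgB ii' (itg_poly_G b).
have d1 : d <= e / 2 by rewrite ge_min lexx.
have d2 : d <= e ^+ 2 / 2 by rewrite ge_min lexx orbT.
exists p; split.
  have : Int (fun x => normc (u x - pG p x)) <=
     Int (fun x => `|Re (u x) - a.[x] * G x|) + Int (fun x => `|Im (u x) - b.[x] * G x|).
    rewrite -IntD; try exact: itg_norm.
    apply: Int_le; [exact: L1_normc uB|by apply: itgD; exact: itg_norm|].
    by move=> x; rewrite -rE -iE normc_le_ReIm.
  lra.
rewrite -ltr_sqr ?nnegrE ?nrm_ge0 ?ltW// nrm_sqr ipff.
have [br bi ibu] := uB2.
have : Int (fun x => nsq ((u \- pG p) x)) =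
     Int (fun x => (Re (u x) - a.[x] * G x) ^+ 2) + Int (fun x => (Im (u x) - b.[x] * G x) ^+ 2).
  rewrite -IntD.
  - by congr Int; apply/funext => x; rewrite -rE -iE.
  - apply: (itg_le _ _ ibu); first by apply: mfX; exact: itg_mf ja.
    by move=> x; rewrite ger0_norm ?sqr_ge0// -rE lerDl sqr_ge0.
  - apply: (itg_le _ _ ibu); first by apply: mfX; exact: itg_mf jb.
    by move=> x; rewrite ger0_norm ?sqr_ge0// -iE lerDr sqr_ge0.
by move=> ->; lra.
Qed.

Definition cutoff (r : R) f := Pop `[- r, r]%classic f.

Lemma L2_cutoff r f : L2 f -> L2 (cutoff r f).
Proof. by apply: L2_Pop; exact: itv_measurable. Qed.

Lemma itg_indic_itv (a b : R) : itg (fun x => \1_`[a, b] x).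
Proof.
have [ab|ba] := leP a b.
  have [_] := Int_itv ab (@has_deriv_id R) (@cst_continuous _ _ (1 : R)).
  by under eq_fun do rewrite mulr1.
rewrite set_itv_ge ?bnd_simp -?ltNge//.
by rewrite indic0; exact: itg0.
Qed.

Lemma L1_cutoff r f : L2 f -> L1 (cutoff r f).
Proof.
move=> f2; have [mr mi _] := L2_cutoff r f2; have [_ _ iff'] := f2.
have i1 := itgD (itg_indic_itv (- r) r) iff'.
have B (z : C) : `|Re z| <= 1 + nsq z /\ `|Im z| <= 1 + nsq z.
  case: z => a b; rewrite /nsq /= !ler_norml; split; apply/andP; split;
  have := sqr_ge0 a; have := sqr_ge0 b; nra.
have K x : `|Re (cutoff r f x)| <= \1_`[- r, r] x + nsq (f x) /\
           `|Im (cutoff r f x)| <= \1_`[- r, r] x + nsq (f x).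
  rewrite /cutoff PopE indicE; case: (x \in _); first exact: B.
  by rewrite /= normr0 add0r nsq_ge0.
split; (apply: (itg_le _ _ i1); first by []); move=> x; have [] := K x.
  by [].
by [].
Qed.

Lemma cutoff_cvg f : L2 f -> nrm (f \- cutoff n%:R f) @[n --> \oo] --> 0.
Proof.
move=> f2; have [mr mi iff'] := f2.
have E n : nrm (f \- cutoff n%:R f) =
  Num.sqrt (Int (fun x => nsq (f x)) - Int (fun x => \1_`[- n%:R, n%:R] x * nsq (f x))).
  rewrite /nrm ipff -IntB//; last first.
    have [_ _] := L2_cutoff n%:R f2; congr itg; apply/funext => x.
    by rewrite /cutoff PopE indicE; case: (x \in _); rewrite ?mul1r// mul0r /nsq /= expr0n/= addr0.
  congr (Num.sqrt (Int _)); apply/funext => x /=.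
  rewrite /cutoff PopE indicE; case: (x \in _); rewrite ?mul1r ?mul0r ?subr0// !subrr.
  by rewrite /nsq /= expr0n/= addr0.
under eq_fun do rewrite E.
have -> : (0 : R) = Num.sqrt (Int (fun x => nsq (f x)) - Int (fun x => nsq (f x))).
  by rewrite subrr sqrtr0.
have cB : Int (fun x => nsq (f x)) - Int (fun x => \1_`[- n%:R, n%:R] x * nsq (f x)) @[n --> \oo] -->
    Int (fun x => nsq (f x)) - Int (fun x => nsq (f x)).
  by apply: cvgB; [exact: cvg_cst|exact: Int_cvg_itv].
exact: (cvg_comp _ _ cB (@sqrt_continuous R _)).
Qed.

Lemma cvg_nrm_small (a : nat -> R) (e : R) : a n @[n --> \oo] --> 0 -> 0 < e ->
  \forall n \near \oo, a n < e.
Proof.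
move=> /cvgr0Pnorm_lt H e0; have := H _ e0; apply: filterS => n; exact: le_lt_trans (ler_norm _).
Qed.

Lemma L2_dense f (e : R) : L2 f -> 0 < e -> exists p, nrm (f \- pG p) < e.
Proof.
move=> f2 e0; have e2 : 0 < e / 2 by rewrite divr_gt0.
have [n fn] := filter_ex (cvg_nrm_small (cutoff_cvg f2) e2).
have [p [_ pn]] := L1_L2_dense (L1_cutoff n%:R f2) (L2_cutoff n%:R f2) e2.
exists p; apply: le_lt_trans (nrmB_tri f2 (L2_cutoff n%:R f2) (L2_pG p)) _.
by lra.
Qed.

(** L^1 approximation by functions p G makes the transforms converge pointwise, and the isometry on
    these functions bounds their norms by that of u plus d. Fatou's lemma then gives an inequality,
    which is enough to place [fourier u] in the closed graph. *)
Lemma fourier_nrm_le u : L1 u -> L2 u -> L2 (fourier u) /\ nrm (fourier u) <= nrm u.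
Proof.
move=> u1 u2.
suff H (d : R) : 0 < d -> L2 (fourier u) /\ nrm (fourier u) <= nrm u + d.
  have [F2 _] := H _ ltr01; split => //.
  by apply/ler_addgt0Pl => d /H[_]; rewrite addrC.
move=> d0.
have D n : exists p, Int (fun x => normc (u x - pG p x)) < d / n.+1%:R /\ nrm (u \- pG p) < d / n.+1%:R.
  by apply: L1_L2_dense => //; rewrite divr_gt0.
pose p n := projT1 (cid (D n)).
have pP n := projT2 (cid (D n)).
have dn0 : d / n.+1%:R @[n --> \oo] --> 0.
  by rewrite -(mulr0 d); apply: cvgM; [exact: cvg_cst|exact: cvg_harmonic].
have L n : L1 (u \- pG (p n)) by apply: L1B => //; exact: L1_pG.
apply: (@L2_fatou (fun n => pG (FT (p n)))).
- by move=> n; exact: L2_pG.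
- move=> x; apply/cvgrPdist_le => e e0.
  near=> n.
  rewrite -fourier_pG -ReN -ReD -fourierB//; last exact: L1_pG.
  apply: le_trans (proj1 (normc_fourier_le x (L n))) _.
  apply: le_trans (ltW (proj1 (pP n))) _.
  apply: ltW; near: n.
  exact: (@cvg_nrm_small (fun n => d / n.+1%:R) e dn0 e0).
- move=> x; apply/cvgrPdist_le => e e0.
  near=> n.
  rewrite -fourier_pG -ImN -ImD -fourierB//; last exact: L1_pG.
  apply: le_trans (proj2 (normc_fourier_le x (L n))) _.
  apply: le_trans (ltW (proj1 (pP n))) _.
  apply: ltW; near: n.
  exact: (@cvg_nrm_small (fun n => d / n.+1%:R) e dn0 e0).
- move=> n; rewrite nrm_FT; apply: le_trans (nrm_le_add (L2_pG _) u2) _.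
  rewrite lerD2l nrmBC; apply: le_trans (ltW (proj2 (pP n))) _.
  by rewrite ler_pdivrMr//; apply: ler_peMr; [exact: ltW|rewrite ler1n].
Unshelve. all: by end_near. Qed.

(* The closure in L^2 x L^2 of the graph of the Fourier transform on the
   functions [pG p]; by [plancherel_graphP] it is the Plancherel graph. *)
Definition fpair f g := [/\ L2 f, L2 g & forall e : R, 0 < e ->
  exists p, nrm (f \- pG p) < e /\ nrm (g \- pG (FT p)) < e].

Lemma fpair_fourier u : L1 u -> L2 u -> fpair u (fourier u).
Proof.
move=> u1 u2; have [F2 _] := fourier_nrm_le u1 u2; split => // e e0.
have [p [_ pe]] := L1_L2_dense u1 u2 e0; exists p; split => //.
have L : L1 (u \- pG p) by apply: L1B => //; exact: L1_pG.
have L' : L2 (u \- pG p) by apply: L2B => //; exact: L2_pG.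
have -> : fourier u \- pG (FT p) = fourier (u \- pG p).
  by apply/funext => x /=; rewrite -fourier_pG -fourierB//; exact: L1_pG.
by apply: le_lt_trans pe; exact: (proj2 (fourier_nrm_le L L')).
Qed.

Lemma plancherel_graphP f g : L2 f -> plancherel_graph f g <-> fpair f g.
Proof.
move=> f2; split.
  move=> [/L2P g2 [u [u12 uf ug]]]; split => // e e0.
  have u1 n : L1 (u n) by apply/L1P; case: (u12 n).
  have u2 n : L2 (u n) by apply/L2P; case: (u12 n).
  have F n := fpair_fourier (u1 n) (u2 n).
  have F2 n : L2 (fourier (u n)) by case: (F n).
  have e2 : 0 < e / 2 by rewrite divr_gt0.
  move/cLnorm_cvg : uf => /(_ (fun n => L2B (u2 n) f2)) uf.
  move/cLnorm_cvg : ug => /(_ (fun n => L2B (F2 n) g2)) ug.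
  have [n [a1 a2]] := filter_ex (filterI (cvg_nrm_small uf e2) (cvg_nrm_small ug e2)).
  have [_ _ /(_ _ e2)[p [b1 b2]]] := F n.
  exists p; split.
    have := nrmB_tri f2 (u2 n) (L2_pG p); rewrite [nrm (f \- u n)]nrmBC; gen_norms; lra.
  have := nrmB_tri g2 (F2 n) (L2_pG (FT p)); rewrite [nrm (g \- fourier _)]nrmBC; gen_norms; lra.
move=> [_ g2 H]; split; first exact/L2P.
have D n : exists p, nrm (f \- pG p) < n.+1%:R^-1 /\ nrm (g \- pG (FT p)) < n.+1%:R^-1.
  by apply: H; rewrite invr_gt0.
pose p n := projT1 (cid (D n)).
have pP n := projT2 (cid (D n)).
have sq (a : nat -> R) : (forall n, 0 <= a n < n.+1%:R^-1) -> a n @[n --> \oo] --> 0.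
  move=> aP; apply: (@squeeze_cvgr _ _ _ _ (fun=> 0) (fun n : nat => n.+1%:R^-1)).
  - by apply: nearW => n; have /andP[-> /ltW ->] := aP n.
  - exact: cvg_cst.
  - exact: cvg_harmonic.
have FE n : fourier (pG (p n)) = pG (FT (p n)) by apply/funext => x; rewrite fourier_pG.
exists (fun n => pG (p n)); split.
- by move=> n; split; [apply/L1P; exact: L1_pG|apply/L2P; exact: L2_pG].
- apply/cLnorm_cvg; first by move=> n; apply: L2B => //; exact: L2_pG.
  by apply: sq => n; rewrite nrm_ge0 nrmBC; exact: (proj1 (pP n)).
- under eq_fun do rewrite FE.
  apply/cLnorm_cvg; first by move=> n; apply: L2B => //; exact: L2_pG.
  by apply: sq => n; rewrite nrm_ge0 nrmBC; exact: (proj2 (pP n)).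
Qed.

Lemma fpair_pG p : fpair (pG p) (pG (FT p)).
Proof.
split; [exact: L2_pG|exact: L2_pG|] => e e0; exists p.
have H q : nrm (pG q \- pG q) = 0.
  by rewrite -(nrm0 R); congr nrm; apply/funext => x /=; rewrite subrr.
by rewrite !H.
Qed.

Lemma fpair_D f g f' g' : fpair f g -> fpair f' g' -> fpair (f \+ f') (g \+ g').
Proof.
move=> [f2 g2 H] [f2' g2' H']; split; [exact: L2D|exact: L2D|] => e e0.
have e2 : 0 < e / 2 by rewrite divr_gt0.
have [p [p1 p2]] := H _ e2; have [q [q1 q2]] := H' _ e2.
have S (a b c d : R -> C) : (a \+ b) \- (c \+ d) = (a \- c) \+ (b \- d).
  by apply/funext => x /=; rewrite opprD addrACA.
exists (p + q); rewrite FTD !pGD !S; split.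
  by apply: le_lt_trans (nrmD (L2B f2 (L2_pG p)) (L2B f2' (L2_pG q))) _; gen_norms; lra.
by apply: le_lt_trans (nrmD (L2B g2 (L2_pG (FT p))) (L2B g2' (L2_pG (FT q)))) _; gen_norms; lra.
Qed.

Lemma fpair_N f g : fpair f g -> fpair (fun x => - f x) (fun x => - g x).
Proof.
move=> [f2 g2 H]; split; [exact: L2N|exact: L2N|] => e e0.
have [p [p1 p2]] := H _ e0; exists (- p); rewrite FTN !pGN.
have S (a b : R -> C) : (fun x => - a x) \- (fun x => - b x) = (fun x => - (a \- b) x).
  by apply/funext => x /=; rewrite opprD.
by rewrite !S !nrmN.
Qed.

Lemma fpair_B f g f' g' : fpair f g -> fpair f' g' -> fpair (f \- f') (g \- g').
Proof. by move=> H /fpair_N H'; exact: (fpair_D H H'). Qed.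

Lemma fpair_nrm f g : fpair f g -> nrm g = nrm f.
Proof.
move=> [f2 g2 H]; apply/eqP; rewrite eq_le; apply/andP; split.
- apply/ler_addgt0Pl => e e0.
  have e2 : 0 < e / 2 by rewrite divr_gt0.
  have [p [p1 p2]] := H _ e2.
  have := nrm_le_add g2 (L2_pG (FT p)); have := nrm_le_add (L2_pG p) f2.
  by rewrite nrm_FT [nrm (_ \- f)]nrmBC; gen_norms; lra.
- apply/ler_addgt0Pl => e e0.
  have e2 : 0 < e / 2 by rewrite divr_gt0.
  have [p [p1 p2]] := H _ e2.
  have := nrm_le_add f2 (L2_pG p); have := nrm_le_add (L2_pG (FT p)) g2.
  by rewrite nrm_FT [nrm (_ \- g)]nrmBC; gen_norms; lra.
Qed.

(** Polarisation of [fpair_nrm]; one identity suffices because [ip] is real. *)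
Lemma fpair_ip f g f' g' : fpair f g -> fpair f' g' -> ip g g' = ip f f'.
Proof.
move=> H H'; have := fpair_nrm (fpair_D H H'); have := fpair_nrm H; have := fpair_nrm H'.
have [f2 g2 _] := H; have [f2' g2' _] := H' => e1 e2 e3.
by have := nrmD_sqr f2 f2'; have := nrmD_sqr g2 g2'; rewrite e1 e2 e3; gen_norms; lra.
Qed.

Lemma nrmB_ae f f' g : L2 f -> L2 f' -> L2 g -> {ae mu, forall x : T, f x = f' x} ->
  nrm (f' \- g) <= nrm (f \- g).
Proof.
move=> f2 f2' g2 ff'; rewrite -[leRHS]add0r -(ae_nrmB f2 f2' ff') (nrmBC f f').
exact: nrmB_tri.
Qed.

Lemma fpair_aer f g g' : fpair f g -> L2 g' -> {ae mu, forall x : T, g x = g' x} -> fpair f g'.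
Proof.
move=> [f2 g2 H] g2' gg'; split => // e /H[p [p1 p2]]; exists p; split => //.
exact: le_lt_trans (nrmB_ae g2 g2' (L2_pG (FT p)) gg') p2.
Qed.

Lemma fpair_uniqr f g g' : fpair f g -> fpair f g' -> {ae mu, forall x : T, g x = g' x}.
Proof.
move=> H H'; have [f2 g2 _] := H; have [_ g2' _] := H'.
apply: nrmB_eq0 => //; rewrite (fpair_nrm (fpair_B H H')) -(nrm0 R).
by congr nrm; apply/funext => x /=; rewrite subrr.
Qed.

Lemma fpair_uniql f f' g : fpair f g -> fpair f' g -> {ae mu, forall x : T, f x = f' x}.
Proof.
move=> H H'; have [f2 g2 _] := H; have [f2' _ _] := H'.
apply: nrmB_eq0 => //; rewrite -(fpair_nrm (fpair_B H H')) -(nrm0 R).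
by congr nrm; apply/funext => x /=; rewrite subrr.
Qed.

(** Distances 2^-(n+1) to f make consecutive gaps at most 2^-n, as [L2_complete] asks. *)
Lemma fast_seq f : L2 f -> exists p : nat -> {poly C},
  (forall n, nrm (f \- pG (p n)) <= 2^-1 ^+ n.+1) /\
  (forall n, nrm (pG (p n.+1) \- pG (p n)) <= 2^-1 ^+ n).
Proof.
move=> f2; have D n : exists p, nrm (f \- pG p) < 2^-1 ^+ n.+1.
  by apply: L2_dense => //; rewrite exprn_gt0// invr_gt0.
pose p n := projT1 (cid (D n)).
have pP n := projT2 (cid (D n)).
exists p; split => n; first exact: ltW (pP n).
apply: le_trans (nrmB_tri (L2_pG _) f2 (L2_pG _)) _.
rewrite nrmBC.
have h1 : nrm (f \- pG (p n)) < 2^-1 ^+ n.+1 := pP n.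
have h2 : nrm (f \- pG (p n.+1)) < 2^-1 ^+ n.+2 := pP n.+1.
rewrite !exprS in h1 h2.
have : 0 < 2^-1 ^+ n :> R by rewrite exprn_gt0// invr_gt0.
by lra.
Qed.

Lemma half_pow_small (e : R) : 0 < e -> \forall n \near \oo, 2^-1 ^+ n.+1 < e :> R.
Proof.
move=> e0; apply: cvg_nrm_small => //.
have : (2^-1 : R) ^+ n @[n --> \oo] --> 0.
  by apply: cvg_expr; rewrite ger0_norm ?invr_ge0// invf_lt1// ltr1n.
by rewrite -cvg_shiftS.
Qed.

(** The isometry carries the gaps of the approximants of f over to their transforms, which therefore
    converge. *)
Lemma fpair_ex f : L2 f -> exists g, fpair f g.
Proof.
move=> f2; have [p [p1 p2]] := fast_seq f2.
have [n|n|g g2 gc] := @L2_complete _ (fun n => pG (FT (p n))).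
- exact: L2_pG.
- by rewrite -pGB -FTB nrm_FT pGB.
- exists g; split => // e e0.
  have [n [n1 n2]] := filter_ex (filterI (half_pow_small e0) (cvg_nrm_small gc e0)).
  exists (p n); split; first exact: le_lt_trans (p1 n) n1.
  by rewrite nrmBC.
Qed.

Lemma fpair_ex_inv g : L2 g -> exists f, fpair f g.
Proof.
move=> g2; have [q [q1 q2]] := fast_seq g2.
pose p n := projT1 (cid (FT_surj (q n))).
have pP n : FT (p n) = q n := projT2 (cid (FT_surj (q n))).
have [n|n|f f2 fc] := @L2_complete _ (fun n => pG (p n)).
- exact: L2_pG.
- by rewrite -pGB -nrm_FT FTB !pP pGB.
- exists f; split => // e e0.
  have [n [n1 n2]] := filter_ex (filterI (half_pow_small e0) (cvg_nrm_small fc e0)).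
  exists (p n); split; first by rewrite nrmBC.
  by rewrite pP; exact: le_lt_trans (q1 n) n1.
Qed.

Lemma fpair_plancherel f : L2 f -> fpair f (plancherel f).
Proof.
move=> f2; apply/(plancherel_graphP _ f2); apply: xgetPex.
by have [g /(plancherel_graphP _ f2)] := fpair_ex f2; exists g.
Qed.

(** [fpair_ex_inv] excludes the default value of [xget]; any other value has g as its transform up
    to a null set. *)
Lemma fpair_plancherel_inv g : L2 g -> fpair (plancherel_inv g) g.
Proof.
move=> g2; rewrite /plancherel_inv; case: xgetP => [h -> [/L2P h2 hg]|/(_ _)/= H].
  exact: fpair_aer (fpair_plancherel h2) g2 hg.
have [f fg] := fpair_ex_inv g2; have [f2 _ _] := fg.
exfalso; apply: (H f); split; first exact/L2P.
exact: fpair_uniqr (fpair_plancherel f2) fg.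
Qed.

Lemma fpair_Qop F f : measurable (F : set T) -> L2 f ->
  fpair (Qop F f) (Pop F (plancherel f)).
Proof.
move=> mF f2; apply: fpair_plancherel_inv; apply: L2_Pop => //.
by have [] := fpair_plancherel f2.
Qed.

End Plancherel.

(** * Mass of a function of controlled decrease on a thin set *)

Section ThinInequality.
Variable R : realType.
Local Notation T := (lebesgueType R).
Local Notation mu := (@completed_lebesgue_measure R).
Implicit Types (f g F : R -> R) (E : set R) (s : bool).

Lemma ae_neq (a : R) : {ae mu, forall x : T, x <> a :> R}.
Proof.
exists [set a]; split.
- exact: borel_lebesgue.
- by apply: etrans (lebesgue_measure_set1 a).
- by move=> x /= /contrapT.
Qed.

Lemma Int_indic E : measurable (E : set T) -> Int (\1_E) = fine (mu E).
Proof. by move=> mE; rewrite /Int /Rintegral integral_indic// setIT. Qed.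

Definition loc_itg f := mf f /\ forall a b : R, itg (fun x => \1_`[a, b] x * f x).

Lemma indic_norm_le1 (E : set R) (x : R) : `|\1_E x : R| <= 1.
Proof. by rewrite indicE; case: (_ \in _); rewrite ?normr1 ?normr0. Qed.

Lemma itg_indicM E f : measurable (E : set T) -> itg f -> itg (fun x => \1_E x * f x).
Proof.
move=> mE itf; apply: (itg_le _ _ (itg_norm itf)).
  by apply: mfM; [exact: mf_indic|exact: itg_mf].
by move=> x; rewrite normrM ler_piMl// indic_norm_le1.
Qed.

Lemma loc_itg_itg f : itg f -> loc_itg f.
Proof.
by move=> itf; split=> [|a b]; [exact: itg_mf|apply: itg_indicM => //; exact: itv_measurable].
Qed.

Lemma loc_itg_bounded f (B : R) : mf f -> (forall x, `|f x| <= B) -> loc_itg f.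
Proof.
move=> mf0 fB; split => // a b; apply: (itg_le _ _ (itgZ B (itg_indic_itv a b))).
  by apply: mfM => //; apply: mf_indic; exact: itv_measurable.
move=> x; rewrite normrM mulrC indicE; case: (_ \in _).
  by rewrite normr1 !mulr1.
by rewrite normr0 !mulr0.
Qed.

Lemma loc_itg_cst (c : R) : loc_itg (fun=> c).
Proof. by apply: (@loc_itg_bounded _ `|c|) => //; exact: mf_cst. Qed.

Lemma loc_itgD f g : loc_itg f -> loc_itg g -> loc_itg (fun x => f x + g x).
Proof.
move=> [mf0 itf] [mg itg0]; split; first exact: mfD.
by move=> a b; under eq_fun do rewrite mulrDr; exact: itgD.
Qed.

Lemma loc_itgZ c f : loc_itg f -> loc_itg (fun x => c * f x).
Proof.
move=> [mf0 itf]; split; first by apply: mfM => //; exact: mf_cst.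
by move=> a b; under eq_fun do rewrite mulrCA; exact: itgZ.
Qed.

Lemma loc_itgM E f : measurable (E : set T) -> loc_itg f -> loc_itg (fun x => \1_E x * f x).
Proof.
move=> mE [mf0 itf]; split; first by apply: mfM => //; exact: mf_indic.
by move=> a b; under eq_fun do rewrite mulrCA; exact: itg_indicM.
Qed.

(** Both half-lines are treated at once: [sg s x] is the coordinate pointing outward on the
    half-line chosen by [s], and [side s a b] is the set where it lies in [a, b]. *)
Definition side s (a b : R) : set R := if s then `[a, b]%classic else `[- b, - a]%classic.
Definition side_Int s a b f := Int (fun x => \1_(side s a b) x * f x).
(** The arithmetic of one step of [thin_induction]: the k are integrals of F over E, the f full
    integrals, x0 and x1 values of F, z0, z1 and w excesses, the b integrals of [B], the c
    discretisation errors. *)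
Lemma excess_add (k1 k2 f1 f2 b1 b2 e x0 x1 z0 z1 w c1 c2 : R) :
  k1 - e * f1 <= x0 * z0 + e * b1 + c1 -> k2 - e * f2 <= x0 * w + c2 ->
  x0 * (z0 + w) <= x1 * z1 + e * b2 ->
  k1 + k2 - e * (f1 + f2) <= x1 * z1 + e * (b1 + b2) + (c1 + c2).
Proof. lra. Qed.

Definition sg s (y : R) := if s then y else - y.

Lemma measurable_side s a b : measurable (side s a b : set T).
Proof. by case: s; exact: itv_measurable. Qed.

Lemma itg_side s a b f : loc_itg f -> itg (fun x => \1_(side s a b) x * f x).
Proof. by move=> [_ itf]; case: s; exact: itf. Qed.

Lemma sideP s a b x : side s a b x <-> a <= sg s x <= b.
Proof.
case: s; rewrite /side /sg /= in_itv /=; first by [].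
by rewrite lerNl andbC lerNr.
Qed.

Lemma side_Int_le s a b f g : loc_itg f -> loc_itg g -> (forall x, a <= sg s x <= b -> f x <= g x) ->
  side_Int s a b f <= side_Int s a b g.
Proof.
move=> lf lg fg; apply: Int_le; [exact: itg_side|exact: itg_side|] => x.
rewrite indicE; case: (boolP (x \in _)) => [|_]; last by rewrite !mul0r.
by rewrite inE !mul1r => /sideP; exact: fg.
Qed.

Lemma side_Int_D s a b f g : loc_itg f -> loc_itg g -> side_Int s a b (fun x => f x + g x) = side_Int s a b f + side_Int s a b g.
Proof.
move=> lf lg; rewrite /side_Int -IntD; try exact: itg_side.
by congr Int; apply/funext => x; rewrite mulrDr.
Qed.

Lemma side_Int_Z s a b c f : loc_itg f -> side_Int s a b (fun x => c * f x) = c * side_Int s a b f.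
Proof.
move=> lf; rewrite /side_Int -IntZ; last exact: itg_side.
by congr Int; apply/funext => x; rewrite mulrCA.
Qed.

Lemma side_Int_add s a b c f : a <= b -> b <= c -> loc_itg f -> side_Int s a c f = side_Int s a b f + side_Int s b c f.
Proof.
move=> ab bc lf; rewrite /side_Int -IntD; try exact: itg_side.
have [mf0 _] := lf.
have mS u v : mf (fun x => \1_(side s u v) x * f x).
  by apply: mfM => //; apply: mf_indic; exact: measurable_side.
apply: ae_eq_Int; [exact: mS|by apply: mfD; exact: mS|].
apply: (ae_imply (ae_neq (sg s b))) => x xb.
have xb' : sg s x != b.
  by apply/eqP => e; apply: xb; rewrite -e; case: (s); rewrite /sg ?opprK.
rewrite !indicE -mulrDl; congr (_ * _).
have M u v : (x \in side s u v) = (u <= sg s x <= v).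
  by apply/idP/idP => [|H]; [rewrite inE => /sideP|rewrite inE; apply/sideP].
rewrite !M; move: xb'; rewrite neq_lt => /orP[xb'|xb'].
  by rewrite (ltW xb') (lt_geF xb') (le_trans (ltW xb') bc) addr0.
by rewrite (ltW xb') (lt_geF xb') (le_trans ab (ltW xb')) /= add0r.
Qed.

Lemma side_Int_FTC s a b F f : a <= b -> has_deriv F f -> continuous f ->
  side_Int s a b f = sg s (F (sg s b) - F (sg s a)).
Proof.
move=> ab hF cf; rewrite /side_Int; case: s => /=.
  by have [-> _] := Int_itv ab hF cf.
rewrite -lerN2 in ab; have [-> _] := Int_itv ab hF cf.
by rewrite opprB.
Qed.

Lemma side_Int_cst s a b c : a <= b -> side_Int s a b (fun=> c) = c * (b - a).
Proof.
move=> ab; rewrite (@side_Int_FTC _ _ _ (fun x => c * x))//; last 2 first.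
- exact: has_deriv_lin.
- exact: cst_continuous.
by case: s => /=; ring.
Qed.

Lemma side_Int_point s a f : loc_itg f -> side_Int s a a f = 0.
Proof. by move=> lf; have := side_Int_add s (lexx a) (lexx a) lf; lra. Qed.

Variables (eps kappa : R) (E : set R).
Hypotheses (e0 : 0 < eps) (k0 : 0 < kappa) (k1 : kappa <= 1)
  (Ethin : wolff_thin eps kappa E).

Let mE : measurable (E : set T) := proj1 Ethin.
Let lE : loc_itg (\1_E).
Proof. by apply: (@loc_itg_bounded _ 1); [exact: mf_indic|exact: indic_norm_le1]. Qed.

Definition nxt (a : R) := Num.sqrt (a ^+ 2 + 4 * kappa).

Lemma nxt_sqr a : nxt a ^+ 2 = a ^+ 2 + 4 * kappa.
Proof. by rewrite sqr_sqrtr// addr_ge0 ?sqr_ge0// mulr_ge0// ltW. Qed.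

Lemma nxt_gt a : 0 <= a -> a < nxt a.
Proof.
move=> a0; rewrite -ltr_sqr ?nnegrE ?sqrtr_ge0// nxt_sqr ltrDl mulr_gt0//.
Qed.

Lemma nxt_le a b : 0 <= a -> a <= b -> nxt a <= nxt b.
Proof.
move=> a0 ab; apply: ler_wsqrtr; rewrite lerD2r ler_sqr ?nnegrE//; exact: le_trans ab.
Qed.

Lemma nxt_sub_le a : 0 <= a -> nxt a - a <= 2 * Num.sqrt kappa.
Proof.
move=> a0; rewrite lerBlDr -ler_sqr ?nnegrE ?sqrtr_ge0 ?addr_ge0 ?mulr_ge0 ?sqrtr_ge0//.
rewrite nxt_sqr; have := sqr_sqrtr (ltW k0); have := sqrtr_ge0 kappa; nra.
Qed.

Lemma nxt_sub_mul_le a : 0 <= a -> (nxt a - a) * a <= 2 * kappa.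
Proof.
move=> a0; have := nxt_sqr a; have := nxt_gt a0; nra.
Qed.

(* The interval from [a] to [nxt a] is the window centred at its midpoint. *)
Lemma window_thin s a : 0 <= a -> side_Int s a (nxt a) (\1_E) <= eps * (nxt a - a).
Proof.
move=> a0; have ab := nxt_gt a0.
pose c := (a + nxt a) / 2; pose r := (nxt a - a) / 2.
have c0 : 0 < c by rewrite /c; lra.
have cr : c * r = kappa by have := nxt_sqr a; rewrite /c /r; nra.
have r0 : 0 < r by rewrite /r; lra.
have rc : r <= c by rewrite /r /c; lra.
(* Otherwise kappa = c r <= c^2 < kappa^2 <= kappa. This ensures that [rho] at the midpoint is not
   cut off at 1. *)
have kc : kappa <= c.
  rewrite leNgt; apply/negP => ck.
  have h1 : 0 <= c * (c - r) by rewrite mulr_ge0// ?subr_ge0// ltW.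
  have h2 : 0 < kappa * (kappa - c) by rewrite mulr_gt0// subr_gt0.
  have h3 : 0 <= c * (kappa - c) by rewrite mulr_ge0// ?subr_ge0 ltW.
  have h4 : 0 <= kappa * (1 - kappa) by rewrite mulr_ge0// ?subr_ge0// ltW.
  by move: h1 h2 h3 h4 cr; rewrite !mulrBr; lra.
have rE : rho kappa (sg s c) = r.
  have nc : sg s c != 0 by case: (s); rewrite /sg ?oppr_eq0 gt_eqF.
  rewrite /rho (negbTE nc).
  have -> : `|sg s c| = c by case: (s); rewrite /sg ?normrN gtr0_norm.
  have -> : kappa / c = r by rewrite -cr mulrAC divff ?mul1r// gt_eqF.
  apply/min_idPr; nra.
have := (proj2 Ethin) (sg s c); rewrite rE => H.
have mI : measurable (E `&` Iwolff kappa (sg s c) : set T).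
  by apply: measurableI => //; exact: itv_measurable.
have -> : side_Int s a (nxt a) (\1_E) = Int (\1_(E `&` Iwolff kappa (sg s c))).
  apply: ae_eq_Int.
  - by apply: mfM; apply: mf_indic => //; exact: measurable_side.
  - exact: mf_indic.
  - apply: (ae_imply2 (ae_neq (sg s a)) (ae_neq (sg s (nxt a)))) => x xa xb.
    rewrite setIC indicI /=; congr (_ * _); rewrite !indicE; congr (_%:R); congr nat_of_bool.
    have D1 : a = c - r by rewrite /c /r; field.
    have D2 : nxt a = c + r by rewrite /c /r; field.
    apply/idP/idP; rewrite !inE /Iwolff /= in_itv /= rE.
      move=> /sideP/andP[]; rewrite !le_eqVlt => /orP[/eqP e|h1].
        by case: xa; rewrite e; case: (s); rewrite /sg ?opprK.
      move=> /orP[/eqP e|h2].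
        by case: xb; rewrite -e; case: (s); rewrite /sg ?opprK.
      by move: h1 h2; case: (s); rewrite /sg; lra.
    by move=> h; apply/sideP; move: h; case: (s); rewrite /sg; lra.
rewrite Int_indic//.
have M : (mu (E `&` Iwolff kappa (sg s c)) \is a fin_num)%E.
  by rewrite ge0_fin_numE//; apply: le_lt_trans H _; exact: ltry.
have -> : eps * (nxt a - a) = 2 * eps * r by rewrite /r; field.
by rewrite -lee_fin fineK.
Qed.

(** The interval is cut into windows by iterating [nxt]; each one raises a^2 by 4 kappa, which
    bounds their number n. The last window may reach beyond x, by at most nxt x - x. *)
Lemma interval_thin s a x : 0 <= a -> a <= x ->
  side_Int s a x (\1_E) <= eps * (x - a) + eps * (nxt x - x).
Proof.
have [n] : exists n : nat, x ^+ 2 - a ^+ 2 <= 4 * kappa * n%:R.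
  exists (Num.truncn ((x ^+ 2 - a ^+ 2) / (4 * kappa))).+1.
  have k4 : 0 < 4 * kappa by rewrite mulr_gt0.
  by rewrite mulrC -ler_pdivrMr// ltW// truncnS_gt.
elim: n a => [|n IH] a xan a0 ax.
  have -> : a = x by apply/eqP; rewrite eq_le ax /=; move: xan; rewrite mulr0; nra.
  rewrite side_Int_point// subrr mulr0 add0r; apply: mulr_ge0; first exact: ltW.
  by rewrite subr_ge0; apply: ltW; apply: nxt_gt; exact: le_trans ax.
have x0 := le_trans a0 ax.
have [bx|xb] := leP (nxt a) x.
  rewrite (@side_Int_add _ _ (nxt a))//; last exact: ltW (nxt_gt a0).
  have := window_thin s a0.
  have := IH (nxt a) _ (le_trans a0 (ltW (nxt_gt a0))) bx.
  have : x ^+ 2 - nxt a ^+ 2 <= 4 * kappa * n%:R.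
    by rewrite nxt_sqr; move: xan; rewrite -natr1; lra.
  by move=> -> /(_ isT); lra.
have : side_Int s a x (\1_E) <= side_Int s a (nxt a) (\1_E).
  rewrite (@side_Int_add _ a x (nxt a))//; last exact: ltW.
  rewrite lerDl; apply: Int_ge0 => y.
  by rewrite mulr_ge0// indicE ler0n.
have := window_thin s a0; have := ler_wpM2l (ltW e0) (nxt_le a0 ax); lra.
Qed.

(** By [FD] the outward rate of decrease of F at distance y is at most D1 + y D2. The two terms meet
    the two bounds on w = nxt y - y, namely w <= 2 sqrt kappa and y w <= 2 kappa, and this gives
    [B]. *)
Variables (F F' D1 D2 : R -> R) (L : R).
Hypotheses (F0 : forall x, 0 <= F x) (hF : has_deriv F F') (cF' : continuous F')
  (F'L : forall x, `|F' x| <= L) (iF : itg F)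
  (iD1 : itg D1) (iD2 : itg D2) (D10 : forall x, 0 <= D1 x) (D20 : forall x, 0 <= D2 x)
  (FD : forall s y, 0 <= y -> - (D1 (sg s y) + y * D2 (sg s y)) <= sg s (F' (sg s y))).

Let B x := 2 * Num.sqrt kappa * D1 x + 2 * kappa * D2 x.
Let M s a b := side_Int s a b (\1_E) - eps * (b - a).

Let iB : itg B.
Proof. by apply: itgD; exact: itgZ. Qed.

Let lEF : loc_itg (fun x => \1_E x * F x).
Proof. by apply: loc_itgM => //; exact: loc_itg_itg. Qed.

Lemma F_Lip x y : `|F x - F y| <= L * `|x - y|.
Proof.
wlog xy : x y / x <= y.
  by have [xy|yx] := leP x y => H; [exact: H|rewrite distrC [`|x - y|]distrC; apply: H; exact: ltW].
have := @side_Int_FTC true x y F F' xy hF cF'.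
rewrite /= => H.
have l1 : loc_itg F' by apply: (@loc_itg_bounded _ L) => //; exact: mf_continuous.
have h1 : side_Int true x y F' <= side_Int true x y (fun=> L).
  by apply: side_Int_le => //; [exact: loc_itg_cst|move=> z _; have := F'L z; rewrite ler_norml => /andP[]].
have h2 : side_Int true x y (fun=> - L) <= side_Int true x y F'.
  by apply: side_Int_le => //; [exact: loc_itg_cst|move=> z _; have := F'L z; rewrite ler_norml => /andP[]].
rewrite !side_Int_cst// H in h1 h2.
rewrite distrC [`|x - y|]distrC (ger0_norm (_ : 0 <= y - x)) ?subr_ge0//.
by rewrite ler_norml; apply/andP; split; lra.
Qed.

(** F is frozen at the inner end of the cell. It varies by at most L h there, which costs L h^2 for
    the integral over E and eps L h^2 for the full one. *)
Lemma thin_step s (y h : R) : 0 <= y -> 0 <= h ->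
  side_Int s y (y + h) (fun x => \1_E x * F x) - eps * side_Int s y (y + h) F <=
  F (sg s y) * M s y (y + h) + (1 + eps) * L * h ^+ 2.
Proof.
move=> y0 h0; have yh : y <= y + h by rewrite lerDl.
have L0 : 0 <= L by exact: le_trans (normr_ge0 _) (F'L 0).
have near x : y <= sg s x <= y + h -> `|F x - F (sg s y)| <= L * h.
  move=> xy; apply: le_trans (F_Lip _ _) _; rewrite ler_wpM2l//.
  rewrite ler_norml; move: xy; case: (s); rewrite /sg; lra.
have a1 : side_Int s y (y + h) (fun x => \1_E x * F x) <= side_Int s y (y + h) (fun x => (F (sg s y) + L * h) * \1_E x).
  apply: side_Int_le => //; first exact: loc_itgZ.
  move=> x /near; rewrite ler_norml indicE; case: (x \in E) => H.
    by rewrite mul1r mulr1; lra.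
  by rewrite mul0r mulr0.
have a2 : side_Int s y (y + h) (fun=> F (sg s y) - L * h) <= side_Int s y (y + h) F.
  apply: side_Int_le; [exact: loc_itg_cst|exact: loc_itg_itg|].
  by move=> x /near; rewrite ler_norml; lra.
have a3 : side_Int s y (y + h) (\1_E) <= side_Int s y (y + h) (fun=> 1).
  apply: side_Int_le => //; first exact: loc_itg_cst.
rewrite side_Int_Z// in a1; rewrite !side_Int_cst// in a2 a3.
rewrite /M; have := F0 (sg s y).
set k := side_Int s y (y + h) (\1_E) in a1 a3 *.
set u := side_Int _ _ _ _ in a1 *; set v := side_Int _ _ _ F in a2 *.
have -> : y + h - y = h by ring.
rewrite (_ : y + h - y = h) in a2 a3; last by ring.
move=> Fy0.
have b2 : eps * ((F (sg s y) - L * h) * h) <= eps * v by rewrite ler_pM2l.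
have b3 : L * h * k <= L * h * h by apply: ler_wpM2l; [exact: mulr_ge0|lra].
by rewrite mul1r in a3; nra.
Qed.

Lemma M_le s a x : 0 <= a -> a <= x -> M s a x <= eps * (nxt x - x).
Proof. by move=> a0 ax; have := interval_thin s a0 ax; rewrite /M; lra. Qed.

(** The fall of F across the cell is the integral of its rate of decrease, and the excess is at most
    eps times w at y + h. Since w is taken at the outer end, its product with any coordinate in the
    cell is still at most 2 kappa. *)
Lemma thin_decrement s (a y h : R) : 0 <= a -> a <= y + h -> 0 <= y -> 0 <= h -> 0 <= M s a (y + h) ->
  (F (sg s y) - F (sg s (y + h))) * M s a (y + h) <= eps * side_Int s y (y + h) B.
Proof.
move=> a0 ay y0 h0 z0; set z := M _ _ _ in z0 *.
have yh : y <= y + h by rewrite lerDl.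
have l1 : loc_itg F' by apply: (@loc_itg_bounded _ L) => //; exact: mf_continuous.
have zx := M_le s a0 ay; rewrite -/z in zx.
have H := @side_Int_FTC s y (y + h) F F' yh hF cF'.
have -> : (F (sg s y) - F (sg s (y + h))) * z = side_Int s y (y + h) (fun x => (- sg s z) * F' x).
  by rewrite side_Int_Z// H; case: (s); rewrite /sg; ring.
rewrite -side_Int_Z; last exact: loc_itg_itg.
apply: side_Int_le; [exact: loc_itgZ|by apply: loc_itgZ; exact: loc_itg_itg|].
move=> x /andP[yx xy].
have x0 : 0 <= sg s x by exact: le_trans yx.
have := FD s x0; have -> : sg s (sg s x) = x by case: (s); rewrite /sg ?opprK.
move=> fd.
have yh0 : 0 <= y + h by rewrite addr_ge0.
have w1 := nxt_sub_le yh0; have w2 := nxt_sub_mul_le yh0.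
have w0 := ltW (nxt_gt yh0).
have -> : - sg s z * F' x = - (z * sg s (F' x)) by case: (s); rewrite /sg; ring.
have c1 : - (z * sg s (F' x)) <= z * (D1 x + sg s x * D2 x).
  by rewrite -mulrN ler_wpM2l//; lra.
apply: le_trans c1 _.
have d1 := D10 x; have d2 := D20 x.
have c2 : z * D1 x <= eps * (2 * Num.sqrt kappa) * D1 x.
  apply: ler_wpM2r => //; apply: le_trans zx _; exact: ler_wpM2l (ltW e0) _ _ w1.
have c3 : z * sg s x <= eps * (2 * kappa).
  apply: le_trans (_ : eps * ((nxt (y + h) - (y + h)) * (y + h)) <= _).
    rewrite mulrA; apply: ler_pM => //.
  exact: ler_wpM2l (ltW e0) _ _ w2.
have c4 : z * sg s x * D2 x <= eps * (2 * kappa) * D2 x by exact: ler_wpM2r.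
by rewrite /B; lra.
Qed.

(* Summation by parts over a grid: [a] is the grid point at which the excess
   [M] was last reset to 0, so that it stays nonnegative. *)
Lemma thin_induction s (h : R) (i : nat) : 0 <= h -> exists a, [/\ 0 <= a, a <= i%:R * h,
  0 <= M s a (i%:R * h) &
  side_Int s 0 (i%:R * h) (fun x => \1_E x * F x) - eps * side_Int s 0 (i%:R * h) F <=
  F (sg s (i%:R * h)) * M s a (i%:R * h) + eps * side_Int s 0 (i%:R * h) B +
  (1 + eps) * L * h ^+ 2 * i%:R].
Proof.
move=> h0; elim: i => [|i [a [a0 ai z0 IH]]].
  exists 0; rewrite mul0r mulr0 addr0; split => //.
    by rewrite /M side_Int_point// subrr mulr0 subr0.
  by rewrite (side_Int_point _ _ lEF) (side_Int_point _ _ (loc_itg_itg iF)) (side_Int_point _ _ (loc_itg_itg iB)) /M (side_Int_point _ _ lE); lra.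
have y0 : 0 <= i%:R * h by rewrite mulr_ge0.
set y := i%:R * h in a0 ai z0 IH y0 *.
have yE : i.+1%:R * h = y + h by rewrite -natr1 mulrDl mul1r.
rewrite yE; have yh : y <= y + h by rewrite lerDl.
rewrite !(@side_Int_add _ 0 y (y + h))//; [|exact: loc_itg_itg|exact: loc_itg_itg].
have S := thin_step s y0 h0.
have Mad : M s a (y + h) = M s a y + M s y (y + h).
  by rewrite /M (@side_Int_add _ a y (y + h))//; ring.
have Fy0 := F0 (sg s y).
have iE : (1 + eps) * L * h ^+ 2 * i.+1%:R = (1 + eps) * L * h ^+ 2 * i%:R + (1 + eps) * L * h ^+ 2.
  by rewrite -natr1 mulrDr mulr1.
rewrite iE.
have [zp|zn] := leP 0 (M s a (y + h)).
  (* Abel summation: the excess is carried on with the new value of F, and the fall of F is charged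
     to [B]. *)
  exists a; split => //; first exact: le_trans yh.
  have := @thin_decrement s a y h a0 (le_trans ai yh) y0 h0 zp.
  by move=> D; apply: (excess_add IH S); rewrite -Mad -lerBlDl -mulrBl.
(* The excess has become negative, so its product with F is dropped and counting restarts at y + h.
   The decrement with excess 0 only records that the integral of [B] is nonnegative. *)
exists (y + h); split => //.
- exact: addr_ge0.
- by rewrite /M side_Int_point// subrr mulr0 subr0.
- have yh0 : 0 <= y + h by exact: addr_ge0.
  have M0 : M s (y + h) (y + h) = 0 by rewrite /M side_Int_point// subrr mulr0 subr0.
  have := @thin_decrement s (y + h) y h yh0 (lexx _) y0 h0; rewrite M0 => /(_ (lexx 0)).
  have := mulr_ge0_le0 Fy0 (ltW zn); rewrite Mad mulr0 => P D.
  by apply: (excess_add IH S); rewrite mulr0 add0r; exact: le_trans P D.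
Qed.

(** With N cells the errors add up to (1 + eps) L Y^2 / N, which is arbitrarily small. The boundary
    term bounds the last excess through [nxt_sub_le]. *)
Lemma thin_half_bounded s (Y : R) : 0 <= Y ->
  side_Int s 0 Y (fun x => \1_E x * F x) <= eps * (side_Int s 0 Y F + side_Int s 0 Y B) +
    eps * (2 * Num.sqrt kappa) * F (sg s Y).
Proof.
move=> Y0; apply/ler_addgt0Pl => d d0.
have L0 : 0 <= L by exact: le_trans (normr_ge0 _) (F'L 0).
pose C := (1 + eps) * L * Y ^+ 2.
have C0 : 0 <= C by apply: mulr_ge0; [apply: mulr_ge0 => //; apply: addr_ge0 => //; exact: ltW|exact: sqr_ge0].
pose N := (Num.truncn (C / d)).+1.
have Nd : C / d < N%:R by exact: truncnS_gt.
have N0 : 0 < N%:R :> R by rewrite ltr0n.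
have [a [a0 ai z0 H]] := @thin_induction s (Y / N%:R) N (divr_ge0 Y0 (ltW N0)).
have YE : N%:R * (Y / N%:R) = Y by rewrite mulrCA divff ?mulr1// gt_eqF.
rewrite YE in ai z0 H.
have E1 : (1 + eps) * L * (Y / N%:R) ^+ 2 * N%:R = C / N%:R.
  by rewrite /C; field; rewrite gt_eqF.
rewrite E1 in H.
have E2 : C / N%:R <= d.
  by rewrite ler_pdivrMr// mulrC -ler_pdivrMr// ltW.
have M1 := M_le s a0 ai; have M2 := nxt_sub_le Y0.
have M3 : M s a Y <= eps * (2 * Num.sqrt kappa).
  by apply: le_trans M1 _; exact: ler_wpM2l (ltW e0) _ _ M2.
have M4 : F (sg s Y) * M s a Y <= F (sg s Y) * (eps * (2 * Num.sqrt kappa)) by exact: ler_wpM2l.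
by lra.
Qed.

Hypothesis (F_cvg : forall s, F (sg s n%:R) @[n --> \oo] --> 0).

Lemma side_Int_halves f (n : nat) : loc_itg f ->
  side_Int true 0 n%:R f + side_Int false 0 n%:R f = Int (fun x => \1_`[- n%:R, n%:R] x * f x).
Proof.
move=> lf; have -> : side_Int false 0 n%:R f = side_Int true (- n%:R) 0 f by rewrite /side_Int /= oppr0.
by rewrite addrC -(@side_Int_add true (- n%:R) 0 n%:R)// oppr_le0.
Qed.

Theorem thin_inequality : Int (fun x => \1_E x * F x) <=
  eps * (Int F + 2 * Num.sqrt kappa * Int D1 + 2 * kappa * Int D2).
Proof.
have -> : Int F + 2 * Num.sqrt kappa * Int D1 + 2 * kappa * Int D2 = Int F + Int B.
  by rewrite /B IntD ?itgZ// !IntZ// addrA.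
have iEF : itg (fun x => \1_E x * F x) by exact: itg_indicM.
pose r n := eps * (Int (fun x => \1_`[- n%:R, n%:R] x * F x) + Int (fun x => \1_`[- n%:R, n%:R] x * B x)) +
   eps * (2 * Num.sqrt kappa) * (F n%:R + F (- n%:R)).
have rc : r n @[n --> \oo] --> eps * (Int F + Int B) + eps * (2 * Num.sqrt kappa) * (0 + 0).
  apply: cvgD; apply: cvgM; try exact: cvg_cst.
    by apply: cvgD; exact: Int_cvg_itv.
  by apply: cvgD; [exact: (F_cvg true)|exact: (F_cvg false)].
rewrite addr0 mulr0 addr0 in rc.
apply: (ler_cvg_to (Int_cvg_itv iEF) rc).
apply: nearW => n; rewrite /r -!side_Int_halves; try exact: loc_itg_itg.
have := thin_half_bounded true (ler0n R n); have := thin_half_bounded false (ler0n R n).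
by rewrite /sg; lra.
Qed.

End ThinInequality.

(** * Splitting into halves and the mass outside a thin set *)

Section LowerBound.
Variable R : realType.
Local Notation Re := complex.Re.
Local Notation Im := complex.Im.
Local Notation normc := Normc.normc.
Local Notation C := R[i].
Local Notation G := (@gauss R).
Local Notation c2 := (@c2 R).
Local Notation ii := ('i%C : C).
Implicit Types (f g : R -> C) (p q : {poly C}) (c : C).

Lemma dot_le_normc (z w : C) : `|dot z w| <= normc z * normc w.
Proof.
rewrite -ler_sqr ?nnegrE ?mulr_ge0 ?normc_ge0// exprMn !normc_sqr real_normK ?num_real//.
rewrite /dot /nsq; case: z => a b; case: w => u v /=.
have := sqr_ge0 (a * v - b * u); nra.
Qed.

Lemma Int_normcM f g : L2 f -> L2 g ->
  itg (fun x => normc (f x) * normc (g x)) /\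
  Int (fun x => normc (f x) * normc (g x)) <= nrm f * nrm g.
Proof.
move=> f2 g2; have f2' := L2_normc f2; have g2' := L2_normc g2.
have E : (fun x => normc (f x) * normc (g x)) =
  (fun x => dot ((normc (f x))%:C%C) ((normc (g x))%:C%C)).
  by apply/funext => x; rewrite /dot /= mulr0 addr0.
rewrite E; split; first exact: itg_dot.
rewrite -(nrm_normc f) -(nrm_normc g).
exact: le_trans (ler_norm _) (ip_le f2' g2').
Qed.

(* [lhalf c q + rhalf c q] runs over all polynomials, and the Fourier transform
   exchanges the two halves up to replacing [q] by [- i FT q]. *)
Definition lhalf c q : {poly C} := (c / 2)%:P + 'X * q.
Definition rhalf c q : {poly C} := (c / 2)%:P + 'X * q - c2 *: q^`().

Lemma lhalf_add_rhalf c q : lhalf c q + rhalf c q = c%:P + cre q.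
Proof.
have cE : c%:P = (c / 2)%:P + (c / 2)%:P :> {poly C} by rewrite -polyCD -splitr.
by rewrite cE /lhalf /rhalf /cre scaler_nat mulr2n; ring.
Qed.

Lemma lhalf_sub_rhalf c q : lhalf c q - rhalf c q = ann q.
Proof. by rewrite /rhalf /ann opprB addrC subrK. Qed.

Lemma FT_rhalf c q : FT (rhalf c q) = lhalf c (- ii *: FT q).
Proof.
by rewrite /rhalf /lhalf FTB FTD FTC FTX FTZ addrA addrK -scalerAr.
Qed.

Lemma FT_lhalf c q : FT (lhalf c q) = rhalf c (- ii *: FT q).
Proof.
rewrite /rhalf /lhalf FTD FTC FTX derivZ FT_deriv -scalerAr addrA; congr (_ + _).
have -> : - ii *: (- ii *: FT q^`()) = - FT q^`().
  by rewrite scalerA mulrNN -expr2 sqr_i scaleN1r.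
by rewrite scalerN opprK.
Qed.

Lemma nrm_ii_FT q : nrm (pG (- ii *: FT q)) = nrm (pG q).
Proof. by rewrite -(nrm_FT q) /nrm ipZZ// nsqN nsq_ii. Qed.

Lemma ip_pGZr (r : R) p q : ip (pG p) (pG (r%:C%C *: q)) = r * ip (pG p) (pG q).
Proof. by rewrite ipC pGZ ipZl ?(ipC (pG q))//; exact: L2_pG. Qed.

(** The commutator of [ann] and [cre] is the constant 1 / pi. *)
Lemma nrm_ann q : nrm (pG (ann q)) ^+ 2 = nrm (pG (cre q)) ^+ 2 - pi^-1 * nrm (pG q) ^+ 2.
Proof.
have ac : ann (cre q) = cre (ann q) + (pi^-1)%:C%C *: q.
  rewrite /ann /cre derivB !derivZ derivM derivX mul1r.
  have -> : ((pi^-1)%:C%C : C) = 2 * c2.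
    by rewrite /c2 two_complex -rmorphM /= invfM mulrA divff ?mul1r// pnatr_eq0.
  rewrite -scalerAr !scalerBr !scalerDr !scalerA ![c2 * 2]mulrC.
  by rewrite -!addrA addrC -!addrA.
have e : ip (pG (cre q)) (pG (cre q)) = ip (pG (ann q)) (pG (ann q)) + pi^-1 * ip (pG q) (pG q).
  by rewrite ip_cre_ann ac ip_pGDr ip_pGZr (ipC (pG q)) ip_cre_ann.
by rewrite !nrm_sqr e addrK.
Qed.

(** Parallelogram law: the sum of the halves is c + cre q, an orthogonal sum, and their difference
    is ann q, whose norm [nrm_ann] compares with that of cre q. *)
Lemma nrm_halves c q : nrm (pG (lhalf c q)) ^+ 2 + nrm (pG (rhalf c q)) ^+ 2 =
  nrm (pG (c%:P + cre q)) ^+ 2 - nrm (pG c%:P) ^+ 2 / 2 - (2 * pi)^-1 * nrm (pG q) ^+ 2.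
Proof.
have h1 := L2_pG (lhalf c q); have h2 := L2_pG (rhalf c q).
have e1 := nrmD_sqr h1 h2; have e2 := nrmB_sqr h1 h2.
rewrite -pGD lhalf_add_rhalf in e1; rewrite -pGB lhalf_sub_rhalf nrm_ann in e2.
have e3 := nrmD_sqr (L2_pG c%:P) (L2_pG (cre q)).
rewrite -pGD ip_pG_const_cre mulr0 addr0 in e3.
have aux : forall x a b d u r s t : R, a = b + 2 * u + d -> r - x * t = b - 2 * u + d ->
  a = s + r -> b + d = a - s / 2 - 2^-1 * x * t.
  by clear -R; move=> *; lra.
by rewrite invfM; exact: aux e1 e2 e3.
Qed.

Definition sqp p : {poly R} := pRe p ^+ 2 + pIm p ^+ 2.

Lemma nsq_pG_ga p x : nsq (pG p x) = (sqp p).[x] * ga (pi + pi) x.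
Proof. by rewrite nsq_pG -gaM. Qed.

Lemma pRe_lhalf c q : pRe (lhalf c q) = (Re c / 2)%:P + 'X * pRe q.
Proof.
rewrite /lhalf [(c / 2)%:P + _]addrC [RHS]addrC -commr_polyX pRe_MXaddC commr_polyX.
by congr (_ + _%:P); case: c => a b; rewrite two_complex -fmorphV ReM /= mulr0 subr0.
Qed.

Lemma pIm_lhalf c q : pIm (lhalf c q) = (Im c / 2)%:P + 'X * pIm q.
Proof.
rewrite /lhalf [(c / 2)%:P + _]addrC [RHS]addrC -commr_polyX pIm_MXaddC commr_polyX.
by congr (_ + _%:P); case: c => a b; rewrite two_complex -fmorphV ImM /= mulr0 add0r.
Qed.

Lemma c2E : c2 = ((2 * pi)^-1)%:C%C. Proof. by []. Qed.

Lemma pRe_rhalf c q : pRe (rhalf c q) = pRe (lhalf c q) - (2 * pi)^-1 *: (pRe q)^`().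
Proof. by rewrite /rhalf pReB c2E pRe_scaler pRe_deriv. Qed.

Lemma pIm_rhalf c q : pIm (rhalf c q) = pIm (lhalf c q) - (2 * pi)^-1 *: (pIm q)^`().
Proof. by rewrite /rhalf pImB c2E pIm_scaler pIm_deriv. Qed.

Lemma dot_pG p q x : dot (pG p x) (pG q x) =
  ((pRe p).[x] * (pRe q).[x] + (pIm p).[x] * (pIm q).[x]) * ga (pi + pi) x.
Proof. by rewrite /dot !Re_pG !Im_pG -gaM -/G; ring. Qed.

(** The right half is made so that the last product absorbs q' together with the derivative of G^2;
    no derivative of q is left to estimate. *)
Lemma deriv_lhalf_sqr c q x :
  ((sqp (lhalf c q))^`() - (2 * (pi + pi)) *: ('X * sqp (lhalf c q))).[x] * ga (pi + pi) x =
  dot (pG c%:P x) (pG q x) + 2 * x * nsq (pG q x) -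
    4 * pi * x * dot (pG (lhalf c q) x) (pG (rhalf c q) x).
Proof.
rewrite !dot_pG nsq_pG_ga; set g := ga _ x.
transitivity (((pRe c%:P).[x] * (pRe q).[x] + (pIm c%:P).[x] * (pIm q).[x] + 2 * x * (sqp q).[x] -
  4 * pi * x * ((pRe (lhalf c q)).[x] * (pRe (rhalf c q)).[x] + (pIm (lhalf c q)).[x] * (pIm (rhalf c q)).[x])) * g);
  last by ring.
congr (_ * g).
have -> : pRe c%:P = (Re c)%:P.
  by apply/polyP => i; rewrite coef_pRe !coefC; case: ifP.
have -> : pIm c%:P = (Im c)%:P.
  by apply/polyP => i; rewrite coef_pIm !coefC; case: ifP.
rewrite /sqp pRe_rhalf pIm_rhalf pRe_lhalf pIm_lhalf.
rewrite !(expr2,derivD,derivM,derivC,derivX,hornerD,hornerN,hornerZ,hornerM,hornerX,hornerC,horner0,mul1r,mul0r,add0r).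
have : pi != 0 :> R by rewrite gt_eqF// pi_gt0.
move: (pi : R) => t t0.
set a := (pRe q).[x]; set b := (pIm q).[x].
set a' := (_^`()).[x]; set b' := (_^`()).[x].
by field.
Qed.

Lemma slope_le (s : bool) (d m d' m' n t y : R) : `|d| <= m -> `|d'| <= m' -> 0 <= n ->
  0 <= y -> 0 <= t -> - (m + y * (t * m')) <= sg s (d + 2 * sg s y * n - t * sg s y * d').
Proof.
rewrite !ler_norml => /andP[l1 l2] /andP[l3 l4] n0 y0 t0.
have h1 := ler_wpM2l (mulr_ge0 t0 y0) l3; have h2 := ler_wpM2l (mulr_ge0 t0 y0) l4.
have h3 : 0 <= 2 * y * n by rewrite !mulr_ge0.
by case: s; rewrite /sg; lra.
Qed.

(** The product X Y is bounded by the mean of the squares. Half of 4 s A B is absorbed by (A - 2 s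
    B)^2 >= 0 and half by (B - 2 t s A)^2 >= 0, using the energy lost in the splitting. In the
    application t = pi and s = sqrt kappa. *)
Lemma halves_energy (X Y P A B s t : R) : 0 < t ->
  X ^+ 2 + Y ^+ 2 = P ^+ 2 - A ^+ 2 / 2 - (2 * t)^-1 * B ^+ 2 ->
  X ^+ 2 + Y ^+ 2 + 4 * s * (A * B) + 16 * t * s ^+ 2 * (X * Y) <=
  (1 + 8 * t * s ^+ 2) * P ^+ 2.
Proof.
move=> t0 N.
have ts : 0 <= t * s ^+ 2 by rewrite mulr_ge0 ?sqr_ge0// ltW.
have h1 : 0 <= t * s ^+ 2 * (X - Y) ^+ 2 by rewrite mulr_ge0// sqr_ge0.
have h2 : 0 <= (A - 2 * s * B) ^+ 2 by exact: sqr_ge0.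
have h3 : 0 <= (2 * t)^-1 * (B - 2 * t * s * A) ^+ 2.
  by rewrite mulr_ge0 ?sqr_ge0// invr_ge0 mulr_ge0// ltW.
have h4 : 0 <= t * s ^+ 2 * A ^+ 2 by rewrite mulr_ge0// sqr_ge0.
have h5 : 0 <= s ^+ 2 * B ^+ 2 by rewrite mulr_ge0 ?sqr_ge0.
have e3 : (2 * t)^-1 * (B - 2 * t * s * A) ^+ 2 =
  (2 * t)^-1 * B ^+ 2 - 2 * s * A * B + 2 * t * s ^+ 2 * A ^+ 2.
  by field; rewrite gt_eqF.
have e4 : t * s ^+ 2 * ((2 * t)^-1 * B ^+ 2) = s ^+ 2 * B ^+ 2 / 2.
  by field; rewrite gt_eqF.
have -> : P ^+ 2 = X ^+ 2 + Y ^+ 2 + A ^+ 2 / 2 + (2 * t)^-1 * B ^+ 2 by rewrite N; ring.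
have -> : (1 + 8 * t * s ^+ 2) * (X ^+ 2 + Y ^+ 2 + A ^+ 2 / 2 + (2 * t)^-1 * B ^+ 2) =
  X ^+ 2 + Y ^+ 2 + A ^+ 2 / 2 + (2 * t)^-1 * B ^+ 2 +
  8 * (t * s ^+ 2) * (X ^+ 2 + Y ^+ 2) + 4 * (t * s ^+ 2 * A ^+ 2) +
  8 * (t * s ^+ 2 * ((2 * t)^-1 * B ^+ 2)).
  by move: ((2 * t)^-1 * B ^+ 2) => w; field.
rewrite e4; rewrite e3 in h3; move: h1 h2 h3 h4 h5; clear.
move: ((2 * t)^-1 * B ^+ 2) => w; lra.
Qed.

Lemma sqr_add_le (u v w : R) : u ^+ 2 + v ^+ 2 <= w -> (u + v) ^+ 2 <= 2 * w.
Proof. by have := sqr_ge0 (u - v); nra. Qed.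

Variables (eps kappa : R).
Hypotheses (e0 : 0 < eps) (k0 : 0 < kappa) (k1 : kappa <= 1).

Lemma thin_lhalf E c q : wolff_thin eps kappa E ->
  nrm (Pop E (pG (lhalf c q))) ^+ 2 <=
  eps * (nrm (pG (lhalf c q)) ^+ 2 + 2 * Num.sqrt kappa * (nrm (pG c%:P) * nrm (pG q)) +
         8 * pi * kappa * (nrm (pG (lhalf c q)) * nrm (pG (rhalf c q)))).
Proof.
move=> Eth; have pi0 := pi_gt0 R; have pp : 0 < pi + pi :> R by rewrite addr_gt0.
have [i1 b1] := Int_normcM (L2_pG c%:P) (L2_pG q).
have [i2 b2] := Int_normcM (L2_pG (lhalf c q)) (L2_pG (rhalf c q)).
pose P := sqp (lhalf c q).
pose F x := P.[x] * ga (pi + pi) x.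
pose F' x := (P^`() - (2 * (pi + pi)) *: ('X * P)).[x] * ga (pi + pi) x.
have FE x : F x = nsq (pG (lhalf c q) x) by rewrite nsq_pG_ga.
have [B B0 FB] := poly_ga_le (P^`() - (2 * (pi + pi)) *: ('X * P)) pp.
have F'B x : `|F' x| <= B.
  apply: le_trans (FB x) _; rewrite -[leRHS]mulr1 ler_wpM2l//.
  rewrite /ga -[leRHS]expR0 ler_expR oppr_le0 mulr_ge0 ?sqr_ge0// divr_ge0// ltW//.
have [Fc1 Fc2] := poly_ga_cvg0 P pp.
have H := @thin_inequality R eps kappa E e0 k0 k1 Eth F F'
  (fun x => normc (pG c%:P x) * normc (pG q x))
  (fun x => 4 * pi * (normc (pG (lhalf c q) x) * normc (pG (rhalf c q) x))) B.
have -> : nrm (Pop E (pG (lhalf c q))) ^+ 2 = Int (fun x => \1_E x * F x).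
  rewrite nrm_sqr ipff; congr Int; apply/funext => x; rewrite PopE indicE FE.
  case: (x \in E); first by rewrite mul1r.
  by rewrite mul0r /nsq /= expr0n addr0.
have -> : nrm (pG (lhalf c q)) ^+ 2 = Int F.
  by rewrite nrm_sqr ipff; congr Int; apply/funext => x.
apply: le_trans (H _ _ _ _ _ _ _ _ _ _ _) _.
- by move=> x; rewrite FE nsq_ge0.
- exact: has_deriv_poly_ga.
- exact: continuous_poly_ga.
- exact: F'B.
- exact: itg_poly_ga.
- exact: i1.
- exact: itgZ.
- by move=> x; rewrite mulr_ge0 ?normc_ge0.
- by move=> x; rewrite !mulr_ge0 ?normc_ge0// ltW.
- move=> s y y0; set x := sg s y.
  rewrite /F' deriv_lhalf_sqr.
  have d1 := dot_le_normc (pG c%:P x) (pG q x).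
  have d2 := dot_le_normc (pG (lhalf c q) x) (pG (rhalf c q) x).
  exact: slope_le d1 d2 (nsq_ge0 _) y0 (mulr_ge0 (ler0n _ 4) (ltW pi0)).
- by case=> /=.
- rewrite IntZ// ler_pM2l// -!addrA lerD2l; apply: lerD.
    by apply: ler_wpM2l => //; rewrite mulr_ge0// sqrtr_ge0.
  have -> : 2 * kappa * (4 * pi * Int (fun x => normc (pG (lhalf c q) x) * normc (pG (rhalf c q) x))) =
    8 * pi * kappa * Int (fun x => normc (pG (lhalf c q) x) * normc (pG (rhalf c q) x)) by ring.
  by apply: ler_wpM2l => //; rewrite !mulr_ge0// ltW.
Qed.

(** The transform of the right half for q is the left half for -i FT q, so [thin_lhalf] serves both
    E and F. The norms of the halves trade places and the cross terms double, giving the left side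
    of [halves_energy]. *)
Lemma split_estimate E F p : wolff_thin eps kappa E -> wolff_thin eps kappa F ->
  exists h1 h2 : {poly C}, [/\ p = h1 + h2, nrm (pG h1) ^+ 2 <= nrm (pG p) ^+ 2 &
   nrm (Pop E (pG h1)) ^+ 2 + nrm (Pop F (pG (FT h2))) ^+ 2 <=
   eps * (1 + 8 * pi * kappa) * nrm (pG p) ^+ 2].
Proof.
move=> tE tF; have [c [q [-> _]]] := cre_decomp p.
have pi0 := pi_gt0 R.
exists (lhalf c q), (rhalf c q); split; first by rewrite lhalf_add_rhalf.
  have := nrm_halves c q; have := sqr_ge0 (nrm (pG c%:P)); have := sqr_ge0 (nrm (pG (rhalf c q))).
  have : 0 <= (2 * pi)^-1 * nrm (pG q) ^+ 2 by rewrite mulr_ge0 ?sqr_ge0// invr_ge0 mulr_ge0// ltW.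
  by move: (_ * nrm (pG q) ^+ 2) => w; gen_norms; lra.
have a1 := thin_lhalf c q tE; have a2 := thin_lhalf c (- ii *: FT q) tF.
rewrite -FT_rhalf -FT_lhalf !nrm_FT nrm_ii_FT in a2.
have N := nrm_halves c q.
move: a1 a2 N.
set u := nrm (Pop _ _); set v := nrm (Pop _ _).
set X := nrm (pG (lhalf c q)); set Y := nrm (pG (rhalf c q)); set P := nrm (pG (_ + _)).
set A := nrm (pG c%:P); set B := nrm (pG q).
have s2 := sqr_sqrtr (ltW k0); set s := Num.sqrt kappa in s2 *; rewrite -s2.
move=> a1 a2 N.
suff : X ^+ 2 + Y ^+ 2 + 4 * s * (A * B) + 16 * pi * s ^+ 2 * (X * Y) <=
   (1 + 8 * pi * s ^+ 2) * P ^+ 2.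
  by move=> H; have := ler_wpM2l (ltW e0) H; lra.
exact: halves_energy pi0 N.
Qed.

(** In [key] the pairing of g with p G splits into h1 on E, h1 outside E, and, through the
    transform, h2 on F. The first and third parts are controlled by [split_estimate], the second by
    t. *)
Lemma thin_pair_bound E F g k : wolff_thin eps kappa E -> wolff_thin eps kappa F ->
  2 * (eps * (1 + 8 * pi * kappa)) < 1 -> fpair g k -> Pop F k = k ->
  (1 - Num.sqrt (2 * (eps * (1 + 8 * pi * kappa)))) * nrm g <= nrm (g \- Pop E g).
Proof.
move=> tE tF; set b := eps * _ => b1 gk Fk.
have pi0 := pi_gt0 R.
have b0 : 0 <= b by rewrite /b mulr_ge0 ?ltW// addr_gt0// !mulr_gt0.
have mE := proj1 tE; have mF := proj1 tF.
have [g2 k2 gkp] := gk.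
set r := Num.sqrt _; set t := nrm (_ \- _).
have r0 : 0 <= r by exact: sqrtr_ge0.
have r2 : r ^+ 2 = 2 * b by rewrite sqr_sqrtr// mulr_ge0.
have t0 : 0 <= t by exact: nrm_ge0.
have key p : ip g (pG p) <= (nrm g * r + t) * nrm (pG p).
  have [h1 [h2 [pE h1p hs]]] := split_estimate p tE tF.
  have gh : ip g (pG p) = ip g (Pop E (pG h1)) + ip (g \- Pop E g) (pG h1) + ip k (Pop F (pG (FT h2))).
    rewrite pE pGD ipDr//; try exact: L2_pG.
    rewrite -(ip_Pop F k) Fk (fpair_ip gk (fpair_pG h2)); congr (_ + _).
    rewrite -(ip_Pop E g) -ipDl; [|exact: L2_Pop|by apply: L2B => //; exact: L2_Pop|exact: L2_pG].
    by congr ip; apply/funext => x /=; rewrite addrC subrK.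
  have le1 := le_trans (ler_norm _) (ip_le g2 (L2_Pop mE (L2_pG h1))).
  have le2 := le_trans (ler_norm _) (ip_le (L2B g2 (L2_Pop mE g2)) (L2_pG h1)).
  have le3 := le_trans (ler_norm _) (ip_le k2 (L2_Pop mF (L2_pG (FT h2)))).
  rewrite (fpair_nrm gk) in le3.
  move: hs le1 le2 le3; set u := nrm (Pop E (pG h1)); set v := nrm (Pop F _).
  move=> hs le1 le2 le3.
  have n1 : nrm (pG h1) <= nrm (pG p) by rewrite -ler_sqr ?nnegrE ?nrm_ge0.
  have u0 : 0 <= u by exact: nrm_ge0.
  have v0 : 0 <= v by exact: nrm_ge0.
  have uv : u + v <= r * nrm (pG p).
    rewrite -ler_sqr ?nnegrE ?addr_ge0 ?mulr_ge0 ?nrm_ge0// exprMn r2.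
    by rewrite -mulrA; exact: sqr_add_le.
  have l4 := ler_wpM2l (nrm_ge0 g) uv; have l5 := ler_wpM2l t0 n1.
  rewrite gh mulrDl; apply: le_trans (lerD (lerD le1 le2) le3) _.
  rewrite -/t addrAC -mulrDr -mulrA; exact: lerD.
have N0 := nrm_ge0 g.
have [->|gn] := eqVneq (nrm g) 0; first by rewrite mulr0.
have N1 : 0 < nrm g by rewrite lt_def gn.
rewrite -(ler_pM2r N1).
suff : nrm g ^+ 2 <= (nrm g * r + t) * nrm g by lra.
apply/ler_addgt0Pl => d d0.
(* The distance e from p G to g enters twice, with these two factors. *)
pose D := nrm g + (nrm g * r + t).
have D0 : 0 < D by rewrite /D ltr_pwDl// addr_ge0// mulr_ge0.
have [p pe] := L2_dense g2 (divr_gt0 d0 D0).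
set e := d / D in pe.
have eD : e * D = d by rewrite /e divfK// gt_eqF.
have p1 : nrm (pG p) <= nrm g + e.
  by have := nrm_le_add (L2_pG p) g2; rewrite nrmBC; lra.
have p2 : nrm g ^+ 2 <= ip g (pG p) + nrm g * e.
  have := ip_le g2 (L2B g2 (L2_pG p)); rewrite ipBr ?nrm_sqr//; [|exact: L2_pG].
  by move=> /(le_trans (ler_norm _)) H; have := ler_wpM2l N0 (ltW pe); lra.
have c0 : 0 <= nrm g * r + t by rewrite addr_ge0// mulr_ge0.
have := key p; have := ler_wpM2l c0 p1; rewrite /D in eD; lra.
Qed.

End LowerBound.

(** * Lower bound for the critical density *)

Section ThetaLower.
Variable R : realType.
Implicit Types (eps kappa : R).

Lemma pi_le4 : pi <= 4 :> R.
Proof.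
have := pihalf_lt2 R.
by rewrite ltr_pdivrMr//; lra.
Qed.

Lemma Theta_lt1 eps kappa : 0 < eps -> 0 < kappa <= 1 ->
  eps < 1 / (2 * (1 + 32 * kappa)) -> (Theta kappa eps < 1)%E.
Proof.
move=> e0 /andP[k0 k1] ek.
have p4 := pi_le4; have pi0 := pi_gt0 R.
have d0 : 0 < 2 * (1 + 32 * kappa) by rewrite mulr_gt0// addr_gt0// mulr_gt0.
have ek' : eps * (2 * (1 + 32 * kappa)) < 1 by rewrite -ltr_pdivlMr.
set b := eps * (1 + 8 * pi * kappa).
have b0 : 0 < b by rewrite /b mulr_gt0// addr_gt0// !mulr_gt0.
have b1 : 2 * b < 1.
  have h : eps * kappa * pi <= eps * kappa * 4 by rewrite ler_pM2l// mulr_gt0.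
  by rewrite /b; lra.
pose r := Num.sqrt (2 * b).
have r0 : 0 <= r by exact: sqrtr_ge0.
have r1 : r < 1 by rewrite -sqrtr1 ltr_sqrt.
(* By Pythagoras: at least the fraction 1 - r of the norm lies outside E. This bound is the same for
   all E, F and f, so it survives the suprema. *)
pose c := Num.sqrt (1 - (1 - r) ^+ 2).
have c0 : 0 <= 1 - (1 - r) ^+ 2 by rewrite expr2; nra.
have c1 : c < 1.
  by rewrite -[ltRHS]sqrtr1 ltr_sqrt// ltrBlDr ltrDl exprn_gt0// subr_gt0.
apply: (@le_lt_trans _ _ c%:E); last by rewrite lte_fin.
apply: ge_ereal_sup => _ [E tE [F tF] <-].
apply: ge_ereal_sup => _ [f [/L2P f2 fn] <-].
have mE := proj1 tE; have mF := proj1 tF.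
have H := fpair_Qop mF f2; have [q2 k2 _] := H.
have Ff := fpair_plancherel f2; have [_ ff2 _] := Ff.
have := thin_pair_bound e0 k0 k1 tE tF b1 H (PopK F _).
rewrite -/b -/r => B.
rewrite /comp cLnorm2E ?lee_fin; last exact: L2_Pop.
rewrite cLnorm2E// lee_fin in fn.
have n1 : nrm (Qop F f) <= 1.
  rewrite -(fpair_nrm H); apply: le_trans (nrm_Pop_le mF ff2) _.
  by rewrite (fpair_nrm Ff).
have n0 := nrm_ge0 (Qop F f).
rewrite -ler_sqr ?nnegrE ?nrm_ge0 ?sqrtr_ge0// [c ^+ 2]sqr_sqrtr//.
have e := nrm_Pop_compl mE q2.
have B2 : ((1 - r) * nrm (Qop F f)) ^+ 2 <= nrm (Qop F f \- Pop E (Qop F f)) ^+ 2.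
  by rewrite ler_sqr ?nnegrE ?mulr_ge0 ?nrm_ge0// subr_ge0 ltW.
have n2 : nrm (Qop F f) ^+ 2 <= 1 by rewrite expr2; nra.
rewrite exprMn in B2.
have := ler_wpM2l c0 n2; lra.
Qed.

Lemma has_sup_eps kappa : has_ubound [set eps : R | 0 < eps < 1 /\ (Theta kappa eps < 1)%E].
Proof. by exists 1 => eps [/andP[_ /ltW]]. Qed.

Lemma eps_c_ge kappa : 0 < kappa <= 1 -> 1 / (2 * (1 + 32 * kappa)) <= eps_c kappa.
Proof.
move=> k01; have /andP[k0 k1] := k01; set t := 1 / _.
have d0 : 0 < 2 * (1 + 32 * kappa) by rewrite mulr_gt0// addr_gt0// mulr_gt0.
have t0 : 0 < t by rewrite divr_gt0.
have t1 : t < 1 by rewrite ltr_pdivrMr//; lra.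
apply/ler_addgt0Pr => e e0.
(* For e >= t the number t - e is not positive, and t / 2 is taken as the member of the set
   instead. *)
have [et|te] := leP t e.
  apply: le_trans et _; rewrite lerDr; apply: le_trans (ltW (_ : 0 < t / 2)) _; first by rewrite divr_gt0.
  apply: ub_le_sup; first exact: has_sup_eps.
  by split; [lra|apply: Theta_lt1 => //; rewrite -/t; lra].
rewrite -lerBlDr; apply: ub_le_sup; first exact: has_sup_eps.
by split; [lra|apply: Theta_lt1 => //; rewrite -/t; lra].
Qed.

End ThetaLower.

(** * Combs and the high frequencies they create *)

Section Oscillation.
Variable R : realType.
Local Notation T := (lebesgueType R).
Local Notation Re := complex.Re.
Local Notation Im := complex.Im.
Local Notation normc := Normc.normc.
Local Notation C := R[i].
Local Notation G := (@gauss R).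
Implicit Types (f g : R -> C) (k : R -> R) (p : {poly C}) (d : R) (s : bool).

(** Even in x, so that on both half-lines the periods start at the origin and [side_Int] treats them
    alike. *)
Definition comb d : set R :=
  [set x : R | exists i : nat, i%:R * (2 * d) <= `|x| <= i%:R * (2 * d) + d].

Definition osc d (x : R) : R := 2 * \1_(comb d) x - 1.

Lemma measurable_comb d : measurable (comb d : set T).
Proof.
have -> : comb d = \bigcup_i (side true (i%:R * (2 * d)) (i%:R * (2 * d) + d) `&` `[0, +oo[ `|`
    side false (i%:R * (2 * d)) (i%:R * (2 * d) + d) `&` `]-oo, 0]).
  apply/seteqP; split => x.
    move=> [i H]; exists i => //; have [x0|x0] := leP 0 x.
      left; split; last by rewrite /= in_itv/= x0.
      by apply/sideP; rewrite /sg -(ger0_norm x0).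
    right; split; last by rewrite /= in_itv/= ltW.
    by apply/sideP; rewrite /sg -(ltr0_norm x0).
  move=> [i _ [[/sideP H]|[/sideP H]]]; rewrite /= in_itv/= ?andbT => x0; exists i; move: H; rewrite /sg.
    by rewrite ger0_norm.
  by rewrite ler0_norm.
apply: bigcupT_measurable => i; apply: measurableU; apply: measurableI;
  by [exact: measurable_side|exact: itv_measurable].
Qed.

Lemma mf_osc d : mf (osc d).
Proof.
apply: mfB; last exact: mf_cst.
by apply: mfM; [exact: mf_cst|apply: mf_indic; exact: measurable_comb].
Qed.

Lemma osc_cases d x : osc d x = 1 \/ osc d x = -1.
Proof. by rewrite /osc indicE; case: (_ \in _) => /=; [left|right]; ring. Qed.

Lemma osc_norm d x : `|osc d x| = 1.
Proof. by case: (osc_cases d x) => ->; rewrite ?normrN normr1. Qed.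

Lemma indic_comb d x : \1_(comb d) x = (1 + osc d x) / 2.
Proof. by rewrite /osc; field. Qed.

Lemma loc_itg_osc d : loc_itg (osc d).
Proof. by apply: (@loc_itg_bounded _ _ 1); [exact: mf_osc|move=> x; rewrite osc_norm]. Qed.

Lemma loc_itg_oscM d k : loc_itg k -> loc_itg (fun x => osc d x * k x).
Proof.
move=> [mk ik]; split; first by apply: mfM => //; exact: mf_osc.
move=> a b; apply: (itg_le _ _ (itg_norm (ik a b))).
  apply: mfM; first by apply: mf_indic; exact: itv_measurable.
  by apply: mfM => //; exact: mf_osc.
by move=> x; rewrite mulrCA normrM osc_norm mul1r.
Qed.

Lemma sg_norm s (x : R) : 0 <= sg s x -> `|x| = sg s x.
Proof. by case: s; rewrite /sg => h; [rewrite ger0_norm|rewrite ler0_norm// -oppr_ge0]. Qed.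

Lemma side_Int_osc_cell s d (i : nat) : 0 < d ->
  side_Int s (i%:R * (2 * d)) (i%:R * (2 * d) + 2 * d) (osc d) = 0.
Proof.
move=> d0; set a := i%:R * (2 * d).
have a0 : 0 <= a by rewrite mulr_ge0// mulr_ge0// ltW.
have ab : a <= a + d by lra.
have ac : a <= a + 2 * d by lra.
have lE : loc_itg (\1_(comb d)).
  by apply: (@loc_itg_bounded _ _ 1); [apply: mf_indic; exact: measurable_comb|exact: indic_norm_le1].
have -> : osc d = (fun x => 2 * \1_(comb d) x + -1) by [].
rewrite side_Int_D ?side_Int_Z ?side_Int_cst//; [|exact: loc_itgZ|exact: loc_itg_cst].
suff -> : side_Int s a (a + 2 * d) (\1_(comb d)) = side_Int s a (a + d) (fun=> 1).
  by rewrite side_Int_cst//; ring.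
apply: ae_eq_Int.
- by apply: mfM; apply: mf_indic; [exact: measurable_side|exact: measurable_comb].
- by apply: mfM; [apply: mf_indic; exact: measurable_side|exact: mf_cst].
(* The outer end of the period already belongs to the next tooth; it is discarded as a null set. *)
apply: (ae_imply (ae_neq (sg s (a + 2 * d)))) => x xb.
rewrite mulr1 !indicE.
have M u v : (x \in side s u v) = (u <= sg s x <= v).
  by apply/idP/idP => [|H]; [rewrite inE => /sideP|rewrite inE; apply/sideP].
have xb' : sg s x != a + 2 * d.
  by apply/eqP => e; apply: xb; rewrite -e; case: (s); rewrite /sg ?opprK.
rewrite !M; case: (boolP (a <= sg s x <= a + 2 * d)) => [/andP[h1 h2]|h]; last first.
  rewrite mul0r; case: (boolP (a <= sg s x <= a + d)) => // /andP[h1 h2].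
  by move: h; rewrite h1/=; have -> : sg s x <= a + 2 * d by lra.
rewrite mul1r h1 /=; congr (_%:R); congr nat_of_bool.
have x0 : 0 <= sg s x by exact: le_trans h1.
apply/idP/idP; last first.
  by move=> h3; rewrite inE; exists i; rewrite (sg_norm x0) h1.
rewrite inE => -[j]; rewrite (sg_norm x0) => /andP[h3 h4].
have [ji|ij] := leqP j i.
  have : j%:R * (2 * d) <= a by rewrite ler_pM2r ?mulr_gt0// ler_nat.
  by lra.
have : a + 2 * d <= j%:R * (2 * d).
  rewrite -[X in _ + X]mul1r -mulrDl ler_pM2r ?mulr_gt0// natr1 ler_nat//.
by move=> h5; exfalso; move/negP: xb'; apply; rewrite eq_le h2 (le_trans h5 h3).
Qed.

Lemma side_Int_norm s (a b : R) k (B : R) : a <= b -> loc_itg k -> (forall x, a <= sg s x <= b -> `|k x| <= B) ->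
  `|side_Int s a b k| <= B * (b - a).
Proof.
move=> ab lk kB.
have h1 : side_Int s a b k <= side_Int s a b (fun=> B).
  by apply: side_Int_le => //; [exact: loc_itg_cst|move=> x /kB; rewrite ler_norml => /andP[]].
have h2 : side_Int s a b (fun=> - B) <= side_Int s a b k.
  by apply: side_Int_le => //; [exact: loc_itg_cst|move=> x /kB; rewrite ler_norml => /andP[]].
by rewrite !side_Int_cst// in h1 h2; rewrite ler_norml -mulNr h1 h2.
Qed.

Section Lipschitz.
Variables (k : R -> R) (L B : R).
Hypotheses (mk : mf k) (kB : forall x, `|k x| <= B)
  (kL : forall x y, `|k x - k y| <= L * `|x - y|).

Let lk : loc_itg k. Proof. exact: (loc_itg_bounded mk kB). Qed.

Lemma Lip_ge0 : 0 <= L.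
Proof. by have := kL 1 0; rewrite subr0 normr1 mulr1; exact: le_trans. Qed.

(** On each period the value of k at its start may be subtracted, since the sign has mean zero; what
    remains is at most 2 L d on a length 2 d. *)
Lemma side_Int_osc_Lip s d (i : nat) : 0 < d ->
  `|side_Int s 0 (i%:R * (2 * d)) (fun x => osc d x * k x)| <= i%:R * (4 * L * d ^+ 2).
Proof.
move=> d0; have lok := loc_itg_oscM d lk; have L0 := Lip_ge0.
elim: i => [|i IH]; first by rewrite !mul0r side_Int_point// normr0.
set a := i%:R * (2 * d) in IH *.
have a0 : 0 <= a by rewrite mulr_ge0// mulr_ge0// ltW.
have ab : a <= a + 2 * d by lra.
have -> : i.+1%:R * (2 * d) = a + 2 * d by rewrite -natr1 mulrDl mul1r.
have -> : i.+1%:R * (4 * L * d ^+ 2) = i%:R * (4 * L * d ^+ 2) + 4 * L * d ^+ 2.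
  by rewrite -natr1 mulrDl mul1r.
rewrite (side_Int_add s a0 ab lok).
apply: le_trans (ler_normD _ _) _; apply: lerD => //.
pose y := sg s a.
have lr : loc_itg (fun x => osc d x * (k x - k y)).
  by apply: loc_itg_oscM; apply: loc_itgD => //; exact: loc_itg_cst.
have -> : side_Int s a (a + 2 * d) (fun x => osc d x * k x) =
  side_Int s a (a + 2 * d) (fun x => osc d x * (k x - k y)).
  have E : (fun x => osc d x * k x) = (fun x => osc d x * (k x - k y) + k y * osc d x).
    by apply/funext => x; ring.
  rewrite E side_Int_D//; last by apply: loc_itgZ; exact: loc_itg_osc.
  by rewrite side_Int_Z ?side_Int_osc_cell ?mulr0 ?addr0//; exact: loc_itg_osc.
apply: le_trans (_ : 2 * L * d * (a + 2 * d - a) <= _); last first.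
  by rewrite le_eqVlt; apply/orP; left; apply/eqP; ring.
apply: side_Int_norm => // x /andP[x1 x2]; rewrite normrM osc_norm mul1r.
apply: le_trans (kL _ _) _; rewrite -[2 * L * d]mulrA mulrCA; apply: ler_wpM2l => //.
by rewrite ler_norml /y; move: x1 x2; case: (s); rewrite /sg; lra.
Qed.

(** Complete periods contribute at most 2 d L Y, the incomplete last one at most 2 d B. *)
Lemma side_Int_osc_bound s d (Y : R) : 0 < d -> 0 <= Y ->
  `|side_Int s 0 Y (fun x => osc d x * k x)| <= 2 * d * (L * Y + B).
Proof.
move=> d0 Y0; have lok := loc_itg_oscM d lk; have L0 := Lip_ge0.
have d20 : 0 < 2 * d by rewrite mulr_gt0.
pose i := Num.truncn (Y / (2 * d)).
have /andP[i1 i2] : i%:R <= Y / (2 * d) < i.+1%:R by apply: truncn_itv; rewrite divr_ge0// ltW.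
set a := i%:R * (2 * d).
have a0 : 0 <= a by rewrite mulr_ge0// ltW.
have aY : a <= Y by rewrite /a -ler_pdivlMr.
have Ya : Y <= a + 2 * d.
  by move: i2; rewrite ltr_pdivrMr// -natr1 mulrDl mul1r => /ltW.
have B0 : 0 <= B by exact: le_trans (kB 0).
rewrite (side_Int_add s a0 aY lok); apply: le_trans (ler_normD _ _) _.
have h1 := side_Int_osc_Lip s i d0; rewrite -/a in h1.
have h2 : `|side_Int s a Y (fun x => osc d x * k x)| <= B * (Y - a).
  by apply: side_Int_norm => // x _; rewrite normrM osc_norm mul1r.
have h3 : B * (Y - a) <= B * (2 * d) by apply: ler_wpM2l => //; lra.
have h4 : i%:R * (4 * L * d ^+ 2) <= 2 * d * (L * Y).
  have -> : i%:R * (4 * L * d ^+ 2) = 2 * d * (L * a) by rewrite /a; ring.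
  by rewrite ler_pM2l//; apply: ler_wpM2l.
by lra.
Qed.

(** A Riemann-Lebesgue lemma for square waves: the mass outside [-m, m] is small, and inside the
    bound is of order 1 / n. *)
Lemma Int_osc_cvg : itg k -> Int (fun x => osc n.+1%:R^-1 x * k x) @[n --> \oo] --> 0.
Proof.
move=> ik; apply/cvgr0Pnorm_le => e e0.
have e2 : 0 < e / 2 by rewrite divr_gt0.
have ink := itg_norm ik.
have c0 := Int_cvg_itv ink.
have [m hm] : exists m : nat, Int (fun x => `|k x|) - Int (fun x => \1_`[- m%:R, m%:R] x * `|k x|) < e / 2.
  have c1 : Int (fun x => `|k x|) - Int (fun x => \1_`[- m%:R, m%:R] x * `|k x|) @[m --> \oo] -->
    Int (fun x => `|k x|) - Int (fun x => `|k x|).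
    by apply: cvgB => //; exact: cvg_cst.
  by rewrite subrr in c1; exact: (filter_ex (cvg_nrm_small c1 e2)).
pose D := 4 * (L * m%:R + B).
have B0 : 0 <= B by exact: le_trans (kB 0).
have D0 : 0 <= D by rewrite mulr_ge0// addr_ge0// mulr_ge0// Lip_ge0.
have cD : D * n.+1%:R^-1 @[n --> \oo] --> 0.
  by rewrite -(mulr0 D); apply: cvgM; [exact: cvg_cst|exact: cvg_harmonic].
have := cvg_nrm_small cD e2; apply: filterS => n Dn.
set d := n.+1%:R^-1 in Dn *; have d0 : 0 < d by rewrite invr_gt0.
have mitv : measurable (`[- m%:R, m%:R]%classic : set T) by exact: itv_measurable.
have iok : itg (fun x => osc d x * k x).
  apply: (itg_le _ _ ink); first by apply: mfM => //; exact: mf_osc.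
  by move=> x; rewrite normrM osc_norm mul1r.
have i1 := itg_indicM mitv iok.
have -> : Int (fun x => osc d x * k x) = Int (fun x => \1_`[- m%:R, m%:R] x * (osc d x * k x)) +
   (Int (fun x => osc d x * k x) - Int (fun x => \1_`[- m%:R, m%:R] x * (osc d x * k x))).
  by ring.
apply: le_trans (ler_normD _ _) _.
have h1 : `|Int (fun x => \1_`[- m%:R, m%:R] x * (osc d x * k x))| <= D * d.
  rewrite -side_Int_halves; last exact: loc_itg_itg.
  apply: le_trans (ler_normD _ _) _.
  have := side_Int_osc_bound true d0 (ler0n R m); have := side_Int_osc_bound false d0 (ler0n R m).
  by rewrite /D; lra.
have h2 : `|Int (fun x => osc d x * k x) - Int (fun x => \1_`[- m%:R, m%:R] x * (osc d x * k x))| <=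
   Int (fun x => `|k x|) - Int (fun x => \1_`[- m%:R, m%:R] x * `|k x|).
  have i3 := itg_indicM mitv ink.
  rewrite -!IntB//; apply: le_trans (Int_norm (itgB iok i1)) _.
  apply: Int_le; [exact: itg_norm (itgB iok i1)|exact: itgB|] => x.
  rewrite indicE; case: (_ \in _); first by rewrite !mul1r !subrr normr0.
  by rewrite !mul0r !subr0 normrM osc_norm mul1r.
by lra.
Qed.

End Lipschitz.

Lemma side_Int_osc_half s d (Y : R) : 0 < d -> 0 <= Y -> `|side_Int s 0 Y (osc d)| <= 2 * d.
Proof.
move=> d0 Y0.
have := @side_Int_osc_bound (fun=> 1) 0 1 (mf_cst 1) _ _ s d Y d0 Y0.
rewrite mul0r add0r mulr1 (_ : (fun x => osc d x * 1) = osc d); last by apply/funext => x; rewrite mulr1.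
by apply=> *; rewrite ?normr1// subrr normr0 mul0r.
Qed.

Lemma side_Int_osc_interval d (a b : R) : 0 < d -> `|side_Int true a b (osc d)| <= 4 * d.
Proof.
move=> d0; have lo := loc_itg_osc d.
have F u v : side_Int true u v (osc d) = side_Int false (- v) (- u) (osc d) by rewrite /side_Int /= !opprK.
have [ab|ba] := leP a b; last first.
  rewrite (_ : side_Int _ _ _ _ = 0) ?normr0 ?mulr_ge0 ?ltW//.
  rewrite -[RHS](Int0 R); congr Int; apply/funext => x.
  rewrite indicE (_ : x \in _ = false) ?mul0r//.
  by apply/negbTE; rewrite notin_setE /= in_itv /= => /andP[h1 h2]; have := le_trans h1 h2; lra.
have [a0|a0] := leP 0 a.
  have b0 := le_trans a0 ab.
  have := side_Int_osc_half true d0 a0; have := side_Int_osc_half true d0 b0.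
  rewrite (side_Int_add true a0 ab lo) => h1 h2.
  have -> : side_Int true a b (osc d) = (side_Int true 0 a (osc d) + side_Int true a b (osc d)) - side_Int true 0 a (osc d) by ring.
  by apply: le_trans (ler_normB _ _) _; lra.
have [b0|b0] := leP 0 b.
  rewrite (side_Int_add true (ltW a0) b0 lo) F oppr0.
  have na : 0 <= - a by lra.
  have := side_Int_osc_half false d0 na; have := side_Int_osc_half true d0 b0 => h1 h2.
  by apply: le_trans (ler_normD _ _) _; lra.
rewrite F; have nb : 0 <= - b by lra.
have nab : - b <= - a by lra.
have na := le_trans nb nab.
have := side_Int_osc_half false d0 nb; have := side_Int_osc_half false d0 na.
rewrite (side_Int_add false nb nab lo) => h1 h2.
have -> : side_Int false (- b) (- a) (osc d) = (side_Int false 0 (- b) (osc d) + side_Int false (- b) (- a) (osc d)) - side_Int false 0 (- b) (osc d) by ring.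
by apply: le_trans (ler_normB _ _) _; lra.
Qed.

Lemma side_Int_osc_indic d (a b u v : R) : 0 < d ->
  `|side_Int true a b (fun x => osc d x * \1_`[u, v] x)| <= 4 * d.
Proof.
move=> d0; have <- : side_Int true (Num.max a u) (Num.min b v) (osc d) =
    side_Int true a b (fun x => osc d x * \1_`[u, v] x); last exact: side_Int_osc_interval.
congr Int; apply/funext => x.
suff -> : \1_(side true (Num.max a u) (Num.min b v)) x = \1_(side true a b) x * \1_`[u, v] x :> R by ring.
rewrite !indicE -natrM mulnb; congr (_%:R); congr nat_of_bool.
rewrite !(mem_setE, in_itv) /= ge_max le_min.
by case: (a <= x); case: (x <= b); case: (u <= x); case: (x <= v).
Qed.

Lemma Int_osc_poly (a : {poly R}) (w : R) (q q' : R -> R) : 0 < w ->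
  has_deriv q q' -> continuous q' -> (forall x, `|q x| <= 1) ->
  (exists B, forall x, `|q' x| <= B) ->
  Int (fun x => osc n.+1%:R^-1 x * (a.[x] * ga w x * q x)) @[n --> \oo] --> 0.
Proof.
move=> w0 hq cq' q1 [Q qQ].
have Q0 : 0 <= Q by exact: le_trans (normr_ge0 _) (qQ 0).
have [B1 B10 aB] := poly_ga_le a w0.
have [B2 B20 a'B] := poly_ga_le (a^`() - (2 * w) *: ('X * a)) w0.
have ga1 x : ga (w / 2) x <= 1.
  by rewrite /ga -expR0 ler_expR oppr_le0 mulr_ge0 ?sqr_ge0// divr_ge0// ltW.
have ga0 x := ltW (ga_gt0 (w / 2) x).
have b1 x : `|a.[x] * ga w x| <= B1.
  by apply: le_trans (aB x) _; have := ler_wpM2l B10 (ga1 x); rewrite mulr1.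
have b2 x : `|(a^`() - (2 * w) *: ('X * a)).[x] * ga w x| <= B2.
  by apply: le_trans (a'B x) _; have := ler_wpM2l B20 (ga1 x); rewrite mulr1.
have hk := has_derivM (has_deriv_poly_ga a w) hq.
have cq := has_deriv_continuous hq.
apply: (@Int_osc_cvg (fun x => a.[x] * ga w x * q x) (B2 + B1 * Q) B1).
- apply: mfM; apply: mf_continuous => //; exact: continuous_poly_ga.
- move=> x; rewrite normrM; have := ler_pM (normr_ge0 _) (normr_ge0 _) (b1 x) (q1 x).
  by rewrite mulr1.
- apply: (F_Lip hk).
  + move=> x; apply: cvgD; apply: cvgM.
    * exact: continuous_poly_ga.
    * exact: cq.
    * exact: continuous_poly_ga.
    * exact: cq'.
  + move=> x; apply: le_trans (ler_normD _ _) _; rewrite !normrM; apply: lerD.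
      by have := ler_pM (normr_ge0 _) (normr_ge0 _) (b2 x) (q1 x); rewrite mulr1 normrM.
    by have := ler_pM (normr_ge0 _) (normr_ge0 _) (b1 x) (qQ x); rewrite normrM.
- apply: (itg_le _ _ (itg_norm (itg_poly_ga a w0))).
    apply: mfM; apply: mf_continuous => //; exact: continuous_poly_ga.
  by move=> x; rewrite normrM; have := ler_wpM2l (normr_ge0 (a.[x] * ga w x)) (q1 x); rewrite mulr1.
Qed.

Definition oscM d f : R -> C := fun x => (osc d x)%:C%C * f x.

Lemma Re_oscM d f x : Re (oscM d f x) = osc d x * Re (f x).
Proof. by rewrite ReM /= mul0r subr0. Qed.
Lemma Im_oscM d f x : Im (oscM d f x) = osc d x * Im (f x).
Proof. by rewrite ImM /= mul0r addr0. Qed.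
Lemma nsq_oscM d f x : nsq (oscM d f x) = nsq (f x).
Proof. by rewrite nsqM {1}/nsq /= expr0n addr0 -real_normK ?num_real// osc_norm expr1n mul1r. Qed.

Lemma L2_oscM d f : L2 f -> L2 (oscM d f).
Proof.
move=> [fr fi iff']; split.
- by under eq_fun do rewrite Re_oscM; apply: mfM => //; exact: mf_osc.
- by under eq_fun do rewrite Im_oscM; apply: mfM => //; exact: mf_osc.
- by under eq_fun do rewrite nsq_oscM.
Qed.

Lemma nrm_oscM d f : nrm (oscM d f) = nrm f.
Proof. by rewrite /nrm !ipff; congr (Num.sqrt (Int _)); apply/funext => x; rewrite nsq_oscM. Qed.

Lemma oscMB d f g : oscM d f \- oscM d g = oscM d (f \- g).
Proof. by apply/funext => x; rewrite /oscM /= mulrBr. Qed.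

Lemma L1_oscM d f : L1 f -> L1 (oscM d f).
Proof.
move=> [fr fi]; split.
  under eq_fun do rewrite Re_oscM; apply: (itg_le _ _ (itg_norm fr)).
    by apply: mfM; [exact: mf_osc|exact: itg_mf].
  by move=> x; rewrite normrM osc_norm mul1r.
under eq_fun do rewrite Im_oscM; apply: (itg_le _ _ (itg_norm fi)).
  by apply: mfM; [exact: mf_osc|exact: itg_mf].
by move=> x; rewrite normrM osc_norm mul1r.
Qed.

Lemma fourier_osc_cvg p (xi : R) :
  Re (fourier (oscM n.+1%:R^-1 (pG p)) xi) @[n --> \oo] --> 0 /\
  Im (fourier (oscM n.+1%:R^-1 (pG p)) xi) @[n --> \oo] --> 0.
Proof.
have pi0 := pi_gt0 R.
have trigP (a : {poly R}) (q q' : R -> R) (e : R) :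
    (forall c, has_deriv (fun x => q (c * x)) (fun x => e * c * q' (c * x))) -> continuous q' ->
    (forall x, `|q x| <= 1) -> (forall x, `|q' x| <= 1) ->
    Int (fun x => osc n.+1%:R^-1 x * (a.[x] * G x * q (2 * pi * xi * x))) @[n --> \oo] --> 0.
  move=> hq cq' q1 q'1; apply: (@Int_osc_poly a pi _ _ pi0 (hq (2 * pi * xi))) => //.
  - move=> x; apply: cvgM; first exact: cvg_cst.
    apply: (continuous_comp (f := fun x => 2 * pi * xi * x)); last exact: cq'.
    by apply: cvgM; [exact: cvg_cst|exact: cvg_id].
  - exists `|e * (2 * pi * xi)| => x; rewrite normrM.
    by have := ler_wpM2l (normr_ge0 (e * (2 * pi * xi))) (q'1 (2 * pi * xi * x)); rewrite mulr1.
have cosP (a : {poly R}) : Int (fun x => osc n.+1%:R^-1 x * (a.[x] * G x * cos (2 * pi * xi * x))) @[n --> \oo] --> 0.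
  apply: (trigP a cos sin (-1)); [|exact: continuous_sin|exact: cos_le1_norm|exact: sin_le1_norm].
  by move=> c; rewrite mulN1r; exact: has_deriv_coslin.
have sinP (a : {poly R}) : Int (fun x => osc n.+1%:R^-1 x * (a.[x] * G x * sin (2 * pi * xi * x))) @[n --> \oo] --> 0.
  apply: (trigP a sin cos 1); [|exact: continuous_cos|exact: sin_le1_norm|exact: cos_le1_norm].
  by move=> c; rewrite mul1r; exact: has_deriv_sinlin.
have iosc d (h : R -> R) : itg h -> itg (fun x => osc d x * h x).
  move=> ih; apply: (itg_le _ _ (itg_norm ih)).
    by apply: mfM; [exact: mf_osc|exact: itg_mf].
  by move=> x; rewrite normrM osc_norm mul1r.
have ic (a : {poly R}) d : itg (fun x => osc d x * (a.[x] * G x * cos (2 * pi * xi * x))).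
  apply: iosc; have := itg_poly_cos a xi.
  by congr itg; apply/funext => x; rewrite [2 * pi * xi * x]mulrAC.
have is' (a : {poly R}) d : itg (fun x => osc d x * (a.[x] * G x * sin (2 * pi * xi * x))).
  apply: iosc; have := itg_poly_sin a xi.
  by congr itg; apply/funext => x; rewrite [2 * pi * xi * x]mulrAC.
split.
- have E d : Re (fourier (oscM d (pG p)) xi) =
    Int (fun x => osc d x * ((pRe p).[x] * G x * cos (2 * pi * xi * x))) +
    Int (fun x => osc d x * ((pIm p).[x] * G x * sin (2 * pi * xi * x))).
    rewrite -IntD//; congr Int; apply/funext => x.
    rewrite ReM Re_oscM Im_oscM Re_pG Im_pG /= cosN sinN [2 * pi * xi * x]mulrAC; ring.
  under eq_fun do rewrite E.
  by rewrite -(addr0 0); apply: cvgD.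
- have E d : Im (fourier (oscM d (pG p)) xi) =
    Int (fun x => osc d x * ((pIm p).[x] * G x * cos (2 * pi * xi * x))) -
    Int (fun x => osc d x * ((pRe p).[x] * G x * sin (2 * pi * xi * x))).
    rewrite -IntB//; congr Int; apply/funext => x.
    rewrite ImM Re_oscM Im_oscM Re_pG Im_pG /= cosN sinN [2 * pi * xi * x]mulrAC; ring.
  under eq_fun do rewrite E.
  by rewrite -(subrr 0); apply: cvgB.
Qed.

(** The transforms tend to 0 pointwise and are bounded by the L^1 norm of p G, uniformly in n;
    dominated convergence applies on the bounded band. *)
Lemma nrm_cutoff_fourier_osc p (S : R) :
  nrm (cutoff S (fourier (oscM n.+1%:R^-1 (pG p)))) @[n --> \oo] --> 0.
Proof.
have L1n n : L1 (oscM n.+1%:R^-1 (pG p)) by apply: L1_oscM; exact: L1_pG.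
have L2n n : L2 (oscM n.+1%:R^-1 (pG p)) by apply: L2_oscM; exact: L2_pG.
have F2 n := proj1 (fourier_nrm_le (L1n n) (L2n n)).
pose M := Int (fun x => normc (pG p x)).
have M0 : 0 <= M by apply: Int_ge0 => x; exact: normc_ge0.
have ME n : Int (fun x => normc (oscM n.+1%:R^-1 (pG p) x)) = M.
  by congr Int; apply/funext => x; rewrite !normc_nsq nsq_oscM.
have mI : measurable (`[- S, S]%classic : set T) by exact: itv_measurable.
have E n : nrm (cutoff S (fourier (oscM n.+1%:R^-1 (pG p)))) =
  Num.sqrt (Int (fun x => \1_`[- S, S] x * nsq (fourier (oscM n.+1%:R^-1 (pG p)) x))).
  rewrite /nrm ipff; congr (Num.sqrt (Int _)); apply/funext => x.
  by rewrite /cutoff PopE indicE; case: (_ \in _); rewrite ?mul1r// mul0r /nsq /= expr0n addr0.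
under eq_fun do rewrite E.
have z2 : nsq (0 : C) = 0 by rewrite /nsq /= expr0n addr0.
have [|||||_ cI] := @Int_dominated _ (fun n x => \1_`[- S, S] x * nsq (fourier (oscM n.+1%:R^-1 (pG p)) x))
   (fun=> 0) (fun x => (2 * M ^+ 2) * \1_`[- S, S] x).
- by move=> n; have [fr fi _] := F2 n; apply: mfM; [exact: mf_indic|exact: mf_nsq].
- exact: mf_cst.
- apply: aeW => x; have [cr ci] := fourier_osc_cvg p x.
  rewrite -(mulr0 (\1_`[- S, S] x)); apply: cvgM; first exact: cvg_cst.
  by rewrite -z2; apply: cvg_nsq.
- by apply: itgZ; exact: itg_indic_itv.
- move=> n x; have i0 : 0 <= \1_`[- S, S] x :> R by rewrite indicE ler0n.
  rewrite mulrC ger0_norm ?mulr_ge0 ?nsq_ge0//; apply: ler_wpM2r => //.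
  have [h1 h2] := normc_fourier_le x (L1n n); rewrite ME in h1 h2.
  rewrite /nsq -[X in X + _]real_normK ?num_real// -[X in _ + X]real_normK ?num_real//.
  have := @ler_sqr _ `|Re (fourier (oscM n.+1%:R^-1 (pG p)) x)| M; rewrite !nnegrE => /(_ (normr_ge0 _) M0) e1.
  have := @ler_sqr _ `|Im (fourier (oscM n.+1%:R^-1 (pG p)) x)| M; rewrite !nnegrE => /(_ (normr_ge0 _) M0) e2.
  by rewrite -e1 in h1; rewrite -e2 in h2; lra.
rewrite (Int0 R) in cI.
have := cvg_comp _ _ cI (@sqrt_continuous R 0).
by rewrite sqrtr0.
Qed.

(** Multiplication by a sign preserves distances, so f may be replaced by a nearby p G. The claim is
    about every g because a transform is only determined almost everywhere. *)
Lemma osc_low_frequency f (S e : R) : L2 f -> 0 < e ->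
  \forall n \near \oo, forall g, fpair (oscM n.+1%:R^-1 f) g -> nrm (cutoff S g) < e.
Proof.
move=> f2 e0; have e2 : 0 < e / 2 by rewrite divr_gt0.
have [p pe] := L2_dense f2 e2.
have := cvg_nrm_small (nrm_cutoff_fourier_osc p S) e2; apply: filterS => n hn g fg.
have mI : measurable (`[- S, S]%classic : set T) by exact: itv_measurable.
set u := oscM _ (pG p) in hn.
have u1 : L1 u by apply: L1_oscM; exact: L1_pG.
have u2 : L2 u by apply: L2_oscM; exact: L2_pG.
have uf := fpair_fourier u1 u2; have [_ fu2 _] := uf; have [_ g2 _] := fg.
have dfg := fpair_nrm (fpair_B fg uf); rewrite oscMB nrm_oscM in dfg.
have := nrm_le_add (L2_cutoff S g2) (L2_cutoff S fu2).
have -> : cutoff S g \- cutoff S (fourier u) = cutoff S (g \- fourier u).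
  by apply/funext => x; rewrite /cutoff /Pop /= mulrBr.
have := nrm_Pop_le mI (L2B g2 fu2); rewrite -/(cutoff S _) dfg.
by gen_norms; lra.
Qed.

Lemma ip_osc_cvg f (e : R) : L2 f -> 0 < e ->
  \forall n \near \oo, `|ip (oscM n.+1%:R^-1 f) f| < e.
Proof.
move=> f2 e0.
(* Replacing f by p G in both arguments costs at most the distance times the sum of the two norms,
   and the norm of p G is at most nrm f + 1 once the distance is below 1. *)
pose D := 2 * nrm f + 2.
have D0 : 0 < D by rewrite /D; have := nrm_ge0 f; lra.
have e1 : 0 < Num.min 1 (e / (2 * D)) by rewrite lt_min ltr01 divr_gt0// mulr_gt0.
have [p pe] := L2_dense f2 e1.
have p2 := L2_pG p.
have cI : Int (fun x => osc n.+1%:R^-1 x * ((sqp p).[x] * ga (pi + pi) x * 1)) @[n --> \oo] --> 0.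
  apply: (@Int_osc_poly _ _ (fun=> 1) (fun=> 0)).
  - by rewrite addr_gt0// pi_gt0.
  - exact: has_deriv_cst.
  - exact: cst_continuous.
  - by move=> x; rewrite normr1.
  - by exists 0 => x; rewrite normr0.
have e2 : 0 < e / 2 by rewrite divr_gt0.
move/cvgr0Pnorm_lt : cI => /(_ _ e2); apply: filterS => n hn.
set d := n.+1%:R^-1 in hn *.
have ipE : ip (oscM d (pG p)) (pG p) = Int (fun x => osc d x * ((sqp p).[x] * ga (pi + pi) x * 1)).
  congr Int; apply/funext => x; rewrite mulr1 -nsq_pG_ga /dot /nsq Re_oscM Im_oscM; ring.
rewrite -ipE in hn.
have of2 := L2_oscM d f2; have op2 := L2_oscM d p2.
have -> : ip (oscM d f) f = ip (oscM d f) (f \- pG p) + ip (oscM d (f \- pG p)) (pG p) + ip (oscM d (pG p)) (pG p).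
  by rewrite -oscMB ipBr// ipBl//; ring.
apply: le_lt_trans (ler_normD _ _) _.
have h1 := ip_le of2 (L2B f2 p2); have h2 := ip_le (L2_oscM d (L2B f2 p2)) p2.
rewrite !nrm_oscM in h1 h2.
move: pe; rewrite lt_min => /andP[pe1 pe2].
set w := nrm (f \- pG p) in h1 h2 pe1 pe2.
have pn : nrm (pG p) <= nrm f + 1 by have := nrm_le_add p2 f2; rewrite nrmBC -/w; lra.
have w0 : 0 <= w by exact: nrm_ge0.
have h3 : w * D < e / 2.
  by move: pe2; rewrite ltr_pdivlMr ?mulr_gt0//; lra.
have h4 := ler_wpM2l w0 pn.
have := ler_normD (ip (oscM d f) (f \- pG p)) (ip (oscM d (f \- pG p)) (pG p)).
by move: h3; rewrite /D mulrDr; lra.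
Qed.

End Oscillation.

(** * Complex conjugation as a substitute for the inverse transform *)

Section Conjugation.
Variable R : realType.
Local Notation Re := complex.Re.
Local Notation Im := complex.Im.
Local Notation C := R[i].
Local Notation ii := ('i%C : C).
Implicit Types (f g : R -> C) (p q : {poly C}) (E : set R).

Definition cj f : R -> C := fun x => conjc (f x).
Definition pcj p : {poly C} := map_poly (@conjc R) p.

Lemma Re_conjc (z : C) : Re (conjc z) = Re z. Proof. by case: z. Qed.
Lemma Im_conjc (z : C) : Im (conjc z) = - Im z. Proof. by case: z. Qed.
Lemma conjc_Z (r : R) (z : C) : conjc (r%:C%C * z) = r%:C%C * conjc z.
Proof. by case: z => a b; apply: complexE; rewrite !(Re_conjc,Im_conjc,ReM,ImM) /=; ring. Qed.

Lemma nsq_conjc (z : C) : nsq (conjc z) = nsq z.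
Proof. by case: z => a b; rewrite /nsq /= sqrrN. Qed.

Lemma L2_cj f : L2 f -> L2 (cj f).
Proof.
move=> [fr fi iff']; split.
- by under eq_fun do rewrite Re_conjc.
- by under eq_fun do rewrite Im_conjc; exact: mfN.
- by under eq_fun do rewrite nsq_conjc.
Qed.

Lemma nrm_cj f : nrm (cj f) = nrm f.
Proof. by rewrite /nrm !ipff; under eq_fun do rewrite nsq_conjc. Qed.

Lemma cjB f g : cj (f \- g) = cj f \- cj g.
Proof. by apply/funext => x; apply: complexE; rewrite /cj /= !(Re_conjc,Im_conjc,ReD,ImD,ReN,ImN) ?opprD. Qed.

Lemma Pop_cj E f : Pop E (cj f) = cj (Pop E f).
Proof. by apply/funext => x; rewrite /cj /Pop conjc_Z. Qed.

Lemma cj_oscM d f : cj (oscM d f) = oscM d (cj f).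
Proof. by apply/funext => x; rewrite /cj /oscM conjc_Z. Qed.

Lemma coef_pcj p i : (pcj p)`_i = conjc p`_i.
Proof. by rewrite coef_map_id0//; apply: complexE; rewrite /= ?oppr0. Qed.

Lemma pG_pcj p : pG (pcj p) = cj (pG p).
Proof.
have eR : pRe (pcj p) = pRe p.
  by apply/polyP => i; rewrite !coef_pRe coef_pcj Re_conjc.
have eI : pIm (pcj p) = - pIm p.
  by apply/polyP => i; rewrite coefN !coef_pIm coef_pcj Im_conjc.
apply/funext => x; apply: complexE; rewrite /cj !(Re_conjc,Im_conjc,Re_pG,Im_pG) ?eR//.
by rewrite eI hornerN mulNr.
Qed.

Lemma pcjD p q : pcj (p + q) = pcj p + pcj q.
Proof. by apply/polyP => i; rewrite !(coefD,coef_pcj); case: (p`_i) (q`_i) => a b [u v]; apply: complexE; rewrite /= ?opprD. Qed.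

Lemma pcjZ (z : C) p : pcj (z *: p) = conjc z *: pcj p.
Proof.
apply/polyP => i; rewrite !(coefZ,coef_pcj).
by case: z (p`_i) => a b [u v]; apply: complexE; rewrite !(Re_conjc,Im_conjc,ReM,ImM) /=; ring.
Qed.

Lemma pcjC (z : C) : pcj z%:P = (conjc z)%:P.
Proof. by apply/polyP => i; rewrite coef_pcj !coefC; case: ifP => // _; rewrite /= oppr0. Qed.

Lemma pcj_cre p : pcj (cre p) = cre (pcj p).
Proof.
apply/polyP => i.
rewrite coef_pcj /cre !(coefB,coefZ,coefXM,coef_deriv) !coef_pcj two_complex /c2.
case: ifP => _; apply: complexE;
  rewrite !(Re_conjc,Im_conjc,ReD,ImD,ReN,ImN,ReM,ImM,ReMn,ImMn) /= ?mulNrn; ring.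
Qed.

(** On the image of [cre] the two phases are conj (-i) and -i, with product 1, and constants are
    only conjugated. *)
Lemma FT_pcj p : FT (pcj (FT p)) = pcj p.
Proof.
have [n] := ubnP (size p); elim: n p => // n IH p pn.
have [p1|p1] := leqP (size p) 1.
  by rewrite (size1_polyC p1) FTC pcjC FTC.
have [z [q [pE qs]]] := cre_decomp p.
have qn : (size q < n)%N.
  by apply: leq_trans qs _; rewrite prednK ?(leq_trans _ p1)//; exact: pn.
rewrite pE FTD FTC FT_cre pcjD pcjC pcjZ pcj_cre FTD FTC FTZ FT_cre (IH _ qn) scalerA.
rewrite pcjD pcjC pcj_cre.
have -> : conjc (- ii) * - ii = 1.
  by apply: complexE; rewrite !(ReM,ImM,Re_conjc,Im_conjc,ReN,ImN) /=; ring.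
by rewrite scale1r.
Qed.

(** Exchanges space and frequency while keeping supports and norms, so one step of the chain serves
    both sides. *)
Lemma fpair_conj f g : fpair f g -> fpair (cj g) (cj f).
Proof.
move=> [f2 g2 H]; split; [exact: L2_cj|exact: L2_cj|] => e /H[p [p1 p2]].
exists (pcj (FT p)); rewrite FT_pcj !pG_pcj -!cjB !nrm_cj.
by split.
Qed.

Lemma nrmZ (r : R) f : 0 <= r -> L2 f -> nrm (fun x => r%:C%C * f x) = r * nrm f.
Proof.
move=> r0 f2; have f2' := L2Z r%:C%C f2.
apply/eqP; rewrite -(@eqrXn2 _ 2) ?mulr_ge0 ?nrm_ge0//; apply/eqP.
by rewrite exprMn !nrm_sqr ipZl// ipC ipZl//; ring.
Qed.

Lemma fpair_Z (r : R) f g : 0 < r -> fpair f g -> fpair (fun x => r%:C%C * f x) (fun x => r%:C%C * g x).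
Proof.
move=> r0 [f2 g2 H]; split; [exact: L2Z|exact: L2Z|] => e e0.
have [p [p1 p2]] := H _ (divr_gt0 e0 r0).
have S (a b : R -> C) : (fun x => r%:C%C * a x) \- (fun x => r%:C%C * b x) = (fun x => r%:C%C * (a \- b) x).
  by apply/funext => x /=; rewrite mulrBr.
exists (r%:C%C *: p); rewrite FTZ !pGZ !S !nrmZ ?(ltW r0)//; try by apply: L2B => //; exact: L2_pG.
by rewrite ![r * _]mulrC -!ltr_pdivlMr.
Qed.

End Conjugation.

Opaque nrm.

(** * Nearly concentrated functions for densities above 1/2 *)

Section Chain.
Variable R : realType.
Local Notation T := (lebesgueType R).
Local Notation mu := (@completed_lebesgue_measure R).
Local Notation C := R[i].
Variable kappa : R.
Hypothesis k0 : 0 < kappa.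
Local Notation rho := (rho kappa).
Implicit Types (f h u k c s : R -> C) (E F : set R).

Lemma rho_gt0 x : 0 < rho x.
Proof.
rewrite /Defs.rho; case: eqP => // /eqP x0.
by rewrite lt_min ltr01 divr_gt0// normr_gt0.
Qed.

Lemma rho_le1 x : rho x <= 1.
Proof. by rewrite /Defs.rho; case: eqP => // _; rewrite ge_min lexx. Qed.

Lemma rho_lb (A x : R) : 0 < A -> `|x| <= A -> Num.min 1 (kappa / A) <= rho x.
Proof.
move=> A0 xA; rewrite /Defs.rho; case: eqP => [_|/eqP x0]; first by rewrite ge_min lexx.
rewrite le_min ge_min lexx/= ge_min; apply/orP; right.
by rewrite ler_pM2l// lef_pV2 ?posrE ?normr_gt0.
Qed.

Definition window (x : R) (w : R -> R) := side_Int true (x - rho x) (x + rho x) w.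

(** The comparison is with half of [-S, S] and not with half of the window, so that adding a comb in
    an annulus adds to both sides. The slack t collects the rounding errors of the combs. *)
Definition half_dense (t : R) E (S : R) := [/\ 0 <= S, measurable (E : set T),
  E `<=` `[- S, S] &
  forall x, window x (\1_E) <= window x (\1_`[- S, S]) / 2 + t * rho x].

Lemma loc_itg_indic E : measurable (E : set T) -> loc_itg (\1_E : R -> R).
Proof. by move=> mE; apply: (@loc_itg_bounded _ _ 1); [exact: mf_indic|exact: indic_norm_le1]. Qed.

Lemma window_le x v w : loc_itg v -> loc_itg w -> (forall y, v y <= w y) -> window x v <= window x w.
Proof. by move=> lv lw vw; apply: side_Int_le. Qed.

Lemma window_cst x (a : R) : window x (fun=> a) = a * (2 * rho x).
Proof. by rewrite /window side_Int_cst; [ring|have := rho_gt0 x; lra]. Qed.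

Lemma window_ge0 x w : (forall y, 0 <= w y) -> 0 <= window x w.
Proof. by move=> w0; apply: Int_ge0 => y; rewrite mulr_ge0// indicE ler0n. Qed.

Lemma half_dense_thin t E S eps : half_dense t E S -> 1 + t <= 2 * eps ->
  wolff_thin eps kappa E.
Proof.
move=> [S0 mE ES H] te; split => // x.
have r0 := rho_gt0 x.
have mI : measurable (Iwolff kappa x : set T) by exact: itv_measurable.
have mEI : measurable (E `&` Iwolff kappa x : set T) by exact: measurableI.
have lE := loc_itg_indic mE; have lS := loc_itg_indic (itv_measurable `[- S, S]).
have iw := itg_side true (x - rho x) (x + rho x) lE.
have le y : `|\1_(E `&` Iwolff kappa x) y| <= \1_(side true (x - rho x) (x + rho x)) y * \1_E y :> R.
  rewrite setIC indicI /= ger0_norm; last by rewrite mulr_ge0// indicE ler0n.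
  apply: ler_wpM2r; first by rewrite indicE ler0n.
  rewrite !indicE ler_nat; case: (boolP (y \in Iwolff _ _)) => // /set_mem h.
  have -> : y \in side true (x - rho x) (x + rho x) = true; last by [].
  apply/mem_set; rewrite /side /= in_itv /=; move: h; rewrite /Iwolff /= in_itv /= => /andP[a b].
  by rewrite !ltW.
have ii := itg_le (mf_indic mEI) le iw.
have -> : (mu (E `&` Iwolff kappa x))%E = (Int (\1_(E `&` Iwolff kappa x)))%:E.
  by rewrite -(Int_EFin ii) integral_indic ?setIT.
rewrite lee_fin; apply: le_trans (_ : window x (\1_E) <= _).
  apply: Int_le => // y; apply: le_trans (ler_norm _) (le y).
apply: le_trans (H x) _.
have : window x (\1_`[- S, S]) <= window x (fun=> 1).
  by apply: window_le => //; exact: loc_itg_cst.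
rewrite window_cst => h.
have := ler_wpM2r (ltW r0) te; lra.
Qed.

Lemma half_dense_mono t t' E S : t <= t' -> half_dense t E S -> half_dense t' E S.
Proof.
move=> tt [S0 mE ES H]; split => // x; apply: le_trans (H x) _.
by rewrite lerD2l ler_pM2r// rho_gt0.
Qed.

Lemma half_dense0 : half_dense 0 set0 0.
Proof.
split => // x; rewrite mul0r addr0 indic0.
have -> : window x (fun=> 0) = 0 by rewrite window_cst mul0r.
by rewrite divr_ge0// window_ge0// => y; rewrite indicE ler0n.
Qed.

Definition annulus (S S' : R) : set R := `[- S', S'] `\` `[- S, S].

Lemma measurable_annulus S S' : measurable (annulus S S' : set T).
Proof. by apply: measurableD; exact: itv_measurable. Qed.

Lemma indic_annulus (S S' x : R) : S <= S' ->
  \1_(annulus S S') x = \1_`[- S', S'] x - \1_`[- S, S] x :> R.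
Proof.
move=> SS; rewrite !indicE in_setD !mem_setE !in_itv /=.
case: (boolP (- S <= x <= S)) => [/andP[h1 h2]|_] /=; last by rewrite andbT subr0.
have -> : - S' <= x by lra.
have -> : x <= S' by lra.
by rewrite subrr.
Qed.

(** The comb is half of the annulus plus half of its sign. Over any window the two sign integrals
    cost at most 4 d together, and d is small against every radius with centre in [-S' - 1, S' + 1].
    Other windows miss [-S', S'], their radius being at most 1. *)
Lemma half_dense_extend t t' E S S' d : half_dense t E S -> S <= S' -> 0 < d ->
  4 * d <= t' * Num.min 1 (kappa / (S' + 1)) -> 0 <= t -> 0 <= t' ->
  half_dense (t + t') (E `|` (comb d `&` annulus S S')) S'.
Proof.
move=> [S0 mE ES H] SS d0 dt t0 t'0.
have S'0 := le_trans S0 SS.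
have S'1 : 0 < S' + 1 by rewrite ltr_wpDl.
set E' := E `|` _.
have mE' : measurable (E' : set T).
  by apply: measurableU => //; apply: measurableI; [exact: measurable_comb|exact: measurable_annulus].
have E'S : E' `<=` `[- S', S'].
  move=> y [/ES|[_ [//]]]; rewrite /= !in_itv /= => /andP[h1 h2].
  by apply/andP; split; lra.
split => // x.
have r0 := rho_gt0 x; have r1 := rho_le1 x.
have [xS|xS] := leP `|x| (S' + 1); last first.
  apply: (@le_trans _ _ 0); last first.
    by rewrite addr_ge0 ?divr_ge0 ?window_ge0 ?mulr_ge0 ?addr_ge0 ?(ltW r0)// => y; rewrite indicE ler0n.
  have <- : window x (fun=> 0) = 0 by rewrite window_cst mul0r.
  apply: side_Int_le; [exact: loc_itg_indic|exact: loc_itg_cst|] => y /= /andP[y1 y2].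
  rewrite indicE; case: (boolP (y \in E')) => // /set_mem/E'S; rewrite /= in_itv /= => /andP[y3 y4].
  by exfalso; move: xS; rewrite ltNge ler_norml => /negP; apply; apply/andP; split; lra.
have ldec := rho_lb S'1 xS.
have D : 4 * d <= t' * rho x by apply: le_trans dt _; exact: ler_wpM2l.
have lE := loc_itg_indic mE; have lS := loc_itg_indic (itv_measurable `[- S, S]).
have lS' := loc_itg_indic (itv_measurable `[- S', S']).
have eE : (\1_E' : R -> R) = (fun y => \1_E y + (2^-1 * \1_`[- S', S'] y + (- 2^-1 * \1_`[- S, S] y +
     (2^-1 * (osc d y * \1_`[- S', S'] y) + - 2^-1 * (osc d y * \1_`[- S, S] y))))).
  apply/funext => y.
  have -> : \1_E' y = \1_E y + \1_(comb d) y * \1_(annulus S S') y :> R.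
    rewrite !indicE in_setU in_setI; case: (boolP (y \in E)) => [yE|_] /=; last first.
      by rewrite add0r; case: (y \in comb d); case: (y \in annulus _ _); rewrite /= ?mul1r ?mul0r.
    have -> : (y \in annulus S S') = false.
      by apply/negbTE; rewrite notin_setE => -[_]; apply; apply: ES; exact: set_mem.
    by rewrite mulr0 addr0.
  by rewrite indic_comb indic_annulus//; field.
have lo := loc_itg_oscM d lS; have lo' := loc_itg_oscM d lS'.
have l1 := loc_itgZ 2^-1 lS'; have l2 := loc_itgZ (- 2^-1) lS.
have l3 := loc_itgZ 2^-1 lo'; have l4 := loc_itgZ (- 2^-1) lo.
rewrite /window eE (side_Int_D _ _ _ lE (loc_itgD l1 (loc_itgD l2 (loc_itgD l3 l4)))).
rewrite (side_Int_D _ _ _ l1 (loc_itgD l2 (loc_itgD l3 l4))) (side_Int_D _ _ _ l2 (loc_itgD l3 l4)) (side_Int_D _ _ _ l3 l4).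
rewrite (side_Int_Z _ _ _ _ lS') (side_Int_Z _ _ _ _ lS) (side_Int_Z _ _ _ _ lo') (side_Int_Z _ _ _ _ lo).
have h1 := side_Int_osc_indic (x - rho x) (x + rho x) (- S) S d0.
have h2 := side_Int_osc_indic (x - rho x) (x + rho x) (- S') S' d0.
rewrite !ler_norml in h1 h2.
have := H x; rewrite /window; move: h1 h2 => /andP[h1 h1'] /andP[h2 h2'].
by lra.
Qed.

(* [c] is the part of the transform of [u] that still lies outside [F]; it has
   norm close to 1 and high frequencies.  One step moves it into an extension of
   [F], which creates a new such part on the space side, so that the two sides
   are exchanged at each step.  The error [s] stays bounded. *)
Definition chain (t eta : R) (n : nat) := exists E F S Q u k c s,
  [/\ half_dense (n%:R * t) E S /\ half_dense (n%:R * t) F Q,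
      fpair u (fun x => k x + c x + s x) /\ [/\ L2 k, L2 c & L2 s],
      Pop E u = u /\ Pop F k = k,
      [/\ nrm (cutoff Q c) <= eta, 1 - n%:R * (2 * eta) <= nrm c, nrm c <= 1 &
        nrm s <= 1 + n%:R * (2 * eta)] &
      n%:R / 4 <= nrm u ^+ 2 + nrm k ^+ 2].

(** The starting function is 0: the error s = - c cancels c, whose role is only to supply norm 1 to
    the first step. With Q = 0 the cutoff is carried by a point. *)
Lemma chain0 t eta : 0 <= eta -> chain t eta 0.
Proof.
move=> eta0.
pose c := Pop `[0, 1]%classic (fun=> 1 : C).
have cE x : nsq (c x) = \1_`[0, 1] x :> R.
  by rewrite /c PopE indicE; case: (x \in _); rewrite /nsq /= ?expr1n expr0n addr0.
have c2 : L2 c.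
  apply: (@L2_le _ c (\1_`[0, 1])).
  - have -> : (fun x => complex.Re (c x)) = \1_`[0, 1].
      by apply/funext => x; rewrite /c PopE indicE; case: (x \in _).
    by apply: mf_indic; exact: itv_measurable.
  - have -> : (fun x => complex.Im (c x)) = (fun=> 0).
      by apply/funext => x; rewrite /c PopE; case: (x \in _).
    exact: mf_cst.
  - exact: itg_indic_itv.
  - by move=> x; rewrite cE.
have c1 : nrm c = 1.
  apply/eqP; rewrite -(@eqrXn2 _ 2) ?nrm_ge0// nrm_sqr expr1n ipff; apply/eqP.
  have -> : (fun x => nsq (c x)) = (fun x => \1_`[0, 1] x * 1).
    by apply/funext => x; rewrite cE mulr1.
  have [-> _] := Int_itv ler01 (@has_deriv_id R) (@cst_continuous _ _ (1 : R)).
  by rewrite subr0.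
have L0 := L20 R.
have z : fpair (fun=> 0 : C) (fun=> 0 : C).
  have := fpair_B (fpair_pG (0 : {poly C})) (fpair_pG (0 : {poly C})).
  have zz (f : R -> C) : f \- f = (fun=> 0) by apply/funext => x /=; rewrite subrr.
  by rewrite !zz.
exists set0, set0, 0, 0, (fun=> 0), (fun=> 0), c, (fun x => - c x); split.
- by rewrite mul0r; split; exact: half_dense0.
- split; last by split => //; exact: L2N.
  have -> : (fun x => 0 + c x + - c x) = (fun=> 0) by apply/funext => x; rewrite add0r subrr.
  exact: z.
- by split; apply/funext => x; rewrite PopE in_set0.
- rewrite mul0r subr0 addr0 nrmN c1; split => //.
  have -> : nrm (cutoff 0 c) = nrm (fun=> 0 : C).
    apply: ae_nrm => //; first exact: L2_cutoff.
    apply: (ae_imply (ae_neq 0)) => x x0; rewrite /cutoff PopE.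
    case: ifP => // /set_mem; rewrite /= oppr0 in_itv /= => /andP[h1 h2].
    by exfalso; apply: x0; apply/eqP; rewrite eq_le h1 h2.
  by rewrite nrm0.
- by rewrite mul0r addr_ge0// sqr_ge0.
Qed.

Lemma chain_step t eta n : 0 < t -> 0 < eta -> n.+1%:R * (2 * eta) <= 2^-1 ->
  chain t eta n -> chain t eta n.+1.
Proof.
move=> t0 eta0 neta [E [F [S [Q [u [k [c [s [[hE hF] [ug [k2 c2 s2]] [Eu Fk] [cQ cl cu sl] uk]]]]]]]]].
have [S0 mE ES _] := hE; have [Q0 mF FQ _] := hF.
(* Most of c lies in the annulus between Q and a large Q': the inner part is small by assumption,
   the outer part by the choice of Q'. *)
have [m [m1 m2]] : exists m : nat, nrm (c \- cutoff m%:R c) < eta /\ Q <= m%:R.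
  exact: (filter_ex (filterI (cvg_nrm_small (cutoff_cvg c2) eta0) (nbhs_infty_ger Q))).
set Q' : R := m%:R in m1 m2.
pose A := annulus Q Q'; have mA := measurable_annulus Q Q'.
pose b := Pop A c; have b2 : L2 b by exact: L2_Pop.
have cb : nrm (c \- b) <= 2 * eta.
  have -> : c \- b = (c \- cutoff Q' c) \+ cutoff Q c.
    apply/funext => x; rewrite /= /b /cutoff /Pop indic_annulus// rmorphB /=; ring.
  apply: le_trans (nrmD (L2B c2 (L2_cutoff _ c2)) (L2_cutoff _ c2)) _.
  by move: m1 cQ; move: (nrm _) (nrm _) => x y; clear; lra.
have bl : nrm c - 2 * eta <= nrm b.
  rewrite lerBlDr; apply: le_trans (nrm_le_add c2 b2) _.
  by rewrite lerD2l.
have bu : nrm b <= nrm c by exact: nrm_Pop_le.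
have r0 : 0 < t * Num.min 1 (kappa / (Q' + 1)).
  rewrite mulr_gt0// lt_min ltr01 divr_gt0//.
  by rewrite ltr_wpDl// (le_trans Q0).
have cD : 4 * j.+1%:R^-1 @[j --> \oo] --> (0 : R).
  by rewrite -(mulr0 4); apply: cvgM; [exact: cvg_cst|exact: cvg_harmonic].
have e8 : 0 < 8^-1 :> R by rewrite invr_gt0.
(* Three demands on the comb step d: the new high-frequency part avoids [-S, S] up to eta, the sign
   makes b almost orthogonal to itself, and the new set stays half dense. *)
have [j [[j1 j2] j3]] := filter_ex (filterI (filterI (osc_low_frequency S (L2_cj b2) eta0)
  (ip_osc_cvg b2 e8)) (cvg_nrm_small cD r0)).
set d := j.+1%:R^-1 in j1 j2 j3; have d0 : 0 < d by rewrite invr_gt0.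
have ob2 := L2_oscM d b2.
pose F' := F `|` (comb d `&` A).
(* b plus its oscillation is 2 b on the comb and 0 off it, so [k'] is carried by [F']. *)
pose k' x := k x + (b x + oscM d b x).
have [a' a'b] := fpair_ex_inv ob2; have [a'2 _ _] := a'b.
pose s' := (c \- b) \+ s; have s'2 : L2 s' by apply: L2D => //; exact: L2B.
have [r rs] := fpair_ex_inv s'2; have [r2 _ _] := rs.
have kF x : x \notin F -> k x = 0.
  by move=> xF; rewrite -Fk PopE (negbTE xF).
have bA x : x \notin A -> b x = 0.
  by move=> xA; rewrite /b PopE (negbTE xA).
have F'k' : Pop F' k' = k'.
  apply/funext => x; rewrite PopE; case: ifPn => //; rewrite in_setU negb_or in_setI negb_and.
  move=> /andP[xF /orP[xc|xA]]; rewrite /k' kF// add0r; last by rewrite /oscM bA// mulr0 addr0.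
  by rewrite /oscM /osc indicE (negbTE xc) mulr0 sub0r rmorphN1 mulN1r subrr.
(* [k'] differs from the transform of u by the oscillation of b and the error [s']; their preimages
   [a'] and [r] provide the new remaining part and the new error. *)
have P1 : fpair (cj k') (fun x => cj u x + cj a' x + - cj r x).
  have -> : (fun x => cj u x + cj a' x + - cj r x) = cj ((u \+ a') \- r).
    by rewrite cjB; apply/funext => x; congr (_ - _); apply: complexE; rewrite /cj !(ReD,ImD,Re_conjc,Im_conjc) ?opprD.
  apply: fpair_conj.
  have -> : k' = ((fun x => k x + c x + s x) \+ oscM d b) \- s'.
    by apply/funext => x; rewrite /k' /s' /=; ring.
  exact: fpair_B (fpair_D ug a'b) rs.
have k'2 : L2 k' by apply: L2D => //; exact: L2D.
have kb : ip k (b \+ oscM d b) = 0.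
  rewrite -[RHS](Int0 R); congr Int; apply/funext => x.
  case: (boolP (x \in F)) => [xF|xF]; last by rewrite kF// /dot /= !mul0r addr0.
  have xA : x \notin A by rewrite notin_setE => -[_]; apply; apply: FQ; exact: set_mem.
  by rewrite /= /oscM bA// mulr0 addr0 /dot /= !mulr0 addr0.
have kk' : nrm k' ^+ 2 = nrm k ^+ 2 + nrm (b \+ oscM d b) ^+ 2.
  have -> : nrm k' = nrm (k \+ (b \+ oscM d b)) by [].
  by rewrite (nrmD_sqr k2 (L2D b2 ob2)) kb mulr0 addr0.
have bo : nrm (b \+ oscM d b) ^+ 2 = 2 * nrm b ^+ 2 + 2 * ip (oscM d b) b.
  by rewrite nrmD_sqr// nrm_oscM [ip b _]ipC; ring.
(* The total loss over all steps, (n+1) 2 eta, is at most 1/2. *)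
have nb : 2^-1 <= nrm b.
  move: neta cl bl; rewrite -natr1 mulrDl mul1r.
  by move: (nrm b) (nrm c) (n%:R * _) => x y z; clear; lra.
have nb2 : 4^-1 <= nrm b ^+ 2.
  by move: nb; move: (nrm b) => x; clear; rewrite expr2; nra.
have nt : n.+1%:R * t = n%:R * t + t by rewrite -natr1 mulrDl mul1r.
have na' : nrm a' = nrm b by rewrite -(fpair_nrm a'b) nrm_oscM.
have u2 : L2 u by case: ug.
exists F', E, Q', S, (cj k'), (cj u), (cj a'), (fun x => - cj r x); split.
- split; last by apply: half_dense_mono hE; rewrite nt lerDl ltW.
  rewrite nt; apply: half_dense_extend => //; [exact: ltW|by rewrite mulr_ge0// ltW|exact: ltW].
- split; first exact: P1.
  by split; [exact: L2_cj|exact: L2_cj|apply: L2N; exact: L2_cj].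
- by rewrite !Pop_cj F'k' Eu.
- rewrite nrmN !nrm_cj na' (_ : n.+1%:R * (2 * eta) = n%:R * (2 * eta) + 2 * eta); last first.
    by rewrite -natr1 mulrDl mul1r.
  split.
  + by apply: ltW; apply: j1; rewrite -cj_oscM; exact: fpair_conj.
  + move: cl bl; move: (nrm b) (nrm c) (n%:R * _) => x y z; clear; lra.
  + exact: le_trans bu cu.
  + rewrite -(fpair_nrm rs); apply: le_trans (nrmD (L2B c2 b2) s2) _.
    by move: cb sl; move: (nrm _) (nrm _) (n%:R * _) => x y z; clear; lra.
(* The gain is 2 |b|^2 + 2 <osc b, b>, at least 2/4 - 2/8 = 1/4. *)
- rewrite !nrm_cj kk' bo -natr1 mulrDl.
  move: j2; rewrite ltr_norml => /andP[h1 _]; move: uk nb2 h1.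
  move: (nrm k ^+ 2) (nrm u ^+ 2) (nrm b ^+ 2) (ip _ _) => x y z w; clear; lra.
Qed.

(** h is the function with transform exactly k. It differs from u, which is carried by E, by the
    preimage of c + s, of norm at most 1 + 3/2 however long the chain is. *)
Lemma almost_concentrated (eps U0 : R) : 2^-1 < eps -> 0 <= U0 ->
  exists E F h k U, [/\ wolff_thin eps kappa E /\ wolff_thin eps kappa F,
    fpair h k, Pop F k = k, U0 <= U & U - 3 <= nrm (Pop E h) /\ nrm h <= U + 3].
Proof.
move=> e1 U00.
(* If the norm of u were below U0, that of k would be below U0 + 3, and the energy N / 4 could not
   be reached. *)
have [N N0 NU] : exists2 N : nat, 0 < N%:R :> R & 4 * (U0 ^+ 2 + (U0 + 3) ^+ 2) < N%:R.
  exists (Num.truncn (4 * (U0 ^+ 2 + (U0 + 3) ^+ 2))).+1; first by rewrite ltr0n.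
  exact: truncnS_gt.
have [t t0 Nt] : exists2 t : R, 0 < t & N%:R * t = eps - 2^-1.
  exists ((eps - 2^-1) / N%:R); first by rewrite divr_gt0// subr_gt0.
  by rewrite mulrCA divff ?mulr1// gt_eqF.
have [eta eta0 Ne] : exists2 eta : R, 0 < eta & N%:R * (2 * eta) = 2^-1.
  exists (4 * N%:R)^-1; first by rewrite invr_gt0 mulr_gt0.
  by field; rewrite gt_eqF.
have ch n : (n <= N)%N -> chain t eta n.
  elim: n => [_|n IH nN]; first by apply: chain0; exact: ltW.
  apply: chain_step => //; last by apply: IH; exact: ltnW.
  by rewrite -Ne ler_pM2r ?mulr_gt0// ler_nat.
have [E [F [S [Q [u [k [c [s [[hE hF] [ug [k2 c2 s2]] [Eu Fk] [cQ cl cu sl] uk]]]]]]]]] := ch N (leqnn _).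
have te : 1 + N%:R * t <= 2 * eps by rewrite Nt; lra.
have tE := half_dense_thin hE te; have tF := half_dense_thin hF te.
have mE := proj1 tE.
have [h hk] := fpair_ex_inv k2; have [h2 _ _] := hk; have [u2 _ _] := ug.
have uh : nrm (u \- h) <= 3.
  rewrite -(fpair_nrm (fpair_B ug hk)).
  have -> : (fun x => k x + c x + s x) \- k = c \+ s.
    by apply/funext => x /=; rewrite addrC -addrA addKr.
  apply: le_trans (nrmD c2 s2) _; rewrite Ne in sl; move: cu sl; clear; lra.
have hu1 := nrm_le_add h2 u2; rewrite nrmBC in hu1.
have hu : nrm h <= nrm u + 3 by apply: le_trans hu1 _; rewrite lerD2l.
exists E, F, h, k, (nrm u); split => //.
  rewrite leNgt; apply/negP => Ul.
  have n0 := nrm_ge0 u; have n1 := nrm_ge0 k.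
  have a1 : nrm u ^+ 2 <= U0 ^+ 2 by rewrite ler_sqr ?nnegrE// ltW.
  have a2 : nrm k ^+ 2 <= (U0 + 3) ^+ 2.
    rewrite ler_sqr ?nnegrE ?addr_ge0// (fpair_nrm hk); apply: le_trans hu _.
    by rewrite lerD2r ltW.
  have := lerD a1 a2; move: uk NU; clear; set w := _ + _; set w' := _ + _; lra.
split => //.
have := nrm_le_add (L2_Pop mE u2) (L2_Pop mE h2).
have -> : Pop E u \- Pop E h = Pop E (u \- h) by apply/funext => x; rewrite /Pop /= mulrBr.
rewrite Eu lerBlDr => /le_trans; apply; rewrite lerD2l.
exact: le_trans (nrm_Pop_le mE (L2B u2 h2)) uh.
Qed.

(** The normalised h has its transform carried by F, so [Qop F] fixes it almost everywhere and it is
    a test function for the operator norm. *)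
Lemma Theta_ge_ratio (eps r : R) E F h k : wolff_thin eps kappa E -> wolff_thin eps kappa F ->
  fpair h k -> Pop F k = k -> 0 < nrm h -> r * nrm h <= nrm (Pop E h) -> (r%:E <= Theta kappa eps)%E.
Proof.
move=> tE tF hk Fk hp rh; have mE := proj1 tE; have mF := proj1 tF.
have [h2 k2 _] := hk.
have ip0 : 0 < (nrm h)^-1 by rewrite invr_gt0.
pose f x : C := ((nrm h)^-1)%:C%C * h x.
have fk : fpair f (fun x => ((nrm h)^-1)%:C%C * k x) := fpair_Z ip0 hk.
have [f2 fk2 _] := fk.
have nf : nrm f = 1 by rewrite /f nrmZ ?(ltW ip0)// mulVf// gt_eqF.
have mPf := fpair_plancherel f2; have [_ pf2 _] := mPf.
have Q1 := fpair_Qop mF f2; have [q2 _ _] := Q1.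
have Q2 : fpair f (Pop F (plancherel f)).
  apply: (fpair_aer fk); first exact: L2_Pop.
  apply: (ae_imply (fpair_uniqr fk mPf)) => x e.
  by rewrite /Pop -e -{1}Fk /Pop mulrCA.
have qf := fpair_uniql Q1 Q2.
apply: le_trans (_ : (cLnorm 2%:E (Pop E (Qop F f)) <= _)%E).
  rewrite cLnorm2E ?lee_fin; last exact: L2_Pop.
  have -> : nrm (Pop E (Qop F f)) = nrm (Pop E f).
    apply: ae_nrm; [exact: L2_Pop|exact: L2_Pop|].
    by apply: (ae_imply qf) => x e; rewrite /Pop e.
  have -> : Pop E f = (fun x => ((nrm h)^-1)%:C%C * Pop E h x).
    by apply/funext => x; rewrite /f /Pop mulrCA.
  rewrite nrmZ ?(ltW ip0)//; last exact: L2_Pop.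
  by rewrite mulrC ler_pdivlMr.
apply: le_trans (_ : (opnorm2 (Pop E \o Qop F) <= _)%E); last first.
  by apply: ereal_sup_ubound; exists E; [exact: tE|exists F; [exact: tF|exact: erefl]].
apply: ereal_sup_ubound; exists f; last exact: erefl.
split; first exact/L2P.
by rewrite (cLnorm2E f2) nf.
Qed.

Lemma Theta_ge (eps r : R) : 2^-1 < eps -> 0 <= r < 1 -> (r%:E <= Theta kappa eps)%E.
Proof.
move=> e1 /andP[r0 r1].
have r1' : 0 < 1 - r by rewrite subr_gt0.
(* U0 (1 - r) >= 3 + 3 r makes the ratio (U - 3) / (U + 3) at least r; the summand 4 keeps U - 3
   positive. *)
have [U0 U00 U0r] : exists2 U0 : R, 4 <= U0 & r * (U0 + 3) <= U0 - 3.
  exists (4 + (3 + 3 * r) / (1 - r)); first by rewrite lerDl divr_ge0 ?(ltW r1')//; lra.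
  have e : (3 + 3 * r) / (1 - r) * (1 - r) = 3 + 3 * r by rewrite divfK// gt_eqF.
  by move: e; set w := _ / _; lra.
have [|E [F [h [k [U [[tE tF] hk Fk UU [Eh hU]]]]]]] := @almost_concentrated eps U0 e1.
  by lra.
have rU : r * (U + 3) <= U - 3.
  have := ler_wpM2l (ltW r1') UU; lra.
have [h2 _ _] := hk.
apply: (Theta_ge_ratio tE tF hk Fk).
  apply: lt_le_trans (nrm_Pop_le (proj1 tE) h2); apply: lt_le_trans Eh; lra.
by apply: le_trans Eh; apply: le_trans rU; exact: ler_wpM2l.
Qed.

Lemma Theta_not_lt1 (eps : R) : (Theta kappa eps < 1)%E -> eps <= 2^-1.
Proof.
move=> th1; rewrite leNgt; apply/negP => e1.
have H r (h : 0 <= r < 1) := Theta_ge e1 h.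
have h0 : 0 <= (0 : R) < 1 by rewrite lexx ltr01.
(* r = 0 excludes the value -oo; for a finite v < 1 the midpoint of v and 1 gives a
   contradiction. *)
move: th1 H (H 0 h0); case: (Theta kappa eps) => [v||] //=.
rewrite lte_fin lee_fin => v1 /(_ ((v + 1) / 2)); rewrite lee_fin => H v0.
have : 0 <= (v + 1) / 2 < 1 by apply/andP; split; lra.
by move=> /H; lra.
Qed.

End Chain.

(** * The critical density and its limit *)

Section CriticalDensity.
Variable R : realType.
Implicit Types kappa : R.

Lemma eps_c_le kappa : 0 < kappa <= 1 -> eps_c kappa <= 1 / 2.
Proof.
move=> k01; have /andP[k0 k1] := k01; apply: ge_sup.
  (* An upper bound passes to [sup] once the set is nonempty; half of the lower bound is a
     member. *)
  pose t : R := 1 / (2 * (1 + 32 * kappa)).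
  have d0 : 0 < 2 * (1 + 32 * kappa) by rewrite mulr_gt0// addr_gt0// mulr_gt0.
  have t0 : 0 < t by rewrite divr_gt0.
  have t1 : t < 1 by rewrite ltr_pdivrMr//; lra.
  exists (t / 2); split; first lra.
  by apply: Theta_lt1 => //; rewrite -/t; lra.
by move=> eps [_ /(Theta_not_lt1 k0)]; rewrite div1r.
Qed.

Lemma lower_bound_cvg :
  1 / (2 * (1 + 32 * kappa)) @[kappa --> (0 : R)^'+] --> (1 / 2 : R).
Proof.
apply: cvg_at_right_filter.
have e : (1 / 2 : R) = 1 * (2 * (1 + 32 * 0))^-1 by rewrite mulr0 addr0 mulr1.
rewrite e; apply: cvgM; first exact: cvg_cst.
apply: cvgV; first by rewrite mulr0 addr0 mulr1 pnatr_eq0.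
apply: cvgM; first exact: cvg_cst.
apply: cvgD; first exact: cvg_cst.
by apply: cvgM; [exact: cvg_cst|exact: cvg_id].
Qed.

End CriticalDensity.

Theorem theorem1p2 (R : realType) :
  (forall kappa : R, 0 < kappa <= 1 ->
     1 / (2 * (1 + 32 * kappa)) <= eps_c kappa <= 1 / 2) /\
  eps_c kappa @[kappa --> (0 : R)^'+] --> (1 / 2 : R).
Proof.
have H (kappa : R) : 0 < kappa <= 1 -> 1 / (2 * (1 + 32 * kappa)) <= eps_c kappa <= 1 / 2.
  by move=> k01; rewrite eps_c_ge// eps_c_le.
split => //; apply: (squeeze_cvgr _ (@lower_bound_cvg R) (cvg_cst (1 / 2 : R))).
near=> kappa; apply: H; apply/andP; split; near: kappa.
  exact: nbhs_right_gt.
by apply: nbhs_right_le.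
Unshelve. all: by end_near. Qed.
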